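(* There is a continuous strictly decreasing function $\beta:[0,2/e]\to[2/e,\sqrt2]$ with $\beta(0)=\sqrt2$ and $\beta(2/e)=2/e$, whose values for $0<a<2/e$ are characterized as follows: $\beta(a)$ is the unique $b\in(a,\sqrt2)$ with $\mathcal E(a,b)=1$; if $rs(1+d^2)\le 2$, then $$\beta(a)=2a-2d+\sqrt{2d^2+\frac{4}{rs}-2},$$ and if $rs(1+d^2)>2$, then $\beta(a)=a+\ell_a$, where $\ell_a$ is the unique root in $(0,a]$ of $\Psi_a(\ell)=0$. This function has the following property. Let $\tau:\mathbb R\to\mathbb R$ be nondecreasing with $\tau(t)\le t$ and $\tau(t)\to\infty$ as $t\to\infty$, and set $$a=\liminf_{t\to\infty}(t-\tau(t)),\qquad b=\limsup_{t\to\infty}(t-\tau(t)).$$ If the equation $x''(t)=x(\tau(t))$ has an eventually positive decreasing solution, then $$a\le 2/e,\qquad b\le\beta(a).$$ The bound $b\le\beta(a)$ is sharp: for every $a\in[0,2/e]$ there is a nondecreasing $\tau$ with $\tau(t)\le t$, $\tau(t)\to\infty$, $\liminf_{t\to\infty}(t-\tau(t))=a$ and $\limsup_{t\to\infty}(t-\tau(t))=\beta(a)$ for which $x''(t)=x(\tau(t))$ has a strictly positive decreasing solution.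
   Context: Differential equations are understood in the Carathéodory sense: a solution on a half-line $[t_0,\infty)$ is a function that is continuous on an interval containing $[t_0,\infty)$ and $\tau([t_0,\infty))$, is $C^1$ with locally absolutely continuous derivative on $[t_0,\infty)$, and satisfies the equation for almost every $t\ge t_0$. For $0<a<2/e$ let $r=-\frac2aW_0(-a/2)>0$ and $s=\frac2aW_0(a/2)>0$, where $W_0$ is the principal Lambert branch (equivalently, $r$ is the smaller positive root of $r^2=e^{ar}$ and $s$ is the positive root of $s^2=e^{-as}$), and put $d=\frac1s-\frac1r$. Definition of $\mathcal E(a,b)$. For $0<a<2/e$ let $X_{2/a}$ be the Banach space of $f\in C(\mathbb R)$ with $\|f\|=\sup_{t\in\mathbb R}e^{2t/a}|f(t)|<\infty$. Let $(S_af)(t)=f(t-a)$ and $(Tg)(t)=\int_t^\infty(u-t)g(u)\,du$. For $b\ge a$ let $\mathbf 1_{[a,b]}$ and $\mathbf 1_{[a,b]^c}$ denote the indicator functions of $[a,b]$ and of its complement $\mathbb R\setminus[a,b]$ (also the corresponding multiplication operators). Define $$\Phi_{a,b}=\sum_{j=0}^\infty\bigl(T\,\mathbf 1_{[a,b]^c}S_a\bigr)^j\,T\mathbf 1_{[a,b]},$$ a convergent series in $X_{2/a}$, and $\mathcal E(a,b)=\Phi_{a,b}(0)$. Definition of $\Psi_a$. Set $I(z,\ell)=(e^{z\ell}-1)/z$ for $z\ne0$, $I(0,\ell)=\ell$, $c_+=\frac{r}{2-ar}$, $c_-=-\frac{s}{2+as}$, and $$\Psi_a(\ell)=[1+c_+(\ell-I(r,\ell))][1+c_-(\ell-I(-s,\ell))]-c_+c_-[I(r+s,\ell)-I(r,\ell)][I(-r-s,\ell)-I(-s,\ell)].$$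 *)

(* Defs.v *)
From HB Require Import structures.
From mathcomp Require Import all_boot all_order all_algebra.
From mathcomp Require Import all_classical all_reals all_analysis.
Set Implicit Arguments.
Unset Strict Implicit.
Unset Printing Implicit Defensive.
Import Order.TTheory GRing.Theory Num.Theory.
Import numFieldNormedType.Exports.
Local Open Scope classical_set_scope.
Local Open Scope ring_scope.

Section LambertParameters.
Variable R : realType.
Implicit Types a z l : R.

(* [w |-> w e^w] is injective on [-1, +oo[ with range [-1/e, +oo[; the value
   is 0 (junk) for x < -1/e. *)
Definition lambertW0 (x : R) : R :=
  xget 0 [set w : R | -1 <= w /\ w * expR w = x].

Definition rpar a : R := - (2 / a) * lambertW0 (- (a / 2)).
Definition spar a : R := (2 / a) * lambertW0 (a / 2).
Definition dpar a : R := (spar a)^-1 - (rpar a)^-1.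

Definition Ifun z l : R := if z == 0 then l else (expR (z * l) - 1) / z.

Definition cplus a : R := rpar a / (2 - a * rpar a).
Definition cminus a : R := - (spar a / (2 + a * spar a)).

Definition Psi a l : R :=
  let r := rpar a in let s := spar a in
  (1 + cplus a * (l - Ifun r l)) * (1 + cminus a * (l - Ifun (- s) l))
  - cplus a * cminus a * (Ifun (r + s) l - Ifun r l)
    * (Ifun (- r - s) l - Ifun (- s) l).

End LambertParameters.

Section Series.
Variable R : realType.
Implicit Types (a b t : R) (f g : R -> R).

(* The norm of X_{2/a}, with value +oo outside X_{2/a}. *)
Definition Xnorm a f : \bar R :=
  ereal_sup (range (fun t => (expR (2 * t / a) * `|f t|)%:E)).

Definition Xspace a : set (R -> R) :=
  [set f | continuous f /\ (Xnorm a f < +oo)%E].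

Definition Sop a f : R -> R := fun t => f (t - a).

Definition Top g : R -> R :=
  fun t => \int[lebesgue_measure]_(u in `[t, +oo[%classic) ((u - t) * g u).

Definition mulind (A : set R) f : R -> R := fun t => \1_A t * f t.

Definition Phi_term a b (j : nat) : R -> R :=
  iter j (fun f => Top (mulind (~` `[a, b]%classic) (Sop a f)))
    (Top (\1_(`[a, b]%classic))).

Definition Phi_partial a b (n : nat) : R -> R :=
  fun t => \sum_(j < n) Phi_term a b j t.

(* The sum of the series in X_{2/a}; the zero function if the series does not
   converge there. *)
Definition Phi a b : R -> R :=
  xget (fun _ => 0) [set F : R -> R |
    [/\ Xspace a F, forall n, Xspace a (Phi_partial a b n) &
        Xnorm a (fun t => Phi_partial a b n t - F t) @[n --> \oo] --> 0%E]].

Definition calE a b : R := Phi a b 0.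

End Series.

Section Solutions.
Variable R : realType.
Implicit Types (c p q t l : R) (f x y tau : R -> R) (A J : set R).

(* The derivative of f at t relative to A; one-sided at an endpoint of an
   interval A. *)
Definition has_deriv_within A f t l : Prop :=
  (f u - f t) / (u - t) @[u --> within A t^'] --> l.

Definition abs_continuous_on p q f : Prop :=
  forall eps : R, 0 < eps -> exists2 delta : R, 0 < delta &
    forall (n : nat) (u v : 'I_n -> R),
      (forall i, [/\ p <= u i, u i <= v i & v i <= q]) ->
      trivIset [set: 'I_n] (fun i => `]u i, v i[%classic) ->
      \sum_(i < n) (v i - u i) < delta ->
      \sum_(i < n) `|f (v i) - f (u i)| < eps.

(* x is a Caratheodory solution of x''(t) = x(tau(t)) on [t0, +oo[.  J is the
   interval on which x is defined (the values of x outside J are irrelevant)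
   and y is the derivative of x on [t0, +oo[. *)
Definition caratheodory_solution tau (t0 : R) J x : Prop :=
  [/\ is_interval J,
      `[t0, +oo[%classic `<=` J,
      tau @` `[t0, +oo[%classic `<=` J,
      {within J, continuous x} &
      exists y : R -> R,
        [/\ {within `[t0, +oo[%classic, continuous y},
            forall t, t0 <= t -> has_deriv_within `[t0, +oo[%classic x t (y t),
            forall q, t0 <= q -> abs_continuous_on t0 q y &
            {ae lebesgue_measure, forall t,
               t0 <= t -> is_derive t 1 y (x (tau t))}]].

(* "Decreasing" is taken in the weak sense here and in the strict sense in
   [has_positive_decreasing_solution].  An eventually positive nonincreasing
   solution is eventually strictly decreasing, being eventually strictly
   convex. *)
Definition has_eventually_positive_decreasing_solution tau : Prop :=
  exists (t0 : R) (J : set R) (x : R -> R),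
    caratheodory_solution tau t0 J x /\
    exists2 t1, t0 <= t1 &
      (forall t, t1 <= t -> 0 < x t) /\
      (forall u v, t1 <= u -> u <= v -> x v <= x u).

Definition has_positive_decreasing_solution tau : Prop :=
  exists (t0 : R) (J : set R) (x : R -> R),
    [/\ caratheodory_solution tau t0 J x,
        forall t, J t -> 0 < x t &
        forall u v, J u -> J v -> u < v -> x v < x u].

Definition admissible_delay tau : Prop :=
  [/\ {homo tau : u v / u <= v},
      forall t, tau t <= t &
      tau t @[t --> +oo] --> +oo].

Definition lag_liminf tau : \bar R :=
  limf_einf (fun t => (t - tau t)%:E) +oo%R.
Definition lag_limsup tau : \bar R :=
  limf_esup (fun t => (t - tau t)%:E) +oo%R.

End Solutions.

(* Main.v *)
(* For [0 <= a <= b] let [F] be the minimal nonnegative solution of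
   [F'' = 1] on [[a, b]] and [F''(t) = F(t - a)] elsewhere, decaying at infinity;
   it is dominated by [exp (- w t)] as soon as [exp (w a) < w ^ 2], and such a
   [w] exists exactly when [a < 2 / e].  Its value at 0 is [calE a b], which is
   continuous and strictly increasing in [a] and [b] while it stays below 1, so
   that [calE a b = 1] defines [b = beta a].  The explicit formulas come from
   the two first integrals of [x''(t) = x(t - a)] attached to the exponents [r]
   and [s], which express [1 - calE a b] through the values on one plateau.

   Necessity: if the lag is eventually at least [a] and is at least [b] at a late
   time [t], put [p = tau t].  Since [tau] is nondecreasing, [x'' >= x p] on
   [[p + a, p + b]], while [x''(u) >= x(u - a)] at the other late times.
   Integrating twice from infinity, [x (p + u) >= x p * F_n u] for every iterate
   [F_n] of the construction of [F], within a range of [u] that contains 0 when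
   [t] is late; at [u = 0] this gives [calE a b <= 1].

   Sharpness: take [b = beta a], so that [F 0 = 1] and hence [F''] is
   nonincreasing.  A sparse sum [y] of shifted multiples of [F] satisfies
   [y''(t) >= y(t - a)] with [y''] nonincreasing, so the equation
   [y''(t) = y(tau t)] can be solved for [tau]: the result is nondecreasing with
   lag at least [a], equal to [a] between the plateaus and approaching [b] at
   their right ends. *)
Require Import Defs.
From HB Require Import structures.
From mathcomp Require Import all_boot all_order all_algebra.
From mathcomp Require Import all_classical all_reals all_analysis.
From mathcomp Require Import measurable_realfun.
From mathcomp Require Import ring lra.
Import Order.TTheory GRing.Theory Num.Theory.
Import numFieldNormedType.Exports.
Local Open Scope classical_set_scope.
Local Open Scope ring_scope.
Set Implicit Arguments.
Unset Strict Implicit.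
Unset Printing Implicit Defensive.

(** * Tail integrals of exponentially dominated functions *)

(** All quantitative facts about [F] come from comparison: as the limit of iterates started at 0,
    [F] lies below every nonnegative supersolution. The [F] of neighbouring parameters, used as
    competitor, gives strict monotonicity in [a] and [b]; adding a multiple of exp (- w t) to it
    gives Lipschitz bounds. These bounds carry the factor 1 / (1 - exp (w a) / w ^ 2), which blows
    up as [a] tends to 2 / e, so continuity of beta at that end needs another source. It is the
    first integral attached to [r]: the derivative r (2 - a r) of the characteristic function at [r]
    tends to 0 there, which forces the plateau to shrink. Since x'' exists only almost everywhere,
    the necessity comparison rests on monotonicity of absolutely continuous functions with
    nonnegative derivative almost everywhere. The lag need not be eventually at least its lower
    limit, so necessity is proved for smaller [a] and passes to the limit by left continuity of
    beta. For sharpness, the upper bound on the lag is not computed: it is the necessary condition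
    applied to the constructed delay. *)

Section TailIntegrals.
Variable R : realType.
Notation mu := (@lebesgue_measure R).
Implicit Types (w C t p q c s u : R) (k g f : R -> R).

(** The bound is asked on the whole line, so growth like exp (- w t) towards minus infinity is
    allowed. Tail integrals and shifts by the lag stay in this class, with an explicit change of
    [C]. *)
Definition expdom w C k :=
  measurable_fun [set: R] k /\ forall t, 0 <= k t <= C * expR (- (w * t)).

(** Minus the derivative of [Top k]; [Vop k] itself has derivative [- k] wherever [k] is
    continuous. *)
Definition Vop k : R -> R := fun t => \int[mu]_(u in `[t, +oo[%classic) k u.

Definition expN w : R -> R := fun t => expR (- (w * t)).

Lemma is_derive_expN w t : is_derive t 1 (expN w) (- w * expN w t).
Proof.
have h : is_derive t 1 (fun t : R => - (w * t)) (- w).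
  by apply: is_derive_eq; rewrite /GRing.scale /= mulr1.
exact: (is_derive_eq (is_derive1_comp (is_derive_expR _) h) (mulrC _ _)).
Qed.

Lemma continuous_expN w : continuous (expN w).
Proof.
move=> t; apply: differentiable_continuous; apply/derivable1_diffP.
by have := is_derive_expN w t => -[].
Qed.

Lemma expN_gt0 w t : 0 < expN w t.
Proof. exact: expR_gt0. Qed.

Lemma expND w t s : expN w (t + s) = expN w t * expN w s.
Proof. by rewrite /expN mulrDr opprD expRD. Qed.

Lemma measurable_expN w : measurable_fun [set: R] (expN w).
Proof. by apply: continuous_measurable_fun; exact: continuous_expN. Qed.

Lemma cvg_expN w : 0 < w -> expN w t @[t --> +oo] --> 0.
Proof.
move=> w0; have /cvg_comp/(_ (@cvgr_expR R)) : (w * t) @[t --> +oo] --> +oo.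
  by apply: gt0_cvgMry => //; exact: cvg_id.
exact.
Qed.

Lemma tail_expN w t : 0 < w ->
  (\int[mu]_(u in `[t, +oo[) (expN w u)%:E = (expN w t / w)%:E)%E.
Proof.
move=> w0; pose F : R -> R := fun u => - (w^-1) * expN w u.
have dF (u : R) : is_derive u 1 F (expN w u).
  apply: (is_derive_eq (is_deriveZ (- w^-1) (is_derive_expN w u))).
  by rewrite /GRing.scale /= mulrA mulrNN mulVf ?mul1r// gt_eqF.
rewrite (@ge0_continuous_FTC2y R _ F t 0).
- by rewrite sub0e -EFinN /F mulNr opprK mulrC.
- by move=> u _; exact/ltW/expN_gt0.
- by apply: continuous_subspaceT => u; exact: continuous_expN.
- rewrite -[X in _ --> X](mulr0 (- w^-1)).
  by apply: cvgM; [exact: cvg_cst|exact: cvg_expN].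
- by move=> u _; have := dF u => -[].
- apply: cvg_at_right_filter; apply: differentiable_continuous.
  by apply/derivable1_diffP; have := dF t => -[].
- by move=> u _; rewrite derive1E; have := dF u => -[].
Qed.

Lemma integrable_expN w t : 0 < w ->
  mu.-integrable `[t, +oo[%classic (EFin \o expN w).
Proof.
move=> w0; apply/integrableP; split.
  by apply/measurable_EFinP; apply: measurable_funTS; exact: measurable_expN.
under eq_integral do rewrite /= ger0_norm ?(ltW (expN_gt0 _ _))//.
by rewrite tail_expN// ltry.
Qed.

Lemma Vop_expN w t : 0 < w -> Vop (expN w) t = expN w t / w.
Proof. by move=> w0; rewrite /Vop /Rintegral tail_expN. Qed.

Lemma integrable_dominated w C t k : 0 < w ->
  measurable_fun [set: R] k ->
  (forall u, t <= u -> `|k u| <= C * expN w u) ->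
  mu.-integrable `[t, +oo[%classic (EFin \o k).
Proof.
move=> w0 mk kC.
apply: (@le_integrable _ _ R mu _ _ _ (EFin \o (fun u => C * expN w u))) => //.
- by apply: measurable_funTS; exact/measurable_EFinP.
- move=> u; rewrite /= in_itv /= andbT => tu.
  rewrite lee_fin; apply: le_trans (ler_norm _); exact: kC.
- have -> : (EFin \o (fun u => C * expN w u)) =
      (fun u => C%:E * (EFin \o expN w) u)%E by [].
  by apply: integrableZl => //; exact: integrable_expN.
Qed.

Lemma integrable_expdom w C k t : 0 < w -> expdom w C k ->
  mu.-integrable `[t, +oo[%classic (EFin \o k).
Proof.
move=> w0 [mk kC]; apply: (integrable_dominated (w := w) (C := C)) => // u _.
by have /andP[k0 kC'] := kC u; rewrite ger0_norm.
Qed.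

Lemma linear_le_exp w (z : R) : 0 < w -> z <= expR (w * z) / w.
Proof.
move=> w0; rewrite ler_pdivlMr// mulrC.
by apply: le_trans (expR_ge1Dx _); rewrite lerDr.
Qed.

Lemma expdom_ge0 w C k t : expdom w C k -> 0 <= C.
Proof.
move=> [_ /(_ t)/andP[k0 kC]]; have := le_trans k0 kC.
by rewrite pmulr_lge0// expR_gt0.
Qed.

(* The weight is halved to absorb the linear factor. *)
Lemma moment_bound w C k s u : 0 < w -> expdom w C k -> s <= u ->
  `|(u - s) * k u| <= (2 / w * C * expR (- (w / 2 * s))) * expN (w / 2) u.
Proof.
move=> w0 dk su; have C0 := expdom_ge0 0 dk; case: dk => _ /(_ u)/andP[k0 kC].
rewrite normrM (ger0_norm k0) ger0_norm ?subr_ge0//.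
have w20 : 0 < w / 2 by rewrite divr_gt0.
have h := linear_le_exp (u - s) w20.
apply: (le_trans (ler_pM _ k0 h kC)); first by rewrite subr_ge0.
rewrite le_eqVlt; apply/orP; left; apply/eqP.
have -> : expR (w / 2 * (u - s)) = expN (w/2) s * expR (w/2*u).
  by rewrite /expN -expRD; congr expR; ring.
have -> : expR (- (w * u)) = expN (w/2) u * expN (w/2) u.
  by rewrite /expN -expRD; congr expR; field.
have e1 : expR (w/2*u) * expN (w/2) u = 1.
  by rewrite /expN -expRD subrr expR0.
rewrite invf_div -[expR (- (w/2*s))]/(expN (w/2) s).
transitivity (2 / w * C * expN (w/2) s * expN (w/2) u * (expR (w/2*u) * expN (w/2) u)); first by ring.
by rewrite e1 mulr1.
Qed.

Lemma integrable_moment w C k s t : 0 < w -> expdom w C k -> s <= t ->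
  mu.-integrable `[t, +oo[%classic (EFin \o (fun u => (u - s) * k u)).
Proof.
move=> w0 dk st.
apply: (integrable_dominated (w := w / 2)
    (C := 2 / w * C * expR (- (w / 2 * s)))).
- by rewrite divr_gt0.
- apply: measurable_funM; last by case: dk.
  exact: measurable_funB.
- by move=> u tu; apply: moment_bound => //; exact: le_trans tu.
Qed.

End TailIntegrals.

Section TailIntegralProperties.
Variable R : realType.
Notation mu := (@lebesgue_measure R).
Implicit Types (w C t p q c s u v : R) (k g f : R -> R).

Lemma tail_split f t u : t <= u ->
  mu.-integrable `[t, +oo[%classic (EFin \o f) ->
  \int[mu]_(v in `[t, +oo[%classic) f v =
  \int[mu]_(v in `[t, u]%classic) f v + \int[mu]_(v in `[u, +oo[%classic) f v.
Proof.
move=> tu intf.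
have := @Rintegral_itvB R f (BLeft t) +oo%O u intf; rewrite bnd_simp tu bnd_simp.
move=> /(_ isT isT); rewrite Rintegral_itv_obnd_cbnd; first by lra.
apply: integrableS intf => //; apply: subset_itvr; by rewrite bnd_simp.
Qed.

Lemma Rintegral_itv_cst t u c : t <= u ->
  \int[mu]_(v in `[t, u]%classic) c = c * (u - t).
Proof.
move=> tu; rewrite Rintegral_cst//= lebesgue_measure_itv/= lte_fin.
have [//|ut] := ltP t u.
have -> : t = u by apply/le_anti; rewrite tu ut.
by rewrite subrr.
Qed.

Lemma integrable_itvS f t u : mu.-integrable `[t, +oo[%classic (EFin \o f) ->
  mu.-integrable `[t, u]%classic (EFin \o f).
Proof. by apply: integrableS => //; apply: subset_itvl; rewrite bnd_simp. Qed.

Lemma integrable_itv_cst t u c : mu.-integrable `[t, u]%classic (EFin \o cst c).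
Proof.
apply/integrableP; split; first by apply/measurable_EFinP; exact: measurable_cst.
under eq_integral do rewrite /=.
rewrite integral_cst//= lebesgue_measure_itv/=; case: ifP => _.
  by rewrite -EFinB -EFinM ltry.
by rewrite mule0 ltry.
Qed.

Lemma Vop_diff f t u m M : t <= u ->
  mu.-integrable `[t, +oo[%classic (EFin \o f) ->
  (forall v, t <= v <= u -> m <= f v <= M) ->
  m * (u - t) <= Vop f t - Vop f u <= M * (u - t).
Proof.
move=> tu intf fmM; rewrite /Vop (tail_split tu intf) addrK.
have h v : `[t, u]%classic v -> m <= f v <= M.
  by rewrite /= in_itv /=; exact: fmM.
rewrite -!Rintegral_itv_cst//; apply/andP; split; apply: le_Rintegral => //;
  (try exact: integrable_itv_cst); (try exact: integrable_itvS).
- by move=> v /h/andP[].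
- by move=> v /h/andP[].
Qed.

(** Integral estimates bound increments over ordered pairs near [t]; the two one-sided quotients are
    the cases where one end of the pair is [t]. *)
Lemma is_derive_strict f t (l : R) :
  (forall e : R, 0 < e -> exists2 d : R, 0 < d & forall x y : R, t - d < x -> x <= y ->
     y < t + d -> (l - e) * (y - x) <= f y - f x <= (l + e) * (y - x)) ->
  is_derive t 1 f l.
Proof.
move=> H.
have D : h^-1 *: ((f \o shift t) h%:A - f t) @[h --> 0^'] --> l.
  apply/cvgrPdist_le => e e0; have [d d0 Hd] := H e e0.
  near=> h; have h0 : h != 0 by near: h; exact: nbhs_dnbhs_neq.
  have hd : `|h| < d by near: h; exact: dnbhs0_lt.
  rewrite /GRing.scale /= mulr1 ler_distlC mulrC.
  move: hd; rewrite ltr_norml => /andP[? ?].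
  have [hp|hn|] := ltgtP h 0; last by move/eqP; rewrite (negbTE h0).
  - have /andP[] := Hd (h + t) t ltac:(lra) ltac:(lra) ltac:(lra).
    by rewrite ler_ndivlMr// ler_ndivrMr// => ? ?; apply/andP; split; lra.
  - have /andP[] := Hd t (h + t) ltac:(lra) ltac:(lra) ltac:(lra).
    by rewrite ler_pdivlMr// ler_pdivrMr// => ? ?; apply/andP; split; lra.
by split; [apply/cvg_ex; exists l|exact/cvg_lim].
Unshelve. all: by end_near. Qed.

Section Dominated.
Variables (w C : R) (k : R -> R).
Hypotheses (w0 : 0 < w) (dk : expdom w C k).

Let ik t : mu.-integrable `[t, +oo[%classic (EFin \o k).
Proof. exact: integrable_expdom dk. Qed.

Let k0 t : 0 <= k t.
Proof. by case: dk => _ /(_ t)/andP[]. Qed.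

Lemma Vop_ge0 t : 0 <= Vop k t.
Proof. by apply: Rintegral_ge0 => v _. Qed.

Lemma Vop_le t : Vop k t <= C / w * expN w t.
Proof.
rewrite mulrAC -mulrA -Vop_expN// /Vop -RintegralZl//; last exact: integrable_expN.
apply: le_Rintegral => //.
- exact: (integrableZl _ C (integrable_expN _ w0)).
- by move=> v _; case: dk => _ /(_ v)/andP[].
Qed.

Lemma Vop_nincr t u : t <= u -> Vop k u <= Vop k t.
Proof.
move=> tu; rewrite /Vop (tail_split tu (ik t)) lerDr.
by apply: Rintegral_ge0.
Qed.

Lemma Vop_lip t u : t <= u -> Vop k t - Vop k u <= C * expN w t * (u - t).
Proof.
move=> tu; have C0 := expdom_ge0 0 dk.
suff h v : t <= v <= u -> 0 <= k v <= C * expN w t.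
  by have /andP[] := Vop_diff tu (ik t) h.
move=> /andP[tv _].
rewrite k0 /=; case: dk => _ /(_ v)/andP[_ /le_trans]; apply.
by rewrite ler_wpM2l// ler_expR lerN2 ler_wpM2l// ltW.
Qed.

Lemma Top_ge0 t : 0 <= Top k t.
Proof.
apply: Rintegral_ge0 => v; rewrite /= in_itv /= andbT => tv.
by rewrite mulr_ge0// subr_ge0.
Qed.

(** The difference is (u - t) Vop k u plus the integral of (v - t) k v over [t, u], and the latter
    lies between 0 and u - t times the integral of [k] there. This is convexity of [Top k]. *)
Lemma Top_diff t u : t <= u ->
  (u - t) * Vop k u <= Top k t - Top k u <= (u - t) * Vop k t.
Proof.
move=> tu; have ut0 : 0 <= u - t by rewrite subr_ge0.
have im := integrable_moment w0 dk (lexx t).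
have iu := integrable_moment w0 dk tu.
have iuu := integrable_moment w0 dk (lexx u).
have E1 : \int[mu]_(v in `[u, +oo[%classic) ((v - t) * k v) =
    Top k u + (u - t) * Vop k u.
  rewrite /Top /Vop -RintegralZl// -RintegralD//; last first.
    exact: (integrableZl _ (u - t) (ik u)).
  by apply: eq_Rintegral => v _; ring.
have E2 : 0 <= \int[mu]_(v in `[t, u]%classic) ((v - t) * k v) <=
    (u - t) * \int[mu]_(v in `[t, u]%classic) k v.
  rewrite Rintegral_ge0 /=; last first.
    by move=> v; rewrite /= in_itv /= => /andP[tv _]; rewrite mulr_ge0// subr_ge0.
  rewrite -RintegralZl//; last exact: integrable_itvS.
  apply: le_Rintegral => //; first exact: integrable_itvS.
    exact: (integrableZl _ (u - t) (@integrable_itvS _ t u (ik t))).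
  move=> v; rewrite /= in_itv /= => /andP[tv vu].
  by rewrite ler_wpM2r// lerD2r.
have E3 := tail_split tu (ik t).
have E4 := tail_split tu im.
rewrite -/(Top k t) in E4; rewrite -/(Vop k t) -/(Vop k u) in E3.
rewrite E4 E1 E3 mulrDr; move: E2; set X := \int[mu]_(v in _) _.
set Y := (u - t) * _; lra.
Qed.

Lemma Top_nincr t u : t <= u -> Top k u <= Top k t.
Proof.
move=> tu; have /andP[h _] := Top_diff tu; rewrite -subr_ge0.
by apply: le_trans h; rewrite mulr_ge0 ?subr_ge0// Vop_ge0.
Qed.

Lemma Vop_cvg : Vop k t @[t --> +oo] --> 0.
Proof.
apply: (@squeeze_cvgr _ _ _ _ (cst 0) (fun t => C / w * expN w t)).
- by apply: nearW => t; rewrite Vop_ge0 Vop_le.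
- exact: cvg_cst.
- rewrite -[X in _ --> X](mulr0 (C / w)).
  by apply: cvgM; [exact: cvg_cst|exact: cvg_expN].
Qed.

Lemma Vop_continuous : continuous (Vop k).
Proof.
move=> t; apply/cvgrPdist_le => e e0.
pose L := C * expN w (t - 1) + 1.
have L0 : 0 < L by rewrite ltr_wpDl// mulr_ge0 ?(expdom_ge0 0 dk)// ltW// expN_gt0.
near=> s.
have ts : `|t - s| <= 1 by near: s; apply: cvgr_dist_le => //; exact: cvg_id.
have tse : `|t - s| <= e / L.
  near: s; apply: cvgr_dist_le; last by rewrite divr_gt0.
  exact: cvg_id.
have H x y : x <= y -> t - 1 <= x -> Vop k x - Vop k y <= L * (y - x).
  move=> xy tx; apply: (le_trans (Vop_lip xy)); rewrite ler_wpM2r ?subr_ge0//.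
  rewrite ler_wpDr// ler_wpM2l ?(expdom_ge0 0 dk)//.
  by rewrite ler_expR lerN2 ler_wpM2l// ltW.
have {tse} : L * `|t - s| <= e by rewrite mulrC -ler_pdivlMr.
apply: le_trans; move: ts; rewrite ler_distlC => /andP[ts1 ts2].
have [st|/ltW st] := leP s t.
- rewrite distrC ger0_norm ?subr_ge0 ?Vop_nincr// ger0_norm ?subr_ge0//.
  by apply: H => //; lra.
- rewrite ger0_norm ?subr_ge0 ?Vop_nincr// distrC ger0_norm ?subr_ge0//.
  by apply: H => //; lra.
Unshelve. all: by end_near. Qed.

(** Increments are squeezed between values of [Vop k], whose continuity gives differentiability at
    every point, even where [k] jumps. *)
Lemma is_derive_Top t : is_derive t 1 (Top k) (- Vop k t).
Proof.
apply: is_derive_strict => e e0.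
have /cvgrPdist_le/(_ e e0)/nbhs_ballP[d d0 dV] := @Vop_continuous t.
exists d => // x y tx xy yt; have /andP[h1 h2] := Top_diff xy.
have bx : ball t d x by rewrite /ball /= ltr_distlC; apply/andP; split; lra.
have by' : ball t d y by rewrite /ball /= ltr_distlC; apply/andP; split; lra.
move: (dV _ bx) (dV _ by'); rewrite !ler_distlC => /andP[? ?] /andP[? ?].
by apply/andP; split; nra.
Qed.

Lemma is_derive_Vop t : {for t, continuous k} ->
  is_derive t 1 (Vop k) (- k t).
Proof.
move=> ck; apply: is_derive_strict => e e0.
have /cvgrPdist_le/(_ e e0)/nbhs_ballP[d d0 dk'] := ck.
exists d => // x y tx xy yt.
suff h v : x <= v <= y -> k t - e <= k v <= k t + e.
  by have /andP[h1 h2] := Vop_diff xy (ik x) h; apply/andP; split; lra.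
move=> /andP[xv vy]; rewrite -ler_distlC; apply: dk'.
by rewrite /ball /= ltr_distlC; apply/andP; split; lra.
Qed.

End Dominated.


Section Algebra.
Variable w : R.
Hypothesis w0 : 0 < w.

Lemma expdomD C1 C2 k1 k2 : expdom w C1 k1 -> expdom w C2 k2 ->
  expdom w (C1 + C2) (fun t => k1 t + k2 t).
Proof.
move=> [m1 h1] [m2 h2]; split; first exact: measurable_funD.
move=> t; have /andP[? ?] := h1 t; have /andP[? ?] := h2 t.
by rewrite addr_ge0//= mulrDl lerD.
Qed.

Lemma expdomZ c C k : 0 <= c -> expdom w C k ->
  expdom w (c * C) (fun t => c * k t).
Proof.
move=> c0 [m h]; split; first by apply: measurable_funM.
by move=> t; have /andP[? ?] := h t; rewrite mulr_ge0//= -mulrA ler_wpM2l.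
Qed.

Lemma expdom_expN : expdom w 1 (expN w).
Proof.
split; first exact: measurable_expN.
by move=> t; rewrite mul1r lexx ltW// expN_gt0.
Qed.

Lemma TopD C1 C2 k1 k2 t : expdom w C1 k1 -> expdom w C2 k2 ->
  Top (fun t => k1 t + k2 t) t = Top k1 t + Top k2 t.
Proof.
move=> d1 d2; rewrite /Top -RintegralD//; first last.
- exact: integrable_moment d2 _.
- exact: integrable_moment d1 _.
by apply: eq_Rintegral => u _; rewrite mulrDr.
Qed.

Lemma TopZ c C k t : expdom w C k ->
  Top (fun t => c * k t) t = c * Top k t.
Proof.
move=> dk; rewrite /Top -RintegralZl//; last exact: integrable_moment dk _.
by apply: eq_Rintegral => u _; ring.
Qed.

Lemma le_Top C1 C2 k1 k2 t : expdom w C1 k1 -> expdom w C2 k2 ->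
  (forall u, t <= u -> k1 u <= k2 u) -> Top k1 t <= Top k2 t.
Proof.
move=> d1 d2 k12; apply: le_Rintegral => //.
- exact: integrable_moment d1 _.
- exact: integrable_moment d2 _.
- move=> u; rewrite /= in_itv /= andbT => tu.
  by rewrite ler_wpM2l ?subr_ge0// k12.
Qed.

Lemma Top_expN_diff t u : t <= u -> Top (expN w) t - Top (expN w) u =
  expN w t / w ^+ 2 - expN w u / w ^+ 2.
Proof.
move=> tu; pose f t := Top (expN w) t - expN w t / w ^+ 2.
suff : f t = f u by rewrite /f; lra.
apply: is_derive_0_is_cst => x.
have dT := is_derive_Top w0 expdom_expN x.
have dE := is_deriveZ (w ^- 2) (is_derive_expN w x).
have -> : f = Top (expN w) \- (w ^- 2 *: expN w).
  by apply/funext => z; rewrite /f /= mulrC.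
apply: (is_derive_eq (is_deriveB dT dE)).
by rewrite Vop_expN// /GRing.scale /=; field; rewrite gt_eqF.
Qed.

End Algebra.

(** A crude bound with half the weight, enough for decay at infinity. The sharp bound [Top_le] rests
    on [Top_expN], which itself needs this decay to fix an integration constant. *)
Lemma expdom_half w C k t : 0 < w -> expdom w C k ->
  Top k t <= (2 / w * C * expR (- (w / 2 * t))) * (expN (w / 2) t / (w / 2)).
Proof.
move=> w0 dk; have w20 : 0 < w / 2 by rewrite divr_gt0.
rewrite -Vop_expN// /Vop -RintegralZl//; last exact: integrable_expN.
apply: le_Rintegral => //.
- exact: (integrable_moment w0 dk).
- exact: (integrableZl _ _ (integrable_expN _ w20)).
move=> u; rewrite /= in_itv /= andbT => tu.
by apply: le_trans (ler_norm _) _; exact: moment_bound.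
Qed.

Lemma Top_cvg w C k : 0 < w -> expdom w C k -> Top k t @[t --> +oo] --> 0.
Proof.
move=> w0 dk; have w20 : 0 < w / 2 by rewrite divr_gt0.
pose M := 2 / w * C * (w / 2)^-1.
apply: (@squeeze_cvgr _ _ _ _ (cst 0)
   (fun t => M * (expN (w / 2) t * expN (w / 2) t))).
- apply: nearW => t; rewrite (Top_ge0 dk) /=.
  apply: le_trans (expdom_half t w0 dk) _.
  by rewrite /M le_eqVlt; apply/orP; left; apply/eqP; rewrite /expN; ring.
- exact: cvg_cst.
- rewrite -[X in _ --> X](mulr0 M) -[in X in _ --> X](mulr0 0).
  by apply: cvgM; [exact: cvg_cst|apply: cvgM; exact: cvg_expN].
Qed.

Lemma Top_expN w t : 0 < w -> Top (expN w) t = expN w t / w ^+ 2.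
Proof.
move=> w0.
have h : Top (expN w) u - expN w u / w ^+ 2 @[u --> +oo] --> 0.
  rewrite -[X in _ --> X]subr0; apply: cvgB; first exact: Top_cvg (expdom_expN _).
  rewrite -[X in _ --> X](mul0r (w ^- 2)); apply: cvgM; last exact: cvg_cst.
  exact: cvg_expN.
have h2 : Top (expN w) u - expN w u / w ^+ 2 @[u --> +oo] -->
    Top (expN w) t - expN w t / w ^+ 2.
  apply: cvg_near_cst; near=> u.
  have tu : t <= u by near: u; apply: nbhs_pinfty_ge; exact: num_real.
  by have := Top_expN_diff w0 tu; lra.
suff : Top (expN w) t - expN w t / w ^+ 2 = 0 by move=> /eqP; rewrite subr_eq0 => /eqP.
exact: (cvg_unique _ h2 h).
Unshelve. all: by end_near. Qed.

Lemma Top_le w C k t : 0 < w -> expdom w C k ->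
  Top k t <= C / w ^+ 2 * expN w t.
Proof.
move=> w0 dk; rewrite mulrAC -mulrA -Top_expN//.
have C0 := expdom_ge0 0 dk.
rewrite -(TopZ w0 C t (expdom_expN _)).
apply: (le_Top w0 dk (expdomZ C0 (expdom_expN _))) => u _.
by case: dk => _ /(_ u)/andP[].
Qed.

Lemma Top_continuous w C k : 0 < w -> expdom w C k -> continuous (Top k).
Proof.
move=> w0 dk t; apply: differentiable_continuous; apply/derivable1_diffP.
by have := is_derive_Top w0 dk t => -[].
Qed.

Lemma expdom_Top w C k : 0 < w -> expdom w C k ->
  expdom w (C / w ^+ 2) (Top k).
Proof.
move=> w0 dk; split.
  by apply: continuous_measurable_fun; exact: Top_continuous dk.
by move=> t; rewrite (Top_ge0 dk) (Top_le _ w0 dk).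
Qed.

End TailIntegralProperties.

(** * Translation, dominated convergence and almost everywhere differentiation of tail integrals *)

Section MoreTail.
Variable R : realType.
Notation mu := (@lebesgue_measure R).
Implicit Types (w C t p q c s u v : R) (k g f : R -> R).

Lemma is_derive_continuous f t (l : R) : is_derive t 1 f l ->
  {for t, continuous f}.
Proof.
by move=> [df _]; apply: differentiable_continuous; exact/derivable1_diffP.
Qed.

(** The pushforward of Lebesgue measure by a translation agrees with it on half-open intervals,
    hence everywhere by uniqueness. *)
Lemma integral_shift g p t : measurable_fun [set: R] g -> (forall u, t - p <= u -> 0 <= g u) ->
  \int[mu]_(u in `[t, +oo[%classic) g (u - p) =
  \int[mu]_(u in `[t - p, +oo[%classic) g u.
Proof.
move=> mg g0; pose phi : measurableTypeR R -> measurableTypeR R := fun u => u - p.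
have mphi : measurable_fun [set: R] phi by apply: measurable_funB.
pose nu := pushforward mu phi.
have nuE (A : set R) : measurable A -> mu A = nu A.
  move=> mA; apply: (@lebesgue_measure_unique R nu) => // _ [[x y] _ <-].
  rewrite /= /nu /pushforward.
  have -> : phi @^-1` [set` `]x, y]] = [set` `]x + p, y + p]].
    apply/seteqP; split => u; rewrite /= !in_itv /= /phi => /andP[? ?];
    apply/andP; split; lra.
  rewrite !lebesgue_measure_itv/= !lte_fin ltrD2r.
  case: ifP => //= _; rewrite -!EFinB; congr (_%:E); ring.
rewrite /Rintegral; congr fine.
have -> : (\int[mu]_(x in `[(t - p)%R, +oo[) (g x)%:E =
    \int[nu]_(x in `[(t - p)%R, +oo[) (g x)%:E)%E.
  by apply: eq_measure_integral => A mA _; exact: nuE.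
rewrite (@ge0_integral_pushforward _ _ _ _ _ phi mphi mu `[(t - p)%R, +oo[%classic (EFin \o g))//=.
- have -> // : phi @^-1` [set` `[t - p, +oo[] = [set` `[t, +oo[].
  by apply/seteqP; split => u; rewrite /= !in_itv /= /phi !andbT lerD2r.
- by apply/measurable_EFinP; apply: measurable_funTS.
- by move=> u; rewrite inE /= in_itv /= andbT lee_fin; exact: g0.
Qed.

Lemma Top_shift w C k p t : expdom w C k ->
  Top (fun u => k (u - p)) t = Top k (t - p).
Proof.
move=> [mk kC]; rewrite /Top.
rewrite -(@integral_shift (fun u => (u - (t - p)) * k u) p t).
- by apply: eq_Rintegral => u _; congr (_ * _); ring.
- by apply: measurable_funM => //; exact: measurable_funB.
- move=> u tu; rewrite mulr_ge0 ?subr_ge0//; by case/andP : (kC u).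
Qed.

Lemma Top_dominated_cvg w C (kn : nat -> R -> R) k t : 0 < w ->
  (forall n, expdom w C (kn n)) ->
  (forall u, kn n u @[n --> \oo] --> k u) ->
  expdom w C k /\ Top (kn n) t @[n --> \oo] --> Top k t.
Proof.
move=> w0 dkn kcv.
have mk : measurable_fun [set: R] k.
  by apply: (@measurable_fun_cvg _ _ _ _ kn) => [n|u _]; [case: (dkn n)|exact: kcv].
have dk : expdom w C k.
  split=> // u; apply/andP; split.
    apply: (cvgr_to_ge (kcv u)).
    by apply: nearW => n; case: (dkn n) => _ /(_ u)/andP[].
  apply: (cvgr_to_le (kcv u)).
  by apply: nearW => n; case: (dkn n) => _ /(_ u)/andP[].
split=> //; rewrite /Top /Rintegral.
have C0 := expdom_ge0 0 dk.
have [_ _ cv] : [/\ mu.-integrable `[t, +oo[ (fun u => ((u - t) * k u)%:E),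
    [sequence (\int[mu]_(x in `[t, +oo[)
      `|((x - t) * kn n x)%:E - ((x - t) * k x)%:E|)%E]_n @ \oo --> 0%E
    & [sequence (\int[mu]_(x in `[t, +oo[) ((x - t) * kn n x)%:E)%E]_n @ \oo -->
      (\int[mu]_(x in `[t, +oo[) ((x - t) * k x)%:E)%E].
  apply: (@dominated_convergence _ _ R mu `[t, +oo[%classic _
    (fun n u => ((u - t) * kn n u)%:E) (fun u => ((u - t) * k u)%:E)
    (fun u => ((u - t) * (C * expN w u))%:E)) => //.
  - move=> n; apply/measurable_EFinP; apply: measurable_funTS.
    apply: measurable_funM; [exact: measurable_funB|by case: (dkn n)].
  - apply/measurable_EFinP; apply: measurable_funTS.
    apply: measurable_funM; [exact: measurable_funB|by []].
  - apply/aeW => u _; apply: cvg_EFin; first exact: nearW.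
    by apply: cvgM; [exact: cvg_cst|exact: kcv].
  - exact: (integrable_moment w0 (expdomZ C0 (expdom_expN _)) (lexx t)).
  - apply/aeW => u n; rewrite /= in_itv /= andbT => tu.
    rewrite lee_fin normrM ger0_norm ?subr_ge0// ler_wpM2l ?subr_ge0//.
    by case: (dkn n) => _ /(_ u)/andP[k0 kC]; rewrite ger0_norm.
apply: fine_cvg; apply: cvg_trans cv _.
rewrite fineK//; apply: (integrable_fin_num _ (integrable_moment w0 dk (lexx t))).
by [].
Qed.

(** At a Lebesgue point [t] the integral of [k] from [t - 1] has derivative [k t], and [Vop k] is a
    constant minus that integral. *)
Lemma Vop_ae_derive w C k : 0 < w -> expdom w C k ->
  {ae mu, forall t, is_derive t 1 (Vop k) (- k t)}.
Proof.
move=> w0 dk.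
have loc : locally_integrable [set: R] k.
  split; [by case: dk|exact: openT|move=> K _ Kc].
  have [M [Mr KM]] := compact_bounded Kc.
  pose B := `|M| + 1.
  have KB x : K x -> - B <= x.
    move=> Kx; have := KM B; rewrite /B ltr_pwDr ?ler_norm// => /(_ isT x Kx) /=.
    by rewrite ler_norml => /andP[].
  have /integrableP[_ ioo] : mu.-integrable K (EFin \o k).
    apply: integrableS (integrable_expdom (- B) w0 dk) => //.
      exact: compact_measurable.
    by move=> x /KB; rewrite /= in_itv /= andbT.
  exact: ioo.
have := lebesgue_differentiation loc.
apply: filterS; first exact: (ae_filter_ringOfSetsType mu).
move=> t tL.
have int := integrable_expdom (t - 1) w0 dk.
have [dF FE] : derivable (fun y => \int[mu]_(u in `[t - 1, y]%classic) k u) t 1 /\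
    (fun y => \int[mu]_(u in `[t - 1, y]%classic) k u)^`()%classic t = k t.
  apply: (@FTC1_lebesgue_pt _ k (BLeft (t - 1)) t (t + 1)) => //.
  - by rewrite ltrDl.
  - exact: integrable_itvS.
  - by rewrite lte_fin; lra.
rewrite derive1E in FE.
have D : is_derive t 1 (fun y => Vop k (t - 1) - \int[mu]_(u in `[t - 1, y]%classic) k u) (- k t).
  have D1 : is_derive t 1 (fun y => \int[mu]_(u in `[t - 1, y]%classic) k u) (k t) by split.
  by apply: (is_derive_eq (is_deriveB (is_derive_cst _ _ _) D1)); rewrite sub0r.
apply: (near_eq_is_derive _ D).
near=> y.
rewrite /Vop (@tail_split _ _ (t - 1) y) ?int//; first by rewrite addrC addKr.
have : ball t 1 y by near: y; exact: nbhsx_ballx.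
by rewrite /ball /= ltr_distlC => /andP[/ltW].
Unshelve. all: by end_near. Qed.

Lemma Top_indic p q t : t <= p -> p < q ->
  Top (\1_(`[p, q]%classic)) t = (q - p) * (q + p - 2 * t) / 2.
Proof.
move=> tp pq.
rewrite /Top.
transitivity (\int[mu]_(u in `[p, q]%classic) (u - t)).
  rewrite [LHS]Rintegral_mkcond [RHS]Rintegral_mkcond.
  apply: eq_Rintegral => u _; rewrite !patchE /= indicE.
  case: (boolP (u \in `[p, q]%classic)) => upq /=; last by rewrite mulr0 if_same.
  rewrite mulr1 ifT//; move: upq; rewrite !inE /= !in_itv /= => /andP[? ?].
  by rewrite andbT; lra.
have dq (u : R) : is_derive u 1 (fun u : R => (u - t) ^+ 2 / 2) (u - t).
  by apply: is_derive_eq; rewrite /GRing.scale /=; field.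
rewrite /Rintegral (@continuous_FTC2 R (fun u => u - t) (fun u => (u - t) ^+ 2 / 2) p q)//.
- by rewrite /=; field.
- by apply: continuous_subspaceT => u; apply: cvgB; [exact: cvg_id|exact: cvg_cst].
- split.
  + by move=> u _; have := dq u => -[].
  + by apply: cvg_at_right_filter; exact: (is_derive_continuous (dq p)).
  + by apply: cvg_at_left_filter; exact: (is_derive_continuous (dq q)).
- by move=> u _; rewrite derive1E; have := dq u => -[].
Qed.

End MoreTail.

(** * Monotonicity from an almost everywhere derivative *)

Section AbsoluteContinuity.
Variable R : realType.
Notation mu := (@lebesgue_measure R).
Implicit Types (p q c u v x y z : R) (f g : R -> R).

Lemma nondecreasing_of_derive f g p q : p <= q ->
  {within `[p, q], continuous f} ->
  (forall x, p < x < q -> is_derive x 1 f (g x)) ->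
  (forall x, p < x < q -> 0 <= g x) -> f p <= f q.
Proof.
move=> pq cf df g0; move: pq; rewrite le_eqVlt => /predU1P[->//|pq].
have [x xpq E] : exists2 c, c \in `]p, q[ & f q - f p = g c * (q - p).
  by apply: MVT => // x; rewrite in_itv /=; exact: df.
rewrite -subr_ge0 E mulr_ge0 ?subr_ge0 ?(ltW pq)// g0//.
Qed.

(** Take the supremum [c] of the points satisfying [G]. One such point lies just to the left of [c],
    and the local hypothesis carries [G] from it across [c], so [c] is [q]. *)
Lemma real_induction p q (G : R -> Prop) : p <= q -> G p ->
  (forall c, p <= c <= q -> exists2 d : R, 0 < d & forall x z : R,
     p <= x -> c - d < x -> x <= c -> c <= z -> z < c + d -> z <= q ->
     G x -> G z) ->
  G q.
Proof.
move=> pq Gp H; pose S := [set x | p <= x <= q /\ G x].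
have Sp : S p by split => //; rewrite lexx.
have supS : has_sup S by split; [exists p|exists q => x [/andP[]]].
pose c := sup S.
have pc : p <= c by apply: ub_le_sup => //; case: supS.
have cq : c <= q by apply: ge_sup; [exists p|move=> x [/andP[]]].
have [d d0 Hd] := H c ltac:(by rewrite pc cq).
have [x [/andP[px xq] Gx] cx] : exists2 x, S x & c - d < x.
  by apply: sup_adherent => //; case: supS.
have xc : x <= c by apply: ub_le_sup; [case: supS|split => //; rewrite px xq].
have [qc|cq'] := leP q c.
  by apply: (Hd x) => //; lra.
pose z := Num.min q (c + d / 2).
have cz : c < z by rewrite lt_min cq' /=; lra.
have zq : z <= q by rewrite ge_min lexx.
have zd : z <= c + d / 2 by rewrite ge_min lexx orbT.
have Gz : G z by apply: (Hd x) => //; [exact: ltW|lra].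
have : z <= c.
  by apply: ub_le_sup; [case: supS|split => //; rewrite zq andbT; lra].
lra.
Qed.

(** A finite family of non-overlapping closed intervals inside [U], between [p] and [x], listed from
    right to left so that the covering argument extends it at the head. *)
Fixpoint chain (U : set R) (p : R) (s : seq (R * R)) (x : R) : Prop :=
  if s is (u, v) :: s' then
    [/\ u <= v, v <= x, `[u, v]%classic `<=` U & chain U p s' u]
  else p <= x.

Lemma chain_le U p s x : chain U p s x -> p <= x.
Proof.
elim: s x => [//|[u v] s IH] x /= [uv vx _ /IH pu].
by rewrite (le_trans pu)// (le_trans uv).
Qed.

Lemma chain_mono U p s x z : x <= z -> chain U p s x -> chain U p s z.
Proof.
case: s => [|[u v] s] /= xz; first by move/le_trans; exact.
by move=> [? vx ? ?]; split => //; exact: le_trans xz.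
Qed.

Lemma chain_nth U p s x : chain U p s x -> forall i, (i < size s)%N ->
  let e := nth (0, 0) s i in [/\ p <= e.1, e.1 <= e.2 & e.2 <= x].
Proof.
elim: s x => [//|[u v] s IH] x /= [uv vx _ cs] [_|i] /=.
  by split => //; exact: chain_le cs.
rewrite ltnS => /(IH _ cs)[? ? eu]; split => //.
by rewrite (le_trans eu)// (le_trans uv).
Qed.

Lemma chain_disj U p s x : chain U p s x -> forall i j, (i < j < size s)%N ->
  (nth (0, 0) s j).2 <= (nth (0, 0) s i).1.
Proof.
elim: s x => [|[u v] s IH] x /=; first by move=> _ i j; rewrite ltn0 andbF.
move=> [uv vx _ cs] [|i] [|j]//=; rewrite !ltnS.
- by move=> js; have [] := chain_nth cs js.
- exact: IH cs i j.
Qed.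

(** Half-open intervals keep consecutive members disjoint even when they share an endpoint. *)
Lemma chain_length U p s x : open U -> chain U p s x ->
  ((\sum_(e <- s) (e.2 - e.1))%:E <= mu (U `&` `[p, x[%classic))%E.
Proof.
move=> oU; elim: s x => [|[u v] s IH] x /=; first by rewrite big_nil.
move=> [uv vx uvU cs]; rewrite big_cons /= EFinD.
have mU : measurable U by exact: open_measurable.
have pu := chain_le cs.
have -> : ((v - u)%:E = mu `[u, v[%classic)%E.
  rewrite lebesgue_measure_itv/= lte_fin; case: ifP => // /negbT.
  rewrite -leNgt => vu; congr (_%:E); lra.
apply: (@le_trans _ _ (mu (`[u, v[%classic `|` (U `&` `[p, u[%classic)))).
  rewrite measureU//; first by apply: leeD => //; exact: IH.
    by apply: measurableI.
  apply/seteqP; split => // z [] /=; rewrite !in_itv /= => /andP[uz _] [_ /andP[_]].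
  by rewrite ltNge uz.
apply: le_measure; rewrite ?inE//.
- by apply: measurableU => //; apply: measurableI.
- by apply: measurableI.
- move=> z [|[Uz]] /=; rewrite !in_itv /= => /andP[z1 z2]; split => //.
  + by apply: uvU; rewrite /= in_itv /= z1 ltW.
  + by rewrite (le_trans pu)//= (lt_le_trans z2).
  + by rewrite z1 /= (lt_le_trans z2)// (le_trans uv).
Qed.

(* Cousin-type covering argument: off a null set the derivative controls the
   increments, and an open neighbourhood of small measure of the exceptional set
   is handled by absolute continuity. *)
Lemma abs_continuous_nondecreasing f p q : p <= q ->
  abs_continuous_on p q f ->
  {ae mu, forall t, p <= t <= q -> exists2 l : R, 0 <= l & is_derive t 1 f l} ->
  f p <= f q.
Proof.
move=> pq ac [N [mN N0 subN]].
suff H (e : R) : 0 < e -> - e * (q - p) - e <= f q - f p.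
  rewrite leNgt; apply/negP => fqp.
  have q1 : 0 < 2 * (q - p + 1) by lra.
  have := H ((f p - f q) / (2 * (q - p + 1))).
  rewrite divr_gt0 ?subr_gt0// => /(_ isT).
  set z := _ / _; have : z * (2 * (q - p + 1)) = f p - f q.
    by rewrite /z mulfVK// gt_eqF.
  lra.
move=> e0; have [dl dl0 acd] := ac e e0.
have Nfin : (mu N < +oo)%E by rewrite [X in (X < _)%E]N0 ltry.
have [U [oU NU mUN]] := @lebesgue_regularity_outer R N dl mN Nfin dl0.
have mU : (mu U < dl%:E)%E.
  apply: le_lt_trans mUN; rewrite -[leLHS]adde0.
  have mU : measurable U by exact: open_measurable.
  rewrite -{1}(setDUK NU) measureU//; last 2 first.
  - exact: measurableD.
  - by rewrite setDE setICA setICr setI0.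
  by rewrite adde0 [X in (X + _ <= _)%E]N0 add0e.
(* Outside the chain [f] falls at rate at most [e]. The chain lies in [U], so its total length is
   below [dl] and the variation over it is below [e]. *)
pose G x := exists s, chain U p s x /\
  - e * (x - p) - \sum_(i <- s) `|f i.2 - f i.1| <= f x - f p.
suff [s [cs fs]] : G q.
  apply: le_trans fs; rewrite lerD2l lerN2 ltW//.
  have := acd (size s) (fun i => (nth (0, 0) s i).1) (fun i => (nth (0, 0) s i).2).
  rewrite (big_nth (0, 0)) big_mkord; apply.
  - by move=> i; have [] := chain_nth cs (ltn_ord i).
  - apply/trivIsetP => i j _ _; wlog ij : i j / (i < j)%N.
      move=> W; case: (ltngtP i j) => [ij|ij|/val_inj ->]; last by rewrite eqxx.
      - exact: W.
      - by move=> _; rewrite setIC; apply: W => //; rewrite neq_ltn ij.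
    move=> _; apply/seteqP; split => // z [] /=; rewrite !in_itv /= => /andP[z1 _] /andP[_ z2].
    have := chain_disj cs (i := i) (j := j); rewrite ij ltn_ord => /(_ isT).
    lra.
  - rewrite -lte_fin; apply: le_lt_trans mU.
    have := chain_length oU cs; rewrite (big_nth (0, 0)) big_mkord => /le_trans; apply.
    apply: le_measure; rewrite ?inE//.
      by apply: measurableI => //; exact: open_measurable.
    exact: open_measurable.
apply: (real_induction (p := p)) => //.
  by exists [::]; split => //=; rewrite big_nil !subrr mulr0 subr0.
move=> c /andP[pc cq]; have [Nc|Nc] := pselect (N c).
  have /nbhs_ballP[d d0 dU] : nbhs c U by apply: open_nbhs_nbhs; split => //; exact: NU.
  exists d => // x z px cx xc cz zc zq [s [cs fs]].
  (* Near an exceptional point nothing is known about the increment, so the whole interval from [x]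
     to [z] joins the chain. *)
  exists ((x, z) :: s); split; last first.
    rewrite big_cons /=; have := ler_norm (- (f z - f x)); rewrite normrN.
    have : 0 <= e * (z - x) by rewrite mulr_ge0 ?(ltW e0)// subr_ge0 (le_trans xc).
    move: fs; set S := \sum_(_ <- _) _; lra.
  split => //; first exact: le_trans cz.
  move=> t /=; rewrite in_itv /= => /andP[xt tz]; apply: dU.
  by rewrite /ball /= ltr_distlC; apply/andP; split; lra.
have [l l0 [dfc dfl]] : exists2 l : R, 0 <= l & is_derive c 1 f l.
  by move: Nc => /contra_notP; apply => ndf; apply: subN => /(_ _)/ndf; apply; rewrite pc cq.
have : h^-1 *: (f (h + c) - f c) @[h --> 0^'] --> l.
  rewrite -dfl; move: dfc; rewrite /derivable /derive.
  have -> : (fun h : R => h^-1 *: (f (h + c) - f c)) =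
     (fun h : R => h^-1 *: ((f \o shift c) h%:A - f c)).
    by apply/funext => h; rewrite /= [h%:A]mulr1.
  by [].
move=> /cvgrPdist_lt/(_ e e0).
rewrite /dnbhs /within => /nbhs_ballP[d /= d0 Hd].
exists d => // x z px cx xc cz zc zq [s [cs fs]].
exists s; split; first by apply: chain_mono cs; exact: le_trans cz.
have D h : h != 0 -> `|h| < d -> l - e < h^-1 * (f (h + c) - f c).
  move=> h0 hd; have := Hd h; rewrite /ball /= sub0r normrN => /(_ hd h0).
  by rewrite ltr_distlC => /andP[].
have fz : - e * (z - c) <= f z - f c.
  move: cz; rewrite le_eqVlt => /predU1P[->|cz]; first by rewrite !subrr mulr0.
  have := D (z - c); rewrite subr_eq0 gt_eqF// gtr0_norm ?subr_gt0// ltrBlDl.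
  rewrite subrK => /(_ isT zc); rewrite mulrC ltr_pdivlMr ?subr_gt0// => /ltW.
  have : 0 <= l * (z - c) by rewrite mulr_ge0// subr_ge0 ltW.
  lra.
have fx : - e * (c - x) <= f c - f x.
  move: xc; rewrite le_eqVlt => /predU1P[->|xc]; first by rewrite !subrr mulr0.
  have := D (x - c); rewrite subr_eq0 lt_eqF// ltr0_norm ?subr_lt0//.
  rewrite subrK opprB => /(_ isT ltac:(lra)).
  rewrite mulrC ltr_ndivlMr ?subr_lt0// => /ltW h.
  have : 0 <= l * (c - x) by rewrite mulr_ge0// subr_ge0 ltW.
  lra.
move: fs; set S := \sum_(_ <- _) _; lra.
Qed.

End AbsoluteContinuity.

(** * Minimal solutions and the single-plateau problem *)

Section MinimalSolution.
Variable R : realType.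
Implicit Types (w C t p q c s u v : R) (k g f y tau : R -> R) (A : set R).

Definition kfun A tau f : R -> R := fun t => \1_A t + \1_(~` A) t * f (tau t).

Definition solI A tau n : R -> R :=
  iter n (fun f => Top (kfun A tau f)) (fun=> 0).

(** The supremum is meaningful as soon as a supersolution exists, since it bounds all iterates. *)
Definition sol A tau : R -> R := fun t => sup (range (fun n => solI A tau n t)).

Lemma kfun_in A tau f t : A t -> kfun A tau f t = 1.
Proof.
by move=> At; rewrite /kfun !indicE mem_set// memNset ?mul0r ?addr0//; apply.
Qed.

Lemma kfun_out A tau f t : ~ A t -> kfun A tau f t = f (tau t).
Proof. by move=> At; rewrite /kfun !indicE memNset// mem_set// mul1r add0r. Qed.

Lemma kfun_ge0 A tau f t : (forall s, 0 <= f s) -> 0 <= kfun A tau f t.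
Proof.
move=> f0; have [At|At] := pselect (A t); first by rewrite kfun_in.
by rewrite kfun_out.
Qed.

Lemma le_kfun A tau f g t : (forall s, f s <= g s) ->
  kfun A tau f t <= kfun A tau g t.
Proof.
move=> fg; have [At|At] := pselect (A t); first by rewrite !kfun_in.
by rewrite !kfun_out.
Qed.

Lemma measurable_kfun A tau f : measurable A -> measurable_fun [set: R] tau ->
  measurable_fun [set: R] f -> measurable_fun [set: R] (kfun A tau f).
Proof.
move=> mA mtau mf; apply: measurable_funD; first exact: measurable_indic.
apply: measurable_funM; first by apply: measurable_indic; exact: measurableC.
exact: measurableT_comp.
Qed.

(** Domination is asked of the right-hand side built from [y]: this is what makes every iterate
    below [y] integrable with the same constant. *)
Definition supersol w C A tau y :=
  [/\ expdom w C (kfun A tau y), forall t, 0 <= y t &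
      forall t, Top (kfun A tau y) t <= y t].

Section Super.
Variables (w C : R) (A : set R) (tau y : R -> R).
Hypotheses (w0 : 0 < w) (mA : measurable A) (mtau : measurable_fun [set: R] tau).
Hypothesis sy : supersol w C A tau y.

Let dom_of f : measurable_fun [set: R] f -> (forall t, 0 <= f t <= y t) ->
  expdom w C (kfun A tau f).
Proof.
move=> mf fy; split; first exact: measurable_kfun.
move=> t; rewrite kfun_ge0 /=; last by move=> s; case/andP: (fy s).
case: sy => -[_ /(_ t)/andP[_ h]] _ _; apply: le_trans h.
by apply: le_kfun => s; case/andP: (fy s).
Qed.

Lemma solI_props n : [/\ measurable_fun [set: R] (solI A tau n) &
  forall t, 0 <= solI A tau n t <= y t].
Proof.
case: sy => dy y0 Ty.
elim: n => [|n [mI bI]].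
  by split => [|t /=]; [exact: measurable_cst|rewrite lexx y0].
have dI := dom_of mI bI; split.
  by case: (expdom_Top w0 dI).
move=> t; rewrite /= (Top_ge0 dI) /=; apply: le_trans (Ty t).
apply: le_Top dI dy _ => // u _; apply: le_kfun => s.
by case/andP: (bI s).
Qed.

Lemma expdom_solI n : expdom w C (kfun A tau (solI A tau n)).
Proof. by have [? ?] := solI_props n; exact: dom_of. Qed.

Lemma solI_ndecr t : {homo (fun n => solI A tau n t) : m n / (m <= n)%N >-> m <= n}.
Proof.
apply/nondecreasing_seqP => n; elim: n t => [|n IH] t.
  by have [_ /(_ t)/andP[]] := solI_props 1.
apply: le_Top (expdom_solI n) (expdom_solI n.+1) _ => // u _.
by apply: le_kfun => s; exact: IH.
Qed.

Lemma solI_has_sup t : has_sup (range (fun n => solI A tau n t)).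
Proof.
split; first by exists (solI A tau 0 t); exists 0%N.
by exists (y t) => _ [n _ <-]; have [_ /(_ t)/andP[]] := solI_props n.
Qed.

Lemma solI_cvg t : solI A tau n t @[n --> \oo] --> sol A tau t.
Proof.
apply: nondecreasing_cvgn; first exact: solI_ndecr.
by case: (solI_has_sup t).
Qed.

Lemma solI_le_sol n t : solI A tau n t <= sol A tau t.
Proof. by apply: ub_le_sup; [case: (solI_has_sup t)|exists n]. Qed.

Lemma sol_le t : sol A tau t <= y t.
Proof.
apply: ge_sup; first by case: (solI_has_sup t).
by move=> _ [n _ <-]; have [_ /(_ t)/andP[]] := solI_props n.
Qed.

Lemma sol_ge0 t : 0 <= sol A tau t.
Proof. exact: le_trans (solI_le_sol 0 t). Qed.

Let ksol t : kfun A tau (solI A tau n) t @[n --> \oo] --> kfun A tau (sol A tau) t.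
Proof.
have [At|At] := pselect (A t).
  rewrite (kfun_in _ _ At); apply: cvg_near_cst; apply: nearW => n.
  by rewrite kfun_in.
rewrite (kfun_out _ _ At).
under eq_fun do rewrite (kfun_out _ _ At).
exact: solI_cvg.
Qed.

Lemma expdom_sol : expdom w C (kfun A tau (sol A tau)).
Proof.
by have [] := Top_dominated_cvg 0 w0 expdom_solI ksol.
Qed.

Lemma sol_fix t : sol A tau t = Top (kfun A tau (sol A tau)) t.
Proof.
have [_ h] := Top_dominated_cvg t w0 expdom_solI ksol.
apply: (cvg_unique _ _ h) => //.
by have := @solI_cvg t; rewrite -(cvg_shiftS (fun n => solI A tau n t)).
Qed.

Lemma sol_fixE : sol A tau = Top (kfun A tau (sol A tau)).
Proof. by apply/funext => t; exact: sol_fix. Qed.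

Lemma sol_nincr t u : t <= u -> sol A tau u <= sol A tau t.
Proof. by move=> tu; rewrite !sol_fix; apply: Top_nincr expdom_sol _ _ _. Qed.

End Super.

End MinimalSolution.

(** * One plateau: dependence of the value at 0 on the lag and on the right end *)

Section SinglePlateau.
Variable R : realType.
Notation mu := (@lebesgue_measure R).
Implicit Types (w C B a b p q c s t u v d : R) (k g f y : R -> R).

Definition Fab a b : R -> R := sol `[a, b]%classic (fun t => t - a).
Definition kab a b : (R -> R) -> R -> R := kfun `[a, b]%classic (fun t => t - a).

Lemma measurable_lag a : measurable_fun [set: R] (fun t => t - a).
Proof. exact: measurable_funB. Qed.

Lemma kab_in a b f t : a <= t <= b -> kab a b f t = 1.
Proof. by move=> h; apply: kfun_in; rewrite /= in_itv. Qed.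

Lemma kab_out a b f t : ~~ (a <= t <= b) -> kab a b f t = f (t - a).
Proof. by move=> /negP h; apply: kfun_out; rewrite /= in_itv. Qed.

Lemma le_expN w t u : 0 < w -> u <= t -> expN w t <= expN w u.
Proof. by move=> w0 ut; rewrite ler_expR lerN2 ler_wpM2l// ltW. Qed.

Lemma expN_shift w t a : expN w (t - a) = expR (w * a) * expN w t.
Proof. by rewrite /expN -expRD; congr expR; ring. Qed.

Lemma one_le_expN w B t : 0 < w -> t <= B -> 1 <= expR (w * B) * expN w t.
Proof.
move=> w0 tB; rewrite /expN -expRD -[leLHS]expR0 ler_expR.
by rewrite -mulrBr mulr_ge0 ?subr_ge0// ltW.
Qed.

Lemma expdom_indic w B p q : 0 < w -> q <= B ->
  expdom w (expR (w * B)) (\1_(`[p, q]%classic)).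
Proof.
move=> w0 qB; split; first exact: measurable_indic.
move=> t; rewrite indicE; case: (boolP (t \in _)) => h /=.
  rewrite ler01 /= one_le_expN//; move: h; rewrite inE /= in_itv /= => /andP[_].
  by move/le_trans; apply.
by rewrite lexx /= mulr_ge0// ltW ?expR_gt0.
Qed.

Lemma Vop_indic_le p q t : p <= q -> Vop (\1_(`[p, q]%classic)) t <= q - p.
Proof.
move=> pq; rewrite /Vop /Rintegral.
rewrite (@integral_indic _ _ R mu `[t, +oo[%classic)//=.
have -> : q - p = fine (mu `[p, q]%classic).
  rewrite lebesgue_measure_itv/= lte_fin; case: ifP => //= /negbT.
  by rewrite -leNgt => qp; apply/eqP; rewrite subr_eq0 eq_le pq qp.
rewrite fine_le//.
- rewrite ge0_fin_numE//; apply: (@le_lt_trans _ _ (mu `[p, q]%classic)).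
    by apply: le_measure; rewrite ?inE//; apply: measurableI.
  by rewrite lebesgue_measure_itv/= lte_fin; case: ifP => // _; rewrite -EFinB ltry.
- by rewrite lebesgue_measure_itv/= lte_fin; case: ifP.
- by apply: le_measure; rewrite ?inE//; apply: measurableI.
Qed.

(** The factor q - p, rather than a mere exponential bound, is what makes [Eab] Lipschitz in its
    second argument. *)
Lemma Top_indic_le w B p q t : 0 < w -> p <= q -> q <= B ->
  Top (\1_(`[p, q]%classic)) t <= (q - p) * (expR (w * B) / w) * expN w t.
Proof.
move=> w0 pq qB; have dI := expdom_indic p w0 qB.
have c0 : 0 <= expR (w * B) / w * expN w t.
  by rewrite mulr_ge0// ltW ?divr_gt0 ?expR_gt0.
apply: (@le_trans _ _ (expR (w * B) / w * expN w t * Vop (\1_(`[p, q]%classic)) t)).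
  rewrite /Vop /Top -RintegralZl//; last exact: integrable_expdom dI.
  apply: le_Rintegral => //.
  - exact: (integrable_moment w0 dI).
  - exact: (integrableZl _ _ (integrable_expdom _ w0 dI)).
  move=> u; rewrite /= in_itv /= andbT => tu.
  rewrite indicE; case: (boolP (u \in _)) => h /=; last by rewrite !mulr0.
  rewrite !mulr1; apply: (le_trans (linear_le_exp (u - t) w0)).
  rewrite mulrAC ler_pM2r ?invr_gt0// /expN -expRD ler_expR -mulrBr ler_wpM2l ?(ltW w0)// lerD2r.
  by move: h; rewrite inE /= in_itv /= => /andP[_ /le_trans]; apply.
rewrite [leRHS](_ : _ = expR (w * B) / w * expN w t * (q - p)); last by ring.
by rewrite ler_wpM2l// Vop_indic_le.
Qed.

Lemma Top_strict w C1 C2 k1 k2 d p q t : 0 < w -> expdom w C1 k1 -> expdom w C2 k2 ->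
  0 <= d -> t <= p -> p < q -> (forall u, t <= u -> k1 u <= k2 u) ->
  (forall u, p <= u <= q -> k1 u + d <= k2 u) ->
  Top k1 t + d * ((q - p) * (q + p - 2 * t) / 2) <= Top k2 t.
Proof.
move=> w0 d1 d2 d0 tp pq k12 kd.
have dI := expdom_indic p w0 (lexx q).
rewrite -Top_indic// -(TopZ w0 d t dI) -(TopD w0 t d1 (expdomZ d0 dI)).
apply: (le_Top w0 (expdomD d1 (expdomZ d0 dI)) d2) => u tu.
rewrite indicE; case: (boolP (u \in _)) => h /=; last by rewrite mulr0 addr0 k12.
by rewrite mulr1 kd//; move: h; rewrite inE /= in_itv.
Qed.

Section Weight.
Variables (w a b B : R).
Hypotheses (w0 : 0 < w) (wa : expR (w * a) <= w ^+ 2) (bB : b <= B).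
Let K := expR (w * B).

(** The constant [K] makes K exp (- w t) at least 1 on the plateau. Off it, the lag multiplies the
    exponential by exp (w a), which the division by w ^ 2 compensates. *)
Lemma Fab_supersol : supersol w K `[a, b]%classic (fun t => t - a)
  (fun t => K / w ^+ 2 * expN w t).
Proof.
have K0 : 0 < K by exact: expR_gt0.
have dK : expdom w K (kab a b (fun t => K / w ^+ 2 * expN w t)).
  split.
    apply: measurable_kfun => //; first exact: measurable_lag.
    by apply: measurable_funM => //; exact: measurable_expN.
  move=> t; have [h|h] := boolP (a <= t <= b).
    rewrite kab_in// ler01 one_le_expN//.
    by case/andP: h => _ /le_trans; apply.
  rewrite kab_out// mulr_ge0 ?divr_ge0 ?sqr_ge0 ?(ltW K0) ?(ltW (expN_gt0 _ _))//=.
  rewrite expN_shift mulrA ler_wpM2r ?(ltW (expN_gt0 _ _))//.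
  by rewrite -mulrA ler_piMr ?(ltW K0)// mulrC ler_pdivrMr ?exprn_gt0// mul1r.
split=> // t; first by rewrite mulr_ge0 ?divr_ge0 ?sqr_ge0 ?(ltW K0) ?(ltW (expN_gt0 _ _)).
exact: Top_le dK.
Qed.

Let mA : measurable `[a, b]%classic. Proof. by []. Qed.

Lemma expdom_Fab : expdom w K (kab a b (Fab a b)).
Proof. exact: (expdom_sol w0 mA (measurable_lag a) Fab_supersol). Qed.

Lemma Fab_fix : Fab a b = Top (kab a b (Fab a b)).
Proof. exact: (sol_fixE w0 mA (measurable_lag a) Fab_supersol). Qed.

Lemma Fab_ge0 t : 0 <= Fab a b t.
Proof. exact: (sol_ge0 w0 mA (measurable_lag a) Fab_supersol). Qed.

Lemma Fab_nincr t u : t <= u -> Fab a b u <= Fab a b t.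
Proof. exact: (sol_nincr w0 mA (measurable_lag a) Fab_supersol). Qed.

Lemma Fab_le t : Fab a b t <= K / w ^+ 2 * expN w t.
Proof. exact: (sol_le w0 mA (measurable_lag a) Fab_supersol). Qed.

Lemma Fab_continuous : continuous (Fab a b).
Proof. by rewrite Fab_fix; apply: Top_continuous expdom_Fab. Qed.

Lemma Fab_measurable : measurable_fun [set: R] (Fab a b).
Proof. by apply: continuous_measurable_fun; exact: Fab_continuous. Qed.

Lemma is_derive_Fab t : is_derive t 1 (Fab a b) (- Vop (kab a b (Fab a b)) t).
Proof. by rewrite {1}Fab_fix; exact: (is_derive_Top w0 expdom_Fab t). Qed.

Lemma Fab_lip t u : t <= u ->
  Fab a b t - Fab a b u <= (u - t) * (K / w * expN w t).
Proof.
move=> tu; rewrite Fab_fix; have /andP[_ h] := Top_diff w0 expdom_Fab tu.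
by apply: (le_trans h); rewrite ler_wpM2l ?subr_ge0// (Vop_le w0 expdom_Fab).
Qed.

Lemma Vop_kab_ge u : a <= b -> u <= b ->
  b - Num.max u a <= Vop (kab a b (Fab a b)) u.
Proof.
move=> ab ub; set m := Num.max u a.
have mb : m <= b by rewrite ge_max ub.
have um : u <= m by rewrite le_max lexx.
have am : a <= m by rewrite le_max lexx orbT.
apply: le_trans (Vop_nincr w0 expdom_Fab um).
have h v : m <= v <= b -> 1 <= kab a b (Fab a b) v <= 1.
  by move=> /andP[mv vb]; rewrite kab_in ?lexx// vb andbT (le_trans am).
have /andP[] := Vop_diff mb (integrable_expdom m w0 expdom_Fab) h.
rewrite mul1r => h1 _; apply: (le_trans h1); rewrite gerBl.
exact: (Vop_ge0 expdom_Fab b).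
Qed.

Lemma Fab_decr t u : a < b -> t < u -> u < b -> Fab a b u < Fab a b t.
Proof.
move=> ab tu ub; rewrite Fab_fix.
have /andP[h _] := Top_diff w0 expdom_Fab (ltW tu).
rewrite -subr_gt0; apply: lt_le_trans h; rewrite mulr_gt0 ?subr_gt0//.
apply: lt_le_trans (Vop_kab_ge (ltW ab) (ltW ub)).
by rewrite subr_gt0 gt_max ub.
Qed.

Lemma Fab_min w' C' y t : 0 < w' ->
  supersol w' C' `[a, b]%classic (fun t => t - a) y -> Fab a b t <= y t.
Proof. by move=> w'0 sy; exact: (sol_le w'0 mA (measurable_lag a) sy). Qed.

(* Slack in the inequality [Top (kab a b y) <= y] turns into a strict bound on
   [Fab a b]. *)
Lemma Fab_le_Top C' y t : supersol w C' `[a, b]%classic (fun t => t - a) y ->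
  Fab a b t <= Top (kab a b y) t.
Proof.
move=> sy; have [dy _ _] := sy; rewrite {1}Fab_fix.
by apply: (le_Top w0 expdom_Fab dy) => u _; apply: le_kfun => s; exact: Fab_min sy.
Qed.

End Weight.

Definition Eab a b := Fab a b 0.

(** The solution [F] for [b'] is a supersolution for [b]: on the removed part of the plateau the
    value 1 is replaced by F (t - a) <= F 0 <= 1. On the right half of that part the loss is at
    least 1 - F (b - a) > 0, which gives strictness. *)
Lemma Eab_lt_b w a b b' : 0 < w -> expR (w * a) <= w ^+ 2 -> 0 <= a ->
  a < b -> b < b' -> Eab a b' <= 1 -> Eab a b < Eab a b'.
Proof.
move=> w0 wa a0 ab bb' E1; set F := Fab a b'.
have dF := expdom_Fab w0 wa (lexx b').
have ab' : a < b' by exact: lt_trans bb'.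
have kle t : kab a b F t <= kab a b' F t.
  have [h|h] := boolP (a <= t <= b).
    by rewrite !kab_in//; case/andP: h => -> /le_trans -> //; exact: ltW.
  rewrite kab_out//; have [h'|h'] := boolP (a <= t <= b'); last by rewrite kab_out.
  rewrite kab_in//; apply: le_trans E1; apply: (Fab_nincr w0 wa (lexx b')).
  by case/andP: h' => h' _; rewrite subr_ge0.
have dk : expdom w (expR (w * b')) (kab a b F).
  split.
    apply: measurable_kfun => //; first exact: measurable_lag.
    exact: (Fab_measurable w0 wa (lexx b')).
  move=> t; rewrite kfun_ge0 ?(le_trans (kle t))//; last exact: (Fab_ge0 w0 wa (lexx b')).
  by case: dF => _ /(_ t)/andP[].
have sF : supersol w (expR (w * b')) `[a, b]%classic (fun t => t - a) F.
  split => // t; first exact: (Fab_ge0 w0 wa (lexx b')).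
  rewrite {2}/F (Fab_fix w0 wa (lexx b')).
  by apply: (le_Top w0 dk dF).
have Fd : F (b - a) < F 0.
  by apply: (Fab_decr w0 wa (lexx b')) => //; lra.
apply: (le_lt_trans (Fab_le_Top w0 wa (lexx b) 0 sF)).
rewrite /Eab -/F {2}/F (Fab_fix w0 wa (lexx b')) -/F.
have FE : F 0 <= 1 by [].
have h := Top_strict w0 dk dF (d := 1 - F (b - a)) (p := (b + b') / 2) (q := b') (t := 0).
apply: lt_le_trans (h _ _ _ _ _); first 1 last.
- lra.
- lra.
- lra.
- by move=> u _; exact: kle.
- move=> u /andP[u1 u2]; rewrite kab_out; last by apply/negP => /andP[]; lra.
  rewrite kab_in; last by apply/andP; split; lra.
  have : F (u - a) <= F (b - a) by apply: (Fab_nincr w0 wa (lexx b')); lra.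
  lra.
- rewrite ltrDl mulr_gt0 ?subr_gt0//; first by lra.
  by rewrite divr_gt0// mulr_gt0//; lra.
Qed.

(** The solution [F] for [a'] is a supersolution for [a]: on the part added to the plateau F (t -
    a') >= F 0 = 1 is replaced by 1, and elsewhere the shorter lag evaluates [F] later. On the left
    half of the added part the replaced value is at least F ((a - a') / 2) > 1. *)
Lemma Eab_lt_a w a a' b : 0 < w -> expR (w * a') <= w ^+ 2 -> 0 <= a ->
  a < a' -> a' < b -> Eab a' b = 1 -> Eab a b < 1.
Proof.
move=> w0 wa' a0 aa' ab E1; set F := Fab a' b.
have wa : expR (w * a) <= w ^+ 2.
  by apply: le_trans wa'; rewrite ler_expR ler_wpM2l ?ltW.
have dF := expdom_Fab w0 wa' (lexx b).
have Fn := Fab_nincr w0 wa' (lexx b).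
have F1 : F 0 = 1 by [].
have kle t : kab a b F t <= kab a' b F t.
  have [h|h] := boolP (a <= t <= b).
    rewrite kab_in//; have [h'|h'] := boolP (a' <= t <= b); first by rewrite kab_in.
    rewrite kab_out// -F1 Fn//.
    move: h h' => /andP[h1 h2]; rewrite h2 andbT -ltNge; lra.
  rewrite kab_out// kab_out; last first.
    by apply: contra h => /andP[h1 ->]; rewrite andbT (le_trans (ltW aa')).
  by apply: Fn; lra.
have dk : expdom w (expR (w * b)) (kab a b F).
  split.
    apply: measurable_kfun => //; first exact: measurable_lag.
    exact: (Fab_measurable w0 wa' (lexx b)).
  move=> t; rewrite kfun_ge0 ?(le_trans (kle t))//; last exact: (Fab_ge0 w0 wa' (lexx b)).
  by case: dF => _ /(_ t)/andP[].
have sF : supersol w (expR (w * b)) `[a, b]%classic (fun t => t - a) F.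
  split => // t; first exact: (Fab_ge0 w0 wa' (lexx b)).
  rewrite {2}/F (Fab_fix w0 wa' (lexx b)).
  by apply: (le_Top w0 dk dF).
have Fd : F 0 < F ((a - a') / 2).
  by apply: (Fab_decr w0 wa' (lexx b)) => //; lra.
apply: (le_lt_trans (Fab_le_Top w0 wa (lexx b) 0 sF)).
rewrite -F1 {2}/F (Fab_fix w0 wa' (lexx b)) -/F.
have h := Top_strict w0 dk dF (d := F ((a - a') / 2) - 1) (p := a) (q := (a + a') / 2) (t := 0).
apply: lt_le_trans (h _ _ _ _ _); first 1 last.
- lra.
- lra.
- lra.
- by move=> u _; exact: kle.
- move=> u /andP[u1 u2]; rewrite kab_in; last by apply/andP; split; lra.
  rewrite kab_out; last by apply/negP => /andP[]; lra.
  have : F ((a - a') / 2) <= F (u - a') by apply: Fn; lra.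
  by rewrite addrCA subrr addr0.
- rewrite ltrDl mulr_gt0 ?subr_gt0//; first by lra.
  by rewrite divr_gt0// mulr_gt0//; lra.
Qed.

(** The competitor is F + e exp (- w t). Lengthening the plateau costs at most M exp (- w t), the
    lag multiplies the correction by q, and [e] solves M + e q = e. *)
Lemma Eab_lip_b w a b b' B : 0 < w -> expR (w * a) < w ^+ 2 ->
  a <= b -> b <= b' -> b' <= B ->
  Eab a b' <= Eab a b +
    (b' - b) * (expR (w * B) / w) / (1 - expR (w * a) / w ^+ 2).
Proof.
move=> w0 wa ab bb' b'B; have wa' := ltW wa.
set q := expR (w * a) / w ^+ 2; set F := Fab a b.
have q1 : 0 < 1 - q by rewrite subr_gt0 ltr_pdivrMr ?exprn_gt0// mul1r.
set M := (b' - b) * _; set e := M / _.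
have bB : b <= B by exact: le_trans b'B.
have e0 : 0 <= e.
  by rewrite divr_ge0 ?(ltW q1)// !mulr_ge0 ?subr_ge0 ?invr_ge0 ?(ltW w0)// ltW ?expR_gt0.
have dF := expdom_Fab w0 wa' bB.
pose y t := F t + e * expN w t.
have y0 t : 0 <= y t.
  by rewrite addr_ge0 ?(Fab_ge0 w0 wa' bB)// mulr_ge0 ?(ltW (expN_gt0 _ _)).
have dI := expdom_indic b w0 b'B.
have dG := expdomZ (c := e * expR (w * a)) ltac:(by rewrite mulr_ge0// ltW ?expR_gt0) (expdom_expN w).
have dS := expdomD (expdomD dF dI) dG.
have kle t : kab a b' y t <= kab a b F t + \1_(`[b, b']%classic) t +
     e * expR (w * a) * expN w t.
  have G0 : 0 <= e * expR (w * a) * expN w t.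
    by apply: mulr_ge0; [apply: mulr_ge0 => //; exact: expR_ge0|exact/ltW/expN_gt0].
  have I0 : 0 <= \1_(`[b, b']%classic) t :> R by rewrite indicE.
  have [h|h] := boolP (a <= t <= b').
    rewrite (kab_in _ h); have [h'|h'] := boolP (a <= t <= b).
      by rewrite kab_in//; lra.
    have -> : \1_(`[b, b']%classic) t = 1 :> R.
      rewrite indicE mem_set// /= in_itv /=; move: h h' => /andP[-> ->] /=.
      by rewrite -ltNge andbT => /ltW.
    have := kfun_ge0 `[a, b]%classic (fun t => t - a) t (Fab_ge0 w0 wa' bB).
    rewrite -/(kab _ _ _ _) -/F; lra.
  rewrite !kab_out//; last first.
    by apply: contra h => /andP[-> /le_trans] ->.
  rewrite /y expN_shift; lra.
have dk : expdom w (expR (w * B) + expR (w * B) + e * expR (w * a) * 1) (kab a b' y).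
  split.
    apply: measurable_kfun => //; first exact: measurable_lag.
    apply: measurable_funD; first exact: (Fab_measurable w0 wa' bB).
    by apply: measurable_funM => //; exact: measurable_expN.
  move=> t; rewrite kfun_ge0//=; apply: (le_trans (kle t)).
  by case: dS => _ /(_ t)/andP[].
have sy : supersol w (expR (w * B) + expR (w * B) + e * expR (w * a) * 1)
    `[a, b']%classic (fun t => t - a) y.
  split => // t; apply: (le_trans (le_Top w0 dk dS (fun u _ => kle u))).
  rewrite (TopD w0 t (expdomD dF dI) dG) (TopD w0 t dF dI) (TopZ w0 _ t (expdom_expN w)).
  rewrite -(Fab_fix w0 wa' bB) -/F Top_expN//.
  have := Top_indic_le t w0 bb' b'B; rewrite -/M => hI.
  have -> : e * expR (w * a) * (expN w t / w ^+ 2) = e * q * expN w t by rewrite /q; ring.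
  have -> : y t = F t + M * expN w t + e * q * expN w t.
    rewrite /y -addrA; congr (_ + _); rewrite -mulrDl; congr (_ * _).
    by rewrite /e; field; rewrite gt_eqF.
  by rewrite lerD2r lerD2l.
apply: (le_trans (Fab_min 0 w0 sy)).
by rewrite /y /expN mulr0 oppr0 expR0 mulr1.
Qed.

(** Same competitor as in [Eab_lip_b], the cost [M] now coming from the Lipschitz bound on [F]
    between t - a' and t - a. The bound by 1 at the smaller lag handles the times that leave the
    plateau. *)
Lemma Eab_lip_a w a a' a1 b : 0 < w -> expR (w * a1) < w ^+ 2 ->
  a < a' -> a' <= a1 -> a' <= b -> Eab a b <= 1 ->
  Eab a' b <= Eab a b +
    (a' - a) * (expR (w * b) / w) / (1 - expR (w * a1) / w ^+ 2).
Proof.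
move=> w0 wa1 aa' a'1 a'b E1; have wa1' := ltW wa1.
have wa'1 : expR (w * a') <= expR (w * a1) by rewrite ler_expR ler_wpM2l// ltW.
have wa' : expR (w * a') <= w ^+ 2 by exact: le_trans wa1'.
have wa : expR (w * a) <= w ^+ 2.
  by apply: le_trans wa'; rewrite ler_expR ler_wpM2l ?ltW.
set q := expR (w * a1) / w ^+ 2; set F := Fab a b.
have w20 : 0 < w ^+ 2 by rewrite exprn_gt0.
have q1 : 0 < 1 - q by rewrite subr_gt0 ltr_pdivrMr// mul1r.
set M := (a' - a) * _; set e := M / _.
have M0 : 0 <= M.
  by rewrite !mulr_ge0 ?subr_ge0 ?invr_ge0 ?(ltW w0) ?(ltW aa')// ltW ?expR_gt0.
have e0 : 0 <= e by rewrite divr_ge0 ?(ltW q1).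
have dF := expdom_Fab w0 wa (lexx b).
have Fn := Fab_nincr w0 wa (lexx b).
pose y t := F t + e * expN w t.
have y0 t : 0 <= y t.
  by rewrite addr_ge0 ?(Fab_ge0 w0 wa (lexx b))// mulr_ge0 ?(ltW (expN_gt0 _ _)).
have dG := expdomZ (c := (M + e) * expR (w * a1)) ltac:(by rewrite mulr_ge0 ?addr_ge0// ltW ?expR_gt0) (expdom_expN w).
have dS := expdomD dF dG.
have kle t : kab a' b y t <= kab a b F t + (M + e) * expR (w * a1) * expN w t.
  have X0 : 0 <= (M + e) * expR (w * a1) * expN w t.
    apply: mulr_ge0; last exact/ltW/expN_gt0.
    by apply: mulr_ge0; [exact: addr_ge0|exact: expR_ge0].
  have [h|h] := boolP (a' <= t <= b).
    rewrite kab_in// kab_in ?lerDl//.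
    by case/andP: h => h ->; rewrite andbT; lra.
  rewrite (kab_out _ h) /y.
  have hF : F (t - a') <= kab a b F t + M * expR (w * a1) * expN w t.
    have l : F (t - a') <= F (t - a) + M * expR (w * a1) * expN w t.
      have := @Fab_lip w a b b w0 wa (lexx b) (t - a') (t - a) ltac:(lra).
      have -> : t - a - (t - a') = a' - a by ring.
      rewrite expN_shift -/F => hl; rewrite -lerBlDl (le_trans hl)// /M -!mulrA.
      by rewrite ler_wpM2l ?subr_ge0 ?(ltW aa')// !ler_wpM2l ?invr_ge0 ?(ltW w0) ?ler_wpM2r ?(ltW (expR_gt0 _))// ltW ?expN_gt0.
    apply: (le_trans l); rewrite lerD2r.
    have [h'|h'] := boolP (a <= t <= b); last by rewrite kab_out.
    rewrite kab_in//; apply: le_trans E1; apply: Fn.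
    by case/andP: h'; rewrite subr_ge0.
  have hG : e * expN w (t - a') <= e * expR (w * a1) * expN w t.
    by rewrite expN_shift mulrA ler_wpM2r ?(ltW (expN_gt0 _ _))// ler_wpM2l.
  apply: (le_trans (lerD hF hG)); lra.
have dk : expdom w (expR (w * b) + (M + e) * expR (w * a1) * 1) (kab a' b y).
  split.
    apply: measurable_kfun => //; first exact: measurable_lag.
    apply: measurable_funD; first exact: (Fab_measurable w0 wa (lexx b)).
    by apply: measurable_funM => //; exact: measurable_expN.
  move=> t; rewrite kfun_ge0//=; apply: (le_trans (kle t)).
  by case: dS => _ /(_ t)/andP[].
have sy : supersol w (expR (w * b) + (M + e) * expR (w * a1) * 1)
    `[a', b]%classic (fun t => t - a') y.
  split => // t; apply: (le_trans (le_Top w0 dk dS (fun u _ => kle u))).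
  rewrite (TopD w0 t dF dG) (TopZ w0 _ t (expdom_expN w)).
  rewrite -(Fab_fix w0 wa (lexx b)) -/F Top_expN//.
  rewrite /y lerD2l (_ : _ * _ = (M + e) * q * expN w t); last by rewrite /q; ring.
  rewrite ler_wpM2r ?(ltW (expN_gt0 _ _))//.
  have -> : (M + e) * q = e - M * (1 - q).
    have : e * (1 - q) = M by rewrite /e divfK// gt_eqF.
    by move=> <-; ring.
  by rewrite gerBl mulr_ge0// ltW.
apply: (le_trans (Fab_min 0 w0 sy)).
by rewrite /y /expN mulr0 oppr0 expR0 mulr1.
Qed.

Lemma Eab_diag w a : 0 < w -> expR (w * a) <= w ^+ 2 -> Eab a a <= 0.
Proof.
move=> w0 wa.
have mA : measurable `[a, a]%classic by [].
have dk : expdom w (expR (w * a)) (kab a a (fun=> 0)).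
  split; first by apply: measurable_kfun => //; exact: measurable_lag.
  move=> t; have [h|h] := boolP (a <= t <= a); last first.
    by rewrite kab_out// lexx /= mulr_ge0// expR_ge0.
  by rewrite kab_in// ler01 one_le_expN//; case/andP: h.
have kE : kab a a (fun=> 0) = \1_(`[a, a]%classic).
  apply/funext => t; have [h|h] := boolP (a <= t <= a).
    by rewrite kab_in// indicE mem_set//= in_itv.
  by rewrite kab_out// indicE memNset//= in_itv /=; exact/negP.
apply: (@Fab_min a a w (expR (w * a)) (fun=> 0) 0 w0); split => // t.
rewrite -/(kab _ _ _) kE; have := Top_indic_le t w0 (lexx a) (lexx a).
by rewrite subrr !mul0r.
Qed.

Lemma Eab_ge w a b : 0 < w -> expR (w * a) <= w ^+ 2 -> 0 <= a -> a < b ->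
  (b - a) * (b + a) / 2 <= Eab a b.
Proof.
move=> w0 wa a0 ab; have dF := expdom_Fab w0 wa (lexx b).
rewrite /Eab (Fab_fix w0 wa (lexx b)).
have := @Top_indic R a b 0 a0 ab; rewrite mulr0 subr0 => <-.
apply: (le_Top w0 (expdom_indic a w0 (lexx b)) dF) => u _.
rewrite indicE; case: (boolP (u \in _)) => h /=.
  by rewrite kab_in//; move: h; rewrite inE /= in_itv.
exact: (kfun_ge0 _ _ _ (Fab_ge0 w0 wa (lexx b))).
Qed.

(** With zero lag the values at t >= 0 involve only later times. Minimality selects the solution
    that vanishes beyond [b], so the iterates receive nothing from outside the plateau. *)
Lemma Eab_0 b : 0 < b -> Eab 0 b = b ^+ 2 / 2.
Proof.
move=> b0; pose w : R := 2.
have w0 : 0 < w by [].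
have wa : expR (w * 0) <= w ^+ 2 by rewrite mulr0 expR0 /w; lra.
apply/eqP; rewrite eq_le; apply/andP; split; last first.
  have := Eab_ge w0 wa (lexx 0) b0; rewrite subr0 addr0; lra.
have Tb : Top (\1_(`[0, b]%classic)) 0 = b ^+ 2 / 2.
  by rewrite Top_indic//; field.
have dI := expdom_indic 0 w0 (lexx b).
have T0 t : b < t -> Top (\1_(`[0, b]%classic)) t = 0.
  move=> bt; rewrite /Top; transitivity (\int[mu]_(u in `[t, +oo[%classic) (cst 0 u : R)).
    apply: eq_Rintegral => u; rewrite inE /= in_itv /= andbT => tu.
    by rewrite indicE memNset ?mulr0//= in_itv /= => /andP[_ ub]; have := le_trans tu ub; lra.
  by rewrite Rintegral_cst// mul0r.
have mA : measurable `[0, b]%classic by [].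
have sy := Fab_supersol w0 wa (lexx b).
suff H n t : 0 <= t -> solI `[0, b]%classic (fun t => t - 0) n t <= Top (\1_(`[0, b]%classic)) t.
  rewrite -Tb; apply: ge_sup; first by exists 0; exists 0%N.
  by move=> _ [n _ <-]; exact: H.
elim: n t => [|n IH] t t0; first exact: (Top_ge0 dI t).
apply: (le_Top w0 (expdom_solI w0 mA (measurable_lag 0) sy n) dI) => u tu.
have u0 : 0 <= u by exact: le_trans tu.
rewrite -/(kab _ _ _ _); have [h|h] := boolP (0 <= u <= b).
  by rewrite kab_in// indicE mem_set//= in_itv.
rewrite kab_out// subr0; apply: (le_trans (IH _ u0)).
by rewrite T0// ltNge; apply: contra h => ->; rewrite u0.
Qed.

End SinglePlateau.

(** * Exponential solutions and the formulas for the single plateau *)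

Section LambertRoots.
Variable R : realType.
Implicit Types (a x z : R).

Lemma lambertW0P x : - expR (- 1) <= x ->
  -1 <= lambertW0 x /\ lambertW0 x * expR (lambertW0 x) = x.
Proof.
move=> ex; rewrite /lambertW0.
suff H : exists v, [set v : R | -1 <= v /\ v * expR v = x] v by exact: (xgetPex 0 H).
have x1 : -1 <= `|x| by apply: (le_trans (y := 0)).
have c : {within `[-1, `|x|], continuous (fun v : R => v * expR v)}.
  apply: continuous_subspaceT => v; apply: cvgM; first exact: cvg_id.
  exact: continuous_expR.
have [|v] := IVT (v := x) x1 c.
  have h : x <= `|x| * expR `|x|.
    apply: (le_trans (ler_norm x)); rewrite ler_peMr// -expR0 ler_expR//.
  by rewrite mulN1r ge_min ex /= le_max h orbT.
by rewrite in_itv /= => /andP[v1 _] vx; exists v.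
Qed.

(** If v is the Lambert value, v exp v = -a/2 or a/2 turns [rpar a] or [spar a] into exp (- v). The
    inequalities are the range of v: between -1 and 0 for [rpar], positive for [spar]. *)
Lemma roots_props a : 0 < a < 2 / expR 1 ->
  [/\ 1 < rpar a, a * rpar a < 2 & expR (a * rpar a / 2) = rpar a] /\
  [/\ 0 < spar a, spar a < 1 & expR (- (a * spar a)) = spar a ^+ 2].
Proof.
move=> /andP[a0 ae]; have e0 := expR_gt0 (1 : R).
have a20 : 0 < a / 2 by rewrite divr_gt0.
have an0 : a != 0 by rewrite gt_eqF.
have ale : a / 2 < expR (- 1).
  by rewrite expRN ltr_pdivrMr// mulrC.
split.
- have [] := @lambertW0P (- (a / 2)); first by rewrite lerN2 ltW.
  rewrite /rpar; set v := lambertW0 _ => v1 vE.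
  have v0 : v < 0 by rewrite -(pmulr_llt0 _ (expR_gt0 v)) vE oppr_lt0.
  have vn : -1 < v.
    rewrite lt_neqAle v1 andbT; apply/negP => /eqP ve.
    have := vE; rewrite -ve mulN1r => /oppr_inj => E; by rewrite E ltxx in ale.
  have rE : - (2 / a) * v = expR (- v).
    rewrite expRN; apply: (mulIf (x := expR v)); first by rewrite gt_eqF ?expR_gt0.
    by rewrite mulVf ?gt_eqF ?expR_gt0// -mulrA vE; field.
  rewrite rE; split.
  + by rewrite -expR0 ltr_expR; lra.
  + by rewrite -rE mulrA mulrN mulrCA divff// mulr1; lra.
  + by congr expR; rewrite -rE; field.
- have [] := @lambertW0P (a / 2).
    by apply: (le_trans (y := 0)); [rewrite oppr_le0 ltW ?expR_gt0|exact: ltW].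
  rewrite /spar; set v := lambertW0 _ => v1 vE.
  have v0 : 0 < v by rewrite -(pmulr_lgt0 _ (expR_gt0 v)) vE.
  have sE : (2 / a) * v = expR (- v).
    rewrite expRN; apply: (mulIf (x := expR v)); first by rewrite gt_eqF ?expR_gt0.
    by rewrite mulVf ?gt_eqF ?expR_gt0// -(mulrA (2 / a)) vE; field.
  rewrite sE; split.
  + exact: expR_gt0.
  + by rewrite -expR0 ltr_expR; lra.
  + by rewrite -expRM_natl; congr expR; rewrite -sE; field.
Qed.

End LambertRoots.

(** * Backward uniqueness for x''(t) = x(t - a) in an exponential growth class *)

Section DelayODE.
Variable R : realType.
Implicit Types (w a b c l p q r s t u v x y : R) (f g : R -> R).

Lemma is_derive_lag f a t l : is_derive (t - a) 1 f l ->
  is_derive t 1 (fun t => f (t - a)) l.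
Proof.
move=> df; have h : is_derive t 1 (fun t : R => t - a) 1.
  by apply: is_derive_eq; rewrite subr0.
by apply: (is_derive_eq (@is_derive1_comp _ f (fun t => t - a) t l 1 df h)); rewrite mulr1.
Qed.

Lemma eq_of_derive0 f p q : p <= q -> (forall x, {for x, continuous f}) ->
  (forall x, p < x < q -> is_derive x 1 f 0) -> f p = f q.
Proof.
move=> pq cf df; apply/eqP; rewrite eq_le; apply/andP; split.
  apply: (@nondecreasing_of_derive _ f (fun=> 0) p q pq) => //.
  by apply: continuous_subspaceT => x; exact: cf.
rewrite -lerN2; apply: (@nondecreasing_of_derive _ (fun x => - f x) (fun=> 0) p q pq) => //.
  by apply: continuous_subspaceT => x; apply: cvgN; exact: cf.
by move=> x h; have := df x h => dfx; apply: is_derive_eq; rewrite oppr0.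
Qed.

(** The function N exp (- w t) has second derivative M exp (- w (t - a)), which dominates that of
    [D]. It is nonnegative and nonincreasing while [D] has zero data at [a], so two integrations
    backwards from [a] preserve the order. *)
Lemma backward_step w a M (D D1 : R -> R) : 0 < w -> 0 <= a ->
  (forall x, is_derive x 1 D (D1 x)) -> continuous D1 ->
  (forall x, x < a -> is_derive x 1 D1 (D (x - a))) ->
  D a = 0 -> D1 a = 0 -> 0 <= M ->
  (forall t, t <= a -> D t <= M * expN w t) ->
  forall t, t <= a -> D t <= M * (expR (w * a) / w ^+ 2) * expN w t.
Proof.
move=> w0 a0 dD cD1 dD1 Da D1a M0 DM t ta.
set N := M * _.
pose phi1 x := - w * N * expN w x - D1 x.
have phi1_le x : x <= a -> phi1 x <= phi1 a.
  move=> xa; apply: (@nondecreasing_of_derive _ phi1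
    (fun x => w ^+ 2 * N * expN w x - D (x - a)) x a xa).
  - apply: continuous_subspaceT => z; apply: cvgB; last exact: cD1.
    by apply: cvgM; [exact: cvg_cst|exact: continuous_expN].
  - move=> z /andP[_ za]; have h := dD1 z za; have h' := is_derive_expN w z.
    by apply: is_derive_eq; rewrite /GRing.scale /=; ring.
  - move=> z /andP[_ za]; rewrite subr_ge0; apply: (le_trans (DM _ _)).
      by rewrite lerBlDr (le_trans (ltW za))// lerDl.
    rewrite expN_shift /N le_eqVlt; apply/orP; left; apply/eqP.
    by field; rewrite gt_eqF.
have N0 : 0 <= N by rewrite mulr_ge0// divr_ge0 ?expR_ge0// sqr_ge0.
have phi1_le0 x : x <= a -> phi1 x <= 0.
  move=> xa; apply: (le_trans (phi1_le x xa)).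
  rewrite /phi1 D1a subr0 !mulNr oppr_le0 mulr_ge0 ?(ltW (expN_gt0 _ _))//.
  by rewrite mulr_ge0// ltW.
pose phi x := - (N * expN w x - D x).
have : phi t <= phi a.
  apply: (@nondecreasing_of_derive _ phi (fun x => - phi1 x) t a ta).
  - apply: continuous_subspaceT => z; apply: cvgN; apply: cvgB.
      by apply: cvgM; [exact: cvg_cst|exact: continuous_expN].
    exact: (is_derive_continuous (dD z)).
  - move=> z _; have h := dD z; have h' := is_derive_expN w z.
    by apply: is_derive_eq; rewrite /GRing.scale /phi1 /=; ring.
  - by move=> z /andP[_ za]; rewrite oppr_ge0 phi1_le0// ltW.
rewrite /phi Da subr0 lerN2 => h.
rewrite -subr_ge0; apply: le_trans h; rewrite mulr_ge0//.
exact/ltW/expN_gt0.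
Qed.

(** Data at [a] alone do not determine a solution to the left of [a]; the growth bound does, since
    [backward_step] improves it by a factor q < 1 each time. *)
Lemma backward_unique w a M (D D1 : R -> R) : 0 < w -> 0 <= a ->
  expR (w * a) < w ^+ 2 ->
  (forall x, is_derive x 1 D (D1 x)) -> continuous D1 ->
  (forall x, x < a -> is_derive x 1 D1 (D (x - a))) ->
  D a = 0 -> D1 a = 0 -> 0 <= M ->
  (forall t, t <= a -> `|D t| <= M * expN w t) ->
  forall t, t <= a -> D t = 0.
Proof.
move=> w0 a0 wa dD cD1 dD1 Da D1a M0 DM t ta.
set q := expR (w * a) / w ^+ 2.
have q0 : 0 <= q by rewrite divr_ge0 ?expR_ge0// sqr_ge0.
have q1 : q < 1 by rewrite ltr_pdivrMr ?exprn_gt0// mul1r.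
have H n : forall t, t <= a -> `|D t| <= M * q ^+ n * expN w t.
  elim: n => [|n IH] x xa; first by rewrite expr0 mulr1 DM.
  have Mq : 0 <= M * q ^+ n by rewrite mulr_ge0// exprn_ge0.
  rewrite exprSr mulrA ler_norml lerNl; apply/andP; split.
    apply: (@backward_step w a (M * q ^+ n) (fun x => - D x) (fun x => - D1 x)) => //.
    - by move=> z; apply: cvgN; exact: cD1.
    - by move=> z za; have h := dD1 z za; apply: is_derive_eq.
    - by rewrite Da oppr0.
    - by rewrite D1a oppr0.
    - by move=> z za; have := IH z za; rewrite ler_norml lerNl => /andP[].
  apply: (@backward_step w a (M * q ^+ n) D D1) => //.
  by move=> z za; have := IH z za; rewrite ler_norml => /andP[].
apply/eqP; rewrite -normr_le0.
have cv : M * q ^+ n * expN w t @[n --> \oo] --> 0.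
  rewrite -[X in _ --> X](mul0r (expN w t)); apply: cvgM; last exact: cvg_cst.
  rewrite -[X in _ --> X](mulr0 M); apply: cvgM; first exact: cvg_cst.
  by apply: cvg_expr; rewrite ger0_norm.
by apply: (cvgr_to_ge cv); apply: nearW => n; exact: H.
Qed.

End DelayODE.

(** * Exponential form on the left of the plateau, and first integrals *)

Section PlateauODE.
Variable R : realType.
Implicit Types (w a b c l p q r s t u v x y : R) (f g : R -> R).

Lemma kab_continuous a b f t : continuous f -> t != a -> t != b ->
  {for t, continuous (kab a b f)}.
Proof.
move=> cf ta tb; have cl : {for t, continuous (fun t => f (t - a))}.
  apply: (@cvg_comp _ _ _ (fun t => t - a) f _ (nbhs (t - a))); last exact: cf.
  by apply: cvgB; [exact: cvg_id|exact: cvg_cst].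
have [h|h] := boolP (a <= t <= b).
- have h' : t \in `]a, b[.
    by rewrite in_itv /= !lt_neqAle; case/andP: h => -> ->; rewrite eq_sym ta tb.
  rewrite /prop_for /continuous_at kab_in//.
  apply: cvg_near_cst; near=> x; rewrite kab_in//.
  have : x \in `]a, b[ by near: x; exact: near_in_itvoo.
  by rewrite in_itv /= => /andP[? ?]; rewrite !ltW.
- rewrite /prop_for /continuous_at kab_out//.
  suff N : \forall x \near t, f (x - a) = kab a b f x.
    by apply: cvg_trans cl; exact: near_eq_cvg N.
  move: h; rewrite !negb_and -!ltNge => /orP[h|h]; near=> x;
    rewrite kab_out// negb_and -!ltNge; apply/orP.
    left; have : ball t (a - t) x by near: x; apply: nbhsx_ballx; rewrite subr_gt0.
    by rewrite /ball /= ltr_distlC => /andP[_]; rewrite addrC subrK.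
  right; have : ball t (t - b) x by near: x; apply: nbhsx_ballx; rewrite subr_gt0.
  by rewrite /ball /= ltr_distlC => /andP[]; rewrite opprB addrC subrK.
Unshelve. all: by end_near. Qed.

Section Fixed.
Variables (w a b : R).
Hypotheses (w0 : 0 < w) (wa : expR (w * a) < w ^+ 2) (a0 : 0 < a) (ab : a < b).
Let K := expR (w * b).
Let F := Fab a b.
Let k := kab a b F.
Let y := Vop k.
Let wa' := ltW wa.
Let dk : expdom w K k := expdom_Fab w0 wa' (lexx b).

Lemma dFab t : is_derive t 1 F (- y t).
Proof. exact: (is_derive_Fab w0 wa' (lexx b)). Qed.

Lemma dVab t : t != a -> t != b -> is_derive t 1 y (- k t).
Proof.
move=> ta tb; apply: (is_derive_Vop w0 dk).
by apply: kab_continuous => //; exact: (Fab_continuous w0 wa' (lexx b)).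
Qed.

Lemma cVab : continuous y.
Proof. exact: (Vop_continuous w0 dk). Qed.

Lemma Fab_exponential r s : 0 < s -> 0 < r -> r < w ->
  expR (a * r) = r ^+ 2 -> expR (- (a * s)) = s ^+ 2 ->
  exists P Q : R, [/\ forall t, t <= a -> F t = P * expN r t + Q * expN (- s) t,
    F a = P / r ^+ 2 + Q / s ^+ 2 & y a = P / r - Q / s].
Proof.
move=> s0 r0 rw rE sE.
have rn0 : r != 0 by rewrite gt_eqF.
have sn0 : s != 0 by rewrite gt_eqF.
have rsn0 : r + s != 0 by rewrite gt_eqF ?addr_gt0.
(* The two components at time [a]: p + q = F a and r p - s q = y a. Moving the base point from [a]
   to 0 multiplies them by r ^ 2 and s ^ 2. *)
pose p := (s * F a + y a) / (r + s); pose q := (r * F a - y a) / (r + s).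
exists (p * r ^+ 2), (q * s ^+ 2).
have Era : expN r a = r ^- 2 by rewrite /expN mulrC expRN rE.
have Esa : expN (- s) a = s ^- 2.
  by rewrite /expN mulNr opprK mulrC -sE expRN invrK.
split; last 2 first.
- by rewrite /p /q; field; rewrite rn0 sn0 rsn0.
- by rewrite /p /q; field; rewrite rn0 sn0 rsn0.
pose u t := p * r ^+ 2 * expN r t + q * s ^+ 2 * expN (- s) t.
pose D t := F t - u t.
pose D1 t := - y t - (- r * (p * r ^+ 2) * expN r t + s * (q * s ^+ 2) * expN (- s) t).
have dE c z := is_derive_expN c z.
suff H t : t <= a -> D t = 0 by move=> t ta; apply/eqP; rewrite -subr_eq0 -/(u t) -/(D t) H.
have q10 : 0 <= w * a by rewrite mulr_ge0// ltW.
pose M := K / w ^+ 2 + `|p * r ^+ 2| * expR ((w - r) * a) +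
          `|q * s ^+ 2| * expR ((w + s) * a).
apply: (@backward_unique _ w a M D D1) => //.
- exact: ltW.
- move=> z; have h1 := dFab z; have h2 := dE r z; have h3 := dE (- s) z.
  by apply: is_derive_eq; rewrite /D1 /GRing.scale /=; ring.
- move=> z; apply: cvgB; first by apply: cvgN; exact: cVab.
  by apply: cvgD; apply: cvgM; [exact: cvg_cst|exact: continuous_expN|exact: cvg_cst|exact: continuous_expN].
- move=> z za; have h1 := dVab (negbT (lt_eqF za)) (negbT (lt_eqF (lt_trans za ab))).
  have h2 := dE r z; have h3 := dE (- s) z.
  apply: is_derive_eq; rewrite /D /u /GRing.scale /= !expN_shift.
  rewrite /k kab_out; last by rewrite negb_and -ltNge za.
  have -> : expR (r * a) = r ^+ 2 by rewrite mulrC.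
  have -> : expR (- s * a) = s ^+ 2 by rewrite mulNr mulrC.
  by ring.
- rewrite /D /u Era Esa /p /q; field; rewrite rn0 sn0 rsn0//.
- rewrite /D1 Era Esa /p /q; field; rewrite rn0 sn0 rsn0//.
- by rewrite !addr_ge0 ?mulr_ge0 ?expR_ge0 ?invr_ge0 ?sqr_ge0.
- move=> z za; rewrite /D /u.
  have b1 : `|F z| <= K / w ^+ 2 * expN w z.
    rewrite ger0_norm ?(Fab_ge0 w0 wa' (lexx b))//.
    exact: (Fab_le w0 wa' (lexx b)).
  have bnd c X : c <= w -> `|X * expN c z| <= `|X| * expR ((w - c) * a) * expN w z.
    move=> cw; rewrite normrM -mulrA ler_wpM2l// ger0_norm ?(ltW (expN_gt0 _ _))//.
    rewrite /expN -expRD ler_expR.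
    have : (w - c) * z <= (w - c) * a by rewrite ler_wpM2l// subr_ge0.
    lra.
  have b2 := bnd r (p * r ^+ 2) (ltW rw).
  have b3 := bnd (- s) (q * s ^+ 2) ltac:(lra).
  rewrite opprK in b3.
  rewrite /M [leRHS]mulrDl [X in _ <= X + _]mulrDl; apply: (le_trans (ler_normB _ _)).
  rewrite -addrA lerD//; apply: (le_trans (ler_normD _ _)); exact: lerD.
Qed.

(* A first integral of x''(t) = x(t - a): the conserved quantity attached to a
   root [- l] of the characteristic equation. *)
Definition Jfun l t : R :=
  expN l t * (l * F t - y t) +
  l ^+ 2 * (Vop (fun u => expN l u * F u) (t - a) - Vop (fun u => expN l u * F u) t).

Section Jlambda.
Variable l : R.
Hypotheses (lw : 0 < w + l) (lE : l ^+ 2 * expR (l * a) = 1).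
Let g u := expN l u * F u.

Lemma expdom_g : expdom (w + l) (K / w ^+ 2) g.
Proof.
split.
  apply: measurable_funM; first exact: measurable_expN.
  exact: (Fab_measurable w0 wa' (lexx b)).
move=> t; rewrite mulr_ge0 ?(ltW (expN_gt0 _ _)) ?(Fab_ge0 w0 wa' (lexx b))//=.
have -> : expR (- ((w + l) * t)) = expN l t * expN w t.
  by rewrite /expN -expRD; congr expR; ring.
rewrite mulrCA ler_wpM2l ?(ltW (expN_gt0 _ _))//.
exact: (Fab_le w0 wa' (lexx b)).
Qed.

Lemma continuous_g : continuous g.
Proof.
by move=> t; apply: cvgM; [exact: continuous_expN|exact: (Fab_continuous w0 wa' (lexx b))].
Qed.

Lemma dVg t : is_derive t 1 (Vop g) (- g t).
Proof. apply: (is_derive_Vop lw expdom_g); exact: continuous_g. Qed.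

Lemma cVg : continuous (Vop g).
Proof. exact: (Vop_continuous lw expdom_g). Qed.

Lemma Jfun_continuous : continuous (Jfun l).
Proof.
move=> t; apply: cvgD; apply: cvgM.
- exact: continuous_expN.
- apply: cvgB; last exact: cVab.
  by apply: cvgM; [exact: cvg_cst|exact: (Fab_continuous w0 wa' (lexx b))].
- exact: cvg_cst.
- apply: cvgB; last exact: cVg.
  apply: (@cvg_comp _ _ _ (fun t => t - a) (Vop g) _ (nbhs (t - a))); last exact: cVg.
  by apply: cvgB; [exact: cvg_id|exact: cvg_cst].
Qed.

(** The root condition on [l] cancels the terms in F t and leaves a derivative that vanishes off the
    plateau. *)
Lemma is_derive_Jfun t : t != a -> t != b ->
  is_derive t 1 (Jfun l) (expN l t * (k t - F (t - a))).
Proof.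
move=> ta tb; have h1 := is_derive_expN l t; have h2 := dFab t.
have h3 := dVab ta tb; have h4 := dVg t; have h5 := is_derive_lag (dVg (t - a)).
rewrite /Jfun -/g; apply: is_derive_eq; rewrite /GRing.scale /= /g expN_shift.
rewrite [X in _ = X](_ : _ = expN l t * k t - (l ^+ 2 * expR (l * a)) * expN l t * F (t - a)).
  by ring.
by rewrite lE; ring.
Qed.

(** Beyond [b] the quantity is constant, and each of its terms tends to 0 because [F] and its
    derivative are dominated by exp (- w t) with w + l > 0. *)
Lemma Jfun_zero : Jfun l b = 0.
Proof.
have Jc t : b <= t -> Jfun l t = Jfun l b.
  move=> bt; apply/esym; apply: (@eq_of_derive0 _ (Jfun l) b t bt); first by move=> x; exact: Jfun_continuous.
  move=> x /andP[bx _]; have ax := lt_trans ab bx.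
  have := is_derive_Jfun (negbT (gt_eqF ax)) (negbT (gt_eqF bx)).
  by rewrite /k kab_out ?subrr ?mulr0// negb_and -!ltNge bx orbT.
have cJ : Jfun l t @[t --> +oo] --> 0.
  have z1 : expN l t * F t @[t --> +oo] --> 0.
    apply: (@squeeze_cvgr _ _ _ _ (cst 0) (fun t => K / w ^+ 2 * expN (w + l) t)).
    - by apply: nearW => t; case: expdom_g => _; exact.
    - exact: cvg_cst.
    - rewrite -[X in _ --> X](mulr0 (K / w ^+ 2)); apply: cvgM; first exact: cvg_cst.
      exact: cvg_expN.
  have z2 : expN l t * y t @[t --> +oo] --> 0.
    apply: (@squeeze_cvgr _ _ _ _ (cst 0) (fun t => K / w * expN (w + l) t)).
    - apply: nearW => t; rewrite mulr_ge0 ?(ltW (expN_gt0 _ _)) ?(Vop_ge0 dk)//=.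
      have -> : expN (w + l) t = expN l t * expN w t.
        by rewrite /expN -expRD; congr expR; ring.
      by rewrite mulrCA ler_wpM2l ?(ltW (expN_gt0 _ _))// (Vop_le w0 dk).
    - exact: cvg_cst.
    - rewrite -[X in _ --> X](mulr0 (K / w)); apply: cvgM; first exact: cvg_cst.
      exact: cvg_expN.
  have z3 : Vop g t @[t --> +oo] --> 0 by exact: (Vop_cvg lw expdom_g).
  have z4 : Vop g (t - a) @[t --> +oo] --> 0.
    apply: (@cvg_comp _ _ _ (fun t => t - a) (Vop g) _ (+oo : set_system R)); last exact: z3.
    apply/cvgryPge => A; near=> t; rewrite lerBrDr; near: t.
    by apply: nbhs_pinfty_ge; exact: num_real.
  have -> : Jfun l = (fun t => l * (expN l t * F t) - expN l t * y t +
      l ^+ 2 * (Vop g (t - a) - Vop g t)).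
    by apply/funext => t; rewrite /Jfun -/g; ring.
  have -> : 0 = l * 0 - 0 + l ^+ 2 * (0 - 0) :> R by rewrite !subr0 !mulr0 addr0.
  apply: cvgD; first by apply: cvgB => //; apply: cvgM => //; exact: cvg_cst.
  by apply: cvgM; [exact: cvg_cst|exact: cvgB].
have cJ2 : Jfun l t @[t --> +oo] --> Jfun l b.
  apply: cvg_near_cst; near=> t; apply: Jc; near: t.
  by apply: nbhs_pinfty_ge; exact: num_real.
exact: (cvg_unique _ cJ2 cJ).
Unshelve. all: by end_near. Qed.

Lemma Vop_g_antiderivative (A : R -> R) p q : p <= q -> continuous A ->
  (forall x, p < x < q -> is_derive x 1 A (g x)) ->
  Vop g p - Vop g q = A q - A p.
Proof.
move=> pq cA dA; suff : Vop g p + A p = Vop g q + A q by lra.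
apply: (@eq_of_derive0 _ (fun x => Vop g x + A x) p q pq).
  by move=> x; apply: cvgD; [exact: cVg|exact: cA].
move=> x h; have h1 := dA x h; have h2 := dVg x.
by apply: is_derive_eq; rewrite addrC subrr.
Qed.

Lemma Jfun_antiderivative (A : R -> R) p q : p <= q -> a <= p -> q <= b -> continuous A ->
  (forall x, p < x < q -> is_derive x 1 A (expN l x * (1 - F (x - a)))) ->
  Jfun l q - Jfun l p = A q - A p.
Proof.
move=> pq ap qb cA dA; suff : Jfun l p - A p = Jfun l q - A q by lra.
apply: (@eq_of_derive0 _ (fun x => Jfun l x - A x) p q pq).
  by move=> x; apply: cvgB; [exact: Jfun_continuous|exact: cA].
move=> x h; have h1 := dA x h; case/andP: (h) => px xq.
have ax := le_lt_trans ap px; have xb := lt_le_trans xq qb.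
have h2 := is_derive_Jfun (negbT (gt_eqF ax)) (negbT (lt_eqF xb)).
apply: is_derive_eq; rewrite /k kab_in ?subrr//.
by rewrite !ltW.
Qed.

End Jlambda.

End Fixed.

End PlateauODE.

(** * Explicit formulas for the value at 0, and an estimate near the critical lag *)

Section PlateauFormulas.
Variable R : realType.
Implicit Types (a b c l p q r s t u v x y z : R) (f g : R -> R).

(** The weight 2 / a maximizes w ^ 2 exp (- w a); at this point the inequality reads exp 2 < (2 / a)
    ^ 2, that is a < 2 / e. *)
Lemma weight_2a a : 0 < a < 2 / expR 1 -> 0 < 2 / a /\ expR (2 / a * a) < (2 / a) ^+ 2.
Proof.
move=> /andP[a0 ae]; have e0 := expR_gt0 (1 : R).
split; first by rewrite divr_gt0.
rewrite mulfVK ?gt_eqF// (_ : 2 = 1 + 1) // expRD -expr2.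
by rewrite ltrXn2r// ?expR_ge0 ?divr_ge0 ?ltW// ltr_pdivlMr// mulrC -ltr_pdivlMr.
Qed.

Section JfunBounds.
Variables (w a b l : R).
Hypotheses (w0 : 0 < w) (wa : expR (w * a) < w ^+ 2) (a0 : 0 <= a) (ab : a < b).
Hypotheses (lw : 0 < w + l) (lE : l ^+ 2 * expR (l * a) = 1).

(** As [Jfun] vanishes at [b], the left-hand side is the integral over [a, b] of exp (- l t) (1 - F
    (t - a)), whose integrand is at most [expN l a]. *)
Lemma Jfun_start_ge : 0 <= l -> - Jfun a b l a <= expN l a * (b - a).
Proof.
move=> l0; have Jb := Jfun_zero w0 wa ab lw lE.
have cJ := Jfun_continuous w0 wa lw (b := b).
pose f t := expN l a * t - Jfun a b l t.
have : f a <= f b.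
  apply: (@nondecreasing_of_derive _ f
    (fun t => expN l a - expN l t * (1 - Fab a b (t - a))) a b (ltW ab)).
  - apply: continuous_subspaceT => t; apply: cvgB; last exact: cJ.
    by apply: cvgM; [exact: cvg_cst|exact: cvg_id].
  - move=> t /andP[ta tb].
    have h1 := is_derive_Jfun w0 wa lw lE (negbT (gt_eqF ta)) (negbT (lt_eqF tb)).
    apply: is_derive_eq; rewrite kab_in ?(ltW ta) ?(ltW tb)//.
    by rewrite /GRing.scale /= mulr1.
  - move=> t /andP[ta tb]; rewrite subr_ge0.
    apply: (@le_trans _ _ (expN l t)).
      rewrite ler_piMr ?(ltW (expN_gt0 _ _))// gerBl.
      exact: (Fab_ge0 w0 (ltW wa) (lexx b)).
    by rewrite ler_expR lerN2 ler_wpM2l// ltW.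
by rewrite /f Jb subr0 mulrBr lerBrDl.
Qed.

(** In the same integral the exponential is now at least 1. For v = t - a <= a, 1 - F v >= F 0 - F v
    >= v (b - a), because the descent rate of [F] at [v] is at least the plateau length. Integrating
    over 0 <= v <= h gives the bound. *)
Lemma Jfun_start_le h : l <= 0 -> Eab a b <= 1 -> 0 < h -> h <= b - a -> h <= a ->
  h ^+ 2 * (b - a) / 2 <= - Jfun a b l a.
Proof.
move=> l0 E1 h0 hba ha; have Jb := Jfun_zero w0 wa ab lw lE.
have cJ := Jfun_continuous w0 wa lw (b := b).
have Fn := Fab_nincr w0 (ltW wa) (lexx b).
have one_le t : 0 <= t -> 1 <= expN l t.
  by move=> t0; rewrite -expR0 ler_expR oppr_ge0 mulr_le0_ge0.
have step1 : Jfun a b l (a + h) <= Jfun a b l b.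
  apply: (@nondecreasing_of_derive _ _ (fun t => expN l t * (1 - Fab a b (t - a))) (a + h) b).
  - by rewrite addrC -lerBrDr.
  - by apply: continuous_subspaceT => t; exact: cJ.
  - move=> t /andP[ta tb]; have ta' : a < t by rewrite (lt_trans _ ta)// ltrDl.
    have h1 := is_derive_Jfun w0 wa lw lE (negbT (gt_eqF ta')) (negbT (lt_eqF tb)).
    by apply: (is_derive_eq h1); rewrite kab_in ?(ltW ta') ?(ltW tb).
  - move=> t /andP[ta tb]; rewrite mulr_ge0 ?(ltW (expN_gt0 _ _))// subr_ge0.
    apply: le_trans E1; apply: Fn; rewrite subr_ge0 ltW// (lt_trans _ ta)// ltrDl//.
pose f t := Jfun a b l t - (b - a) * (t - a) ^+ 2 / 2.
have : f a <= f (a + h).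
  apply: (@nondecreasing_of_derive _ f (fun t => expN l t * (1 - Fab a b (t - a)) - (b - a) * (t - a)) a (a + h)).
  - by rewrite lerDl ltW.
  - apply: continuous_subspaceT => t; apply: cvgB; first exact: cJ.
    apply: cvgM; last exact: cvg_cst.
    apply: cvgM; first exact: cvg_cst.
    have cta : (t0 - a) @[t0 --> t] --> t - a by apply: cvgB; [exact: cvg_id|exact: cvg_cst].
    exact: (cvgM cta cta).
  - move=> t /andP[ta tb]; have tb' : t < b by rewrite (lt_le_trans tb)// addrC -lerBrDr.
    have h1 := is_derive_Jfun w0 wa lw lE (negbT (gt_eqF ta)) (negbT (lt_eqF tb')).
    apply: is_derive_eq; rewrite kab_in ?(ltW ta) ?(ltW tb')// /GRing.scale /=.
    by field.
  - move=> t /andP[ta tb]; have hv : t - a <= a.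
      by rewrite lerBlDr (le_trans (ltW tb))// lerD2l.
    have v0 : 0 <= t - a by rewrite subr_ge0 ltW.
    rewrite subr_ge0; apply: (@le_trans _ _ (1 - Fab a b (t - a))); last first.
      rewrite ler_peMl ?one_le//; last exact: le_trans (ltW ta).
      by rewrite subr_ge0; apply: le_trans E1; exact: Fn.
    have dF := expdom_Fab w0 (ltW wa) (lexx b).
    have /andP[hT _] := Top_diff w0 dF v0.
    rewrite -(Fab_fix w0 (ltW wa) (lexx b)) subr0 in hT.
    have ub : t - a <= b by exact: le_trans (ltW ab).
    have hV := @Vop_kab_ge R w a b b w0 (ltW wa) (lexx b) (t - a) (ltW ab) ub.
    rewrite max_r// in hV.
    rewrite mulrC; apply: (@le_trans _ _ ((t - a) * Vop (kab a b (Fab a b)) (t - a))).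
      by rewrite ler_wpM2l.
    by apply: (le_trans hT); rewrite lerD2r.
rewrite /f subrr expr0n /= mulr0 mul0r subr0 (addrC a) addrK => h1.
move: step1 h1; rewrite Jb (addrC h); lra.
Qed.

End JfunBounds.

Section Formulas.
Variables (a b : R).
Hypotheses (ae : 0 < a < 2 / expR 1) (ab : a < b).
Let r := rpar a.
Let s := spar a.
Let w := 2 / a.
Let F := Fab a b.
Let y := Vop (kab a b F).
Let a0 : 0 < a. Proof. by case/andP: ae. Qed.
Let w0 : 0 < w. Proof. by have [] := weight_2a ae. Qed.
Let wa : expR (w * a) < w ^+ 2. Proof. by have [] := weight_2a ae. Qed.
Let s0 : 0 < s. Proof. by have [_ []] := roots_props ae. Qed.
Let r1 : 1 < r. Proof. by have [[]] := roots_props ae. Qed.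
Let r0 : 0 < r. Proof. exact: lt_trans r1. Qed.
Let ar : a * r < 2. Proof. by have [[]] := roots_props ae. Qed.
Let rw : r < w. Proof. by rewrite /w ltr_pdivlMr// mulrC. Qed.
Let s1 : s < 1. Proof. by have [_ []] := roots_props ae. Qed.
Let rE : expR (a * r) = r ^+ 2.
Proof.
have [[_ _ h] _] := roots_props ae; rewrite -/r in h.
by rewrite -[in RHS]h -expRM_natl; congr expR; field.
Qed.
Let sE : expR (- (a * s)) = s ^+ 2. Proof. by have [_ []] := roots_props ae. Qed.
Let rn0 : r != 0. Proof. by rewrite gt_eqF. Qed.
Let sn0 : s != 0. Proof. by rewrite gt_eqF. Qed.
Let rsn0 : r + s != 0. Proof. by rewrite gt_eqF ?addr_gt0. Qed.

Let lwr : 0 < w + - r. Proof. by rewrite subr_gt0. Qed.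
Let lws : 0 < w + s. Proof. by rewrite addr_gt0. Qed.
Let lEr : (- r) ^+ 2 * expR (- r * a) = 1.
Proof. by rewrite sqrrN mulNr mulrC expRN (mulrC r) rE mulVf// sqrf_eq0. Qed.
Let lEs : s ^+ 2 * expR (s * a) = 1.
Proof. by rewrite -sE -expRD mulrC addNr expR0. Qed.

Let Era : expN (- r) a = r ^+ 2. Proof. by rewrite /expN mulNr opprK mulrC. Qed.
Let Esa : expN s a = s ^+ 2. Proof. by rewrite /expN mulrC. Qed.

Lemma continuous_expN_affine (A B C l : R) :
  continuous (fun t => A * expN l t + B * t + C).
Proof.
move=> t; apply: cvgD; last exact: cvg_cst.
by apply: cvgD; apply: cvgM; [exact: cvg_cst|exact: continuous_expN|exact: cvg_cst|exact: cvg_id].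
Qed.

Lemma is_derive_expN_affine (A B C l t : R) :
  is_derive t 1 (fun t => A * expN l t + B * t + C) (- l * A * expN l t + B).
Proof.
have h := is_derive_expN l t.
by apply: is_derive_eq; rewrite /GRing.scale /=; ring.
Qed.

(** The integral of [F] over [0, a] in [Jfun] contains one resonant term, linear in t. The resulting
    factors r (2 - a r) and - s (2 + a s) are the derivatives of z ^ 2 - exp (a z) at its roots [r]
    and [- s]. *)
Lemma plateau_coefficients : exists P Q : R,
  [/\ forall t, t <= a -> F t = P * expN r t + Q * expN (- s) t,
      F a = P / r ^+ 2 + Q / s ^+ 2 /\ y a = P / r - Q / s,
      Jfun a b (- r) a = - (P * (r * (2 - a * r))) &
      Jfun a b s a = Q * (s * (2 + a * s))].
Proof.
have [P [Q [FE Fa ya]]] := Fab_exponential w0 wa a0 ab s0 r0 rw rE sE.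
exists P, Q; split=> //.
- rewrite /Jfun -/F -/y subrr Era.
  have hd x : 0 < x < a -> is_derive x 1
      (fun t => Q / (r + s) * expN (- (r + s)) t + P * t + 0) (expN (- r) x * F x).
    move=> /andP[_ xa]; have h := is_derive_expN_affine (Q / (r + s)) P 0 (- (r + s)) x.
    apply: (is_derive_eq h); rewrite /F FE ?(ltW xa)// mulrDr.
    rewrite !mulrA ![_ * P]mulrC ![_ * Q]mulrC -!mulrA.
    have -> : expN (- r) x * expN r x = 1 by rewrite /expN -expRD -expR0; congr expR; ring.
    have -> : expN (- r) x * expN (- s) x = expN (- (r + s)) x.
      by rewrite /expN -expRD; congr expR; ring.
    by field.
  rewrite (Vop_g_antiderivative w0 wa lwr (ltW a0) (@continuous_expN_affine _ _ _ _) hd).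
  rewrite /y /F Fa ya.
  have -> : expN (- (r + s)) a = r ^+ 2 / s ^+ 2.
    rewrite -sE -expRN -rE /expN -expRD; congr expR; ring.
  rewrite /expN mulr0 oppr0 expR0.
  by field; rewrite rn0 sn0 rsn0.
- rewrite /Jfun -/F -/y subrr Esa.
  have hd x : 0 < x < a -> is_derive x 1
      (fun t => - (P / (r + s)) * expN (r + s) t + Q * t + 0) (expN s x * F x).
    move=> /andP[_ xa]; have h := is_derive_expN_affine (- (P / (r + s))) Q 0 (r + s) x.
    apply: (is_derive_eq h); rewrite /F FE ?(ltW xa)// mulrDr.
    rewrite !mulrA ![_ * P]mulrC ![_ * Q]mulrC -!mulrA.
    have -> : expN s x * expN (- s) x = 1 by rewrite /expN -expRD -expR0; congr expR; ring.
    have -> : expN s x * expN r x = expN (r + s) x.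
      by rewrite /expN -expRD; congr expR; ring.
    by field.
  rewrite (Vop_g_antiderivative w0 wa lws (ltW a0) (@continuous_expN_affine _ _ _ _) hd).
  rewrite /y /F Fa ya.
  have -> : expN (r + s) a = s ^+ 2 / r ^+ 2.
    rewrite -sE -rE -expRN /expN -expRD; congr expR; ring.
  rewrite /expN mulr0 oppr0 expR0.
  by field; rewrite rn0 sn0 rsn0.
Qed.

Lemma Fab_quadratic : exists H S : R, forall t, a <= t <= b ->
  y t = S - t /\ F t = H - S * t + t ^+ 2 / 2.
Proof.
have yE t : a <= t <= b -> y t = y b + b - t.
  move=> /andP[a_t tb]; suff : y t + t = y b + b by lra.
  apply: (@eq_of_derive0 _ (fun t => y t + t) t b tb).
    by move=> x; apply: cvgD; [exact: (cVab w0 wa)|exact: cvg_id].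
  move=> x /andP[tx xb]; have ax := le_lt_trans a_t tx.
  have h := dVab w0 wa (negbT (gt_eqF ax)) (negbT (lt_eqF xb)).
  apply: is_derive_eq; rewrite kab_in; first by rewrite addrC subrr.
  by rewrite !ltW.
exists (F b + (y b + b) * b - b ^+ 2 / 2), (y b + b) => t tab; split; first exact: yE.
case/andP: (tab) => a_t tb.
suff : F t + (y b + b) * t - t ^+ 2 / 2 = F b + (y b + b) * b - b ^+ 2 / 2 by lra.
apply: (@eq_of_derive0 _ (fun t => F t + (y b + b) * t - t ^+ 2 / 2) t b tb).
  move=> x; apply: cvgB.
    apply: cvgD; first exact: (Fab_continuous w0 (ltW wa) (lexx b)).
    by apply: cvgM; [exact: cvg_cst|exact: cvg_id].
  by apply: cvgM; [exact: exprn_continuous|exact: cvg_cst].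
move=> x /andP[tx xb]; have h := dFab b w0 wa x.
apply: is_derive_eq; rewrite -/F -/y yE; first by rewrite /GRing.scale /=; field.
by rewrite (ltW xb) (le_trans a_t) ?(ltW tx).
Qed.

(** When 2 a <= b the window [b - a, b] in [Jfun] lies inside the plateau, where [F] is a parabola,
    so the identity at [b] becomes algebraic. *)
Lemma Jfun_zero_quadratic l H S : l != 0 -> 0 < w + l -> l ^+ 2 * expR (l * a) = 1 ->
  2 * a <= b ->
  (forall t, a <= t <= b -> y t = S - t /\ F t = H - S * t + t ^+ 2 / 2) ->
  F (b - a) - y (b - a) / l + l ^- 2 = 1.
Proof.
move=> l0 lw lE a2b FE; have a0' := a0; have cab : b - a <= b by lra.
have := Jfun_zero w0 wa ab lw lE; rewrite /Jfun.
(* Repeated integration by parts of exp (- l t) F t, which ends because F'' = 1. *)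
pose A t := - (expN l t * ((H - S * t + t ^+ 2 / 2) / l - (S - t) / l ^+ 2 + l ^- 3)).
have cA : continuous A.
  move=> t; apply: cvgN; apply: cvgM; first exact: continuous_expN.
  apply: cvgD; last exact: cvg_cst.
  apply: cvgB; apply: cvgM; try exact: cvg_cst.
    apply: cvgD; last by apply: cvgM; [exact: exprn_continuous|exact: cvg_cst].
    apply: cvgB; first exact: cvg_cst.
    by apply: cvgM; [exact: cvg_cst|exact: cvg_id].
  by apply: cvgB; [exact: cvg_cst|exact: cvg_id].
have hd x : b - a < x < b -> is_derive x 1 A (expN l x * F x).
  move=> /andP[cx xb]; have h := is_derive_expN l x.
  have [_ ->] := FE x ltac:(apply/andP; split; lra).
  by apply: is_derive_eq; rewrite /GRing.scale /=; field.
rewrite (Vop_g_antiderivative w0 wa lw cab cA hd).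
have hb : a <= b <= b by rewrite ltW/=.
have hc : a <= b - a <= b by apply/andP; split; lra.
have [yb Fb] := FE b hb; have [yc Fc] := FE _ hc.
rewrite -/F -/y yb Fb yc Fc /A expN_shift.
have -> : expR (l * a) = l ^- 2.
  by apply: (mulfI (x := l ^+ 2)); rewrite ?sqrf_eq0// lE mulfV// sqrf_eq0.
move=> h; apply: (mulfI (x := expN l b)); first by rewrite gt_eqF ?expN_gt0.
rewrite mulr1; apply/eqP; rewrite -subr_eq0; apply/eqP.
apply: (mulIf (x := l^-1)); first by rewrite invr_eq0.
by rewrite mul0r -[RHS]h; field.
Qed.

(** The relations of [Jfun_zero_quadratic] for [- r] and [s] fix the value of [F] at b - a and its
    slope, with y (b - a) = d. The parabola carries them back to [a], where P + Q = r s (F a + d y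
    a). *)
Lemma Eab_large : 2 * a <= b ->
  Eab a b = r * s * (1 + dpar a ^+ 2 + 2 * dpar a * (b - 2 * a) +
     (b - 2 * a) ^+ 2 / 2) - 1.
Proof.
move=> a2b; have a0' := a0; have [P [Q [FE [Fa ya] _ _]]] := plateau_coefficients.
have [H [S qE]] := Fab_quadratic.
have rn0' : - r != 0 by rewrite oppr_eq0.
have e1 := Jfun_zero_quadratic rn0' lwr lEr a2b qE.
have e2 := Jfun_zero_quadratic sn0 lws lEs a2b qE.
have [yc Fc] := qE (b - a) ltac:(apply/andP; split; lra).
have [ya' Fa'] := qE a ltac:(apply/andP; split; [lra|exact: ltW]).
have E0 : Eab a b = P + Q.
  by rewrite /Eab -/F FE ?(ltW a0)// /expN !mulr0 oppr0 expR0 !mulr1.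
rewrite yc Fc in e1 e2; rewrite ya' in ya; rewrite Fa' in Fa.
have eS : S = b - a + (s^-1 - r^-1).
  have h : (S - (b - a)) * (s^-1 + r^-1) = (s^-1 - r^-1) * (s^-1 + r^-1).
    transitivity (s ^- 2 - r ^- 2); last by field; rewrite rn0 sn0.
    move: e1 e2; rewrite sqrrN invrN !mulrN opprK; lra.
  have n0 : s^-1 + r^-1 != 0 by rewrite gt_eqF ?addr_gt0 ?invr_gt0.
  by have := mulIf n0 h; lra.
have eH : H = 1 - s ^- 2 + (S - (b - a)) / s + S * (b - a) - (b - a) ^+ 2 / 2 by lra.
have pq : (P + Q) / (r * s) = H - S * a + a ^+ 2 / 2 + (S - a) * (s^-1 - r^-1).
  by rewrite Fa ya; field; rewrite rn0 sn0.
rewrite E0; have -> : P + Q = r * s * ((P + Q) / (r * s)).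
  by field; rewrite rn0 sn0.
rewrite pq eH eS /dpar -/r -/s; field; rewrite rn0 sn0//.
Qed.

Lemma Eab_PQ (P Q : R) : (forall t, t <= a -> F t = P * expN r t + Q * expN (- s) t) ->
  Eab a b = P + Q.
Proof.
by move=> FE; rewrite /Eab -/F FE ?(ltW a0)// /expN !mulr0 oppr0 expR0 !mulr1.
Qed.

Lemma expN_two_exp (A B C l m : R) : continuous (fun t => A * expN l t + B * expN m t + C * t).
Proof.
move=> t; apply: cvgD; last by apply: cvgM; [exact: cvg_cst|exact: cvg_id].
by apply: cvgD; apply: cvgM; [exact: cvg_cst|exact: continuous_expN|exact: cvg_cst|exact: continuous_expN].
Qed.

Lemma is_derive_two_exp (A B C l m t : R) :
  is_derive t 1 (fun t => A * expN l t + B * expN m t + C * t)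
    (- l * A * expN l t - m * B * expN m t + C).
Proof.
have h := is_derive_expN l t; have h' := is_derive_expN m t.
by apply: is_derive_eq; rewrite /GRing.scale /=; ring.
Qed.

(** The right-hand side is the square of 2 sinh (x / 2), so this is sinh z >= z at z = x / 2. *)
Lemma sinh_ge x : 0 <= x -> x ^+ 2 <= (expR x - 1) * (1 - expR (- x)).
Proof.
move=> x0; pose z := x / 2.
have z0 : 0 <= z by rewrite divr_ge0.
have h : 2 * z <= expR z - expR (- z).
  rewrite -subr_ge0; pose f z := expR z - expR (- z) - 2 * z.
  have -> : 0 = f 0 by rewrite /f oppr0 subrr mulr0 subrr.
  apply: (@nondecreasing_of_derive _ f (fun z => expR z + expR (- z) - 2) 0 z z0).
  - apply: continuous_subspaceT => u; apply: cvgB; last by apply: cvgM; [exact: cvg_cst|exact: cvg_id].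
    apply: cvgB; first exact: continuous_expR.
    apply: (@cvg_comp _ _ _ (fun u => - u) expR _ (nbhs (- u))); last exact: continuous_expR.
    by apply: cvgN; exact: cvg_id.
  - move=> u _; have h1 := is_derive_expR u; have h2 := is_derive_expN (1 : R) u.
    have -> : f = (fun z => expR z - expN 1 z - 2 * z).
      by apply/funext => v; rewrite /f /expN mul1r.
    apply: is_derive_eq; rewrite /GRing.scale /= /expN mul1r; ring.
  - move=> u _; have p := expR_gt0 u.
    have -> : expR u + expR (- u) - 2 = (expR u - 1) ^+ 2 / expR u.
      by rewrite expRN; field; rewrite gt_eqF.
    by rewrite divr_ge0 ?sqr_ge0// ltW.
have xz : x = z + z by rewrite /z; lra.
have e1 : expR z * expR (- z) = 1 by rewrite -expRD subrr expR0.
rewrite xz opprD !expRD.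
set E := expR z in h e1 *; set G := expR (- z) in h e1 *.
have -> : (E * E - 1) * (1 - G * G) = (E - G) ^+ 2.
  transitivity (E ^+ 2 - (E * G) ^+ 2 - 1 + G ^+ 2); first ring.
  by rewrite e1; transitivity (E ^+ 2 - 2 * (E * G) + G ^+ 2); [rewrite e1; ring|ring].
rewrite -(mulr2n z) -mulr_natl lerXn2r ?nnegrE//; first by rewrite mulr_ge0.
by apply: le_trans h; rewrite mulr_ge0.
Qed.

(** When b <= 2 a the delayed times of the plateau stay in [0, a], where [F] is a sum of two
    exponentials, and the two first integrals form a linear system for [P] and [Q]. [D] is its
    determinant and Cramer's rule gives Psi = D (1 - P - Q). Expanding, D = 1 + (cp + cm) l - cp cm
    (I2 I4 - l ^ 2), with cp + cm >= 0, cp cm < 0 and I2 I4 >= l ^ 2 by [sinh_ge]. *)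
Lemma Eab_small : b <= 2 * a ->
  exists2 D : R, 1 <= D & Psi a (b - a) = D * (1 - Eab a b).
Proof.
move=> b2a; have a0' := a0; have [P [Q [FE [Fa ya] Jr Js]]] := plateau_coefficients.
set l := b - a.
have l0 : 0 < l by rewrite subr_gt0.
have ba : b = l + a by rewrite /l; ring.
have rs0 : 0 < r + s by rewrite addr_gt0.
have p2 : 0 < 2 - a * r by rewrite subr_gt0.
have p3 : 0 < 2 + a * s by rewrite addr_gt0// mulr_gt0.
have Ersa : expN (- (r + s)) a = r ^+ 2 / s ^+ 2.
  rewrite -sE -expRN -rE /expN -expRD; congr expR; ring.
have Ersa' : expN (r + s) a = s ^+ 2 / r ^+ 2.
  rewrite -sE -rE -expRN /expN -expRD; congr expR; ring.
have eq1 : P * (r * (2 - a * r)) = r ^+ 2 * ((expR (r * l) - 1) / r - P * l - Q * ((expR ((r + s) * l) - 1) / (r + s))).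
  have hd x : a < x < b -> is_derive x 1
      (fun t => 1 / r * expN (- r) t + (- (Q * s ^+ 2 / (r + s))) * expN (- (r + s)) t + (- (P * r ^+ 2)) * t)
      (expN (- r) x * (1 - F (x - a))).
    move=> /andP[ax xb]; apply: (is_derive_eq (is_derive_two_exp _ _ _ _ _ _)).
    rewrite FE; last by rewrite lerBlDr -mulr2n -mulr_natl (le_trans (ltW xb)).
    rewrite !expN_shift.
    have -> : expR (r * a) = r ^+ 2 by rewrite mulrC.
    have -> : expR (- s * a) = s ^+ 2 by rewrite mulNr mulrC.
    have -> : expN (- r) x * (1 - (P * (r ^+ 2 * expN r x) + Q * (s ^+ 2 * expN (- s) x))) =
       expN (- r) x - P * r ^+ 2 * (expN (- r) x * expN r x) - Q * s ^+ 2 * (expN (- r) x * expN (- s) x) by ring.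
    have -> : expN (- r) x * expN r x = 1 by rewrite /expN -expRD -expR0; congr expR; ring.
    have -> : expN (- r) x * expN (- s) x = expN (- (r + s)) x.
      by rewrite /expN -expRD; congr expR; ring.
    by field; rewrite rn0 rsn0.
  have := Jfun_antiderivative w0 wa lwr lEr (ltW ab) (lexx a) (lexx b) (@expN_two_exp _ _ _ _ _) hd.
  rewrite (Jfun_zero w0 wa ab lwr lEr) Jr sub0r opprK => ->.
  have -> : expN (- r) b = expR (r * l) * r ^+ 2.
    by rewrite ba expND Era /expN mulNr opprK.
  have -> : expN (- (r + s)) b = expR ((r + s) * l) * (r ^+ 2 / s ^+ 2).
    by rewrite ba expND Ersa /expN mulNr opprK.
  rewrite Era Ersa; set X := expR (r * l); set Y := expR ((r + s) * l).
  by rewrite ba; field; rewrite rn0 sn0 rsn0.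
have eq2 : - (Q * (s * (2 + a * s))) = s ^+ 2 * ((1 - expR (- (s * l))) / s - P * ((1 - expR (- ((r + s) * l))) / (r + s)) - Q * l).
  have hd x : a < x < b -> is_derive x 1
      (fun t => - (1 / s) * expN s t + (P * r ^+ 2 / (r + s)) * expN (r + s) t + (- (Q * s ^+ 2)) * t)
      (expN s x * (1 - F (x - a))).
    move=> /andP[ax xb]; apply: (is_derive_eq (is_derive_two_exp _ _ _ _ _ _)).
    rewrite FE; last by rewrite lerBlDr -mulr2n -mulr_natl (le_trans (ltW xb)).
    rewrite !expN_shift.
    have -> : expR (r * a) = r ^+ 2 by rewrite mulrC.
    have -> : expR (- s * a) = s ^+ 2 by rewrite mulNr mulrC.
    have -> : expN s x * (1 - (P * (r ^+ 2 * expN r x) + Q * (s ^+ 2 * expN (- s) x))) =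
       expN s x - P * r ^+ 2 * (expN s x * expN r x) - Q * s ^+ 2 * (expN s x * expN (- s) x) by ring.
    have -> : expN s x * expN (- s) x = 1 by rewrite /expN -expRD -expR0; congr expR; ring.
    have -> : expN s x * expN r x = expN (r + s) x.
      by rewrite /expN -expRD; congr expR; ring.
    by field; rewrite sn0 rsn0.
  have := Jfun_antiderivative w0 wa lws lEs (ltW ab) (lexx a) (lexx b) (@expN_two_exp _ _ _ _ _) hd.
  rewrite (Jfun_zero w0 wa ab lws lEs) Js sub0r => ->.
  have -> : expN s b = expR (- (s * l)) * s ^+ 2 by rewrite ba expND Esa.
  have -> : expN (r + s) b = expR (- ((r + s) * l)) * (s ^+ 2 / r ^+ 2).
    by rewrite ba expND Ersa'.
  rewrite Esa Ersa'; set X := expR (- (s * l)); set Y := expR (- ((r + s) * l)).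
  by rewrite ba; field; rewrite rn0 sn0 rsn0.
pose cp := r / (2 - a * r); pose cm := - (s / (2 + a * s)).
pose I1 := (expR (r * l) - 1) / r; pose I2 := (expR ((r + s) * l) - 1) / (r + s).
pose I3 := (1 - expR (- (s * l))) / s; pose I4 := (1 - expR (- ((r + s) * l))) / (r + s).
have e1 : P = cp * (I1 - P * l - Q * I2).
  rewrite -/I1 -/I2 in eq1; apply: (mulIf (x := r * (2 - a * r))).
    by rewrite mulf_neq0// gt_eqF.
  by rewrite eq1 /cp; field; rewrite gt_eqF.
have e2 : Q = cm * (I3 - P * I4 - Q * l).
  rewrite -/I3 -/I4 in eq2; apply: (mulIf (x := - (s * (2 + a * s)))).
    by rewrite oppr_eq0 mulf_neq0// gt_eqF.
  by rewrite mulrN eq2 /cm; field; rewrite gt_eqF.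
exists ((1 + cp * l) * (1 + cm * l) - cp * cm * (I2 * I4)); last first.
  rewrite (Eab_PQ FE) /Psi /Ifun -/r -/s /cplus /cminus -/r -/s -/cp -/cm.
  rewrite (negbTE rn0) oppr_eq0 (negbTE sn0) (negbTE rsn0).
  have -> : (- r - s == 0) = false by rewrite -opprD oppr_eq0 (negbTE rsn0).
  have -> : (expR (- s * l) - 1) / - s = I3 by rewrite /I3 mulNr; field.
  have -> : (expR ((- r - s) * l) - 1) / (- r - s) = I4.
    by rewrite /I4 -opprD mulNr invrN mulrN -mulNr opprB.
  rewrite -/I1 -/I2.
  have f1 : P * (1 + cp * l) + Q * (cp * I2) = cp * I1.
    by rewrite mulrDr mulr1 {1}e1; ring.
  have f2 : P * (cm * I4) + Q * (1 + cm * l) = cm * I3.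
    by rewrite (mulrDr Q) mulr1 {1}e2; ring.
  have g1 : P * ((1 + cp * l) * (1 + cm * l) - cp * cm * (I2 * I4)) =
     cp * I1 * (1 + cm * l) - cm * I3 * (cp * I2) by rewrite -f1 -f2; ring.
  have g2 : Q * ((1 + cp * l) * (1 + cm * l) - cp * cm * (I2 * I4)) =
     cm * I3 * (1 + cp * l) - cp * I1 * (cm * I4) by rewrite -f1 -f2; ring.
  set D := (1 + cp * l) * (1 + cm * l) - cp * cm * (I2 * I4) in g1 g2 *.
  transitivity (D - (P * D + Q * D)); last by ring.
  by rewrite g1 g2 /D; ring.
have cp0 : 0 < cp by rewrite divr_gt0.
have cm0 : cm < 0 by rewrite oppr_lt0 divr_gt0.
have cpm : 0 <= cp + cm.
  rewrite subr_ge0 ler_pdivrMr// mulrAC ler_pdivlMr//.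
  have sr : s < r by exact: lt_trans r1.
  have := ltW (mulr_gt0 r0 s0); nra.
have hI : l ^+ 2 <= I2 * I4.
  have -> : I2 * I4 = (expR ((r + s) * l) - 1) * (1 - expR (- ((r + s) * l))) / (r + s) ^+ 2.
    by rewrite /I2 /I4; field.
  rewrite ler_pdivlMr ?exprn_gt0// -exprMn mulrC; apply: sinh_ge.
  by rewrite mulr_ge0 ?(ltW rs0) ?(ltW l0).
have : 0 <= (cp + cm) * l by rewrite mulr_ge0 ?(ltW l0).
have : 0 <= (cp * - cm) * (I2 * I4 - l ^+ 2).
  by rewrite mulr_ge0 ?subr_ge0// mulr_ge0 ?oppr_ge0 ?(ltW cm0) ?(ltW cp0).
lra.
Qed.

(** [Jfun_start_le] bounds P r (2 - a r) from below, while P <= 1 - Q <= 1 + b. As a r approaches 2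
    the right-hand side vanishes, so b - a must tend to 0; this is what controls beta near 2 / e. *)
Lemma Eab_end : Eab a b <= 1 ->
  Num.min (b - a) a ^+ 2 * (b - a) / 2 <= (1 + b) * (r * (2 - a * r)).
Proof.
move=> E1; have a0' := a0; have [P [Q [FE [Fa ya] Jr Js]]] := plateau_coefficients.
set h := Num.min _ _.
have h0 : 0 < h by rewrite lt_min subr_gt0 ab.
have hba : h <= b - a by rewrite ge_min lexx.
have ha : h <= a by rewrite ge_min lexx orbT.
have p2 : 0 < 2 - a * r by rewrite subr_gt0.
have p3 : 0 < 2 + a * s by rewrite addr_gt0// mulr_gt0.
have Fn := Fab_nincr w0 (ltW wa) (lexx b).
have PE : P + Q <= 1 by rewrite -(Eab_PQ FE).
have Qb : - Q <= b.
  have : - (Q * (s * (2 + a * s))) <= s ^+ 2 * (b - a).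
    by rewrite -Js -Esa; exact: (Jfun_start_ge w0 wa ab lws lEs (ltW s0)).
  rewrite expr2 => h1; have h2 : - Q * (2 + a * s) <= s * (b - a).
    rewrite -(ler_pM2l s0) mulrA; rewrite [leRHS]mulrA; apply: le_trans h1.
    by rewrite le_eqVlt; apply/orP; left; apply/eqP; ring.
  have ab' := ab; have [Q0|Q0] := leP 0 Q; first by rewrite (le_trans (y := 0)) ?oppr_le0// ltW// (lt_trans a0).
  have h3 : s * (b - a) <= 1 * (b - a).
    by rewrite ler_wpM2r ?(ltW s1)// subr_ge0 ltW.
  have h4 : 0 <= - Q * (1 + a * s).
    by rewrite mulr_ge0 ?oppr_ge0 ?(ltW Q0)// addr_ge0// mulr_ge0 ?(ltW a0) ?(ltW s0).
  apply: (@le_trans _ _ (- Q * (2 + a * s))).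
    by rewrite (_ : - Q * (2 + a * s) = - Q + - Q * (1 + a * s)) ?lerDl//; ring.
  by apply: (le_trans h2); apply: (le_trans h3); rewrite mul1r gerBl ltW.
have lower : h ^+ 2 * (b - a) / 2 <= P * (r * (2 - a * r)).
  rewrite -[leRHS]opprK -Jr.
  apply: (Jfun_start_le w0 wa (ltW a0) ab lwr lEr _ E1 h0 hba ha).
  by rewrite oppr_le0 ltW.
apply: (le_trans lower); rewrite ler_wpM2r//; first by rewrite mulr_ge0 ?(ltW r0) ?(ltW p2).
by rewrite -[P](addrK Q) lerD.
Qed.

End Formulas.

End PlateauFormulas.

(** * The function beta *)

(* [acrit], [Ev] and [betaf] are sealed behind an opaque constant: otherwise
   conversion tests between unrelated real numbers unfold suprema. *)
Lemma acrit_seal (R : realType) : {x : R | x = 2 / expR 1}.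
Proof. by exists (2 / expR 1). Qed.
Definition acrit (R : realType) : R := sval (acrit_seal R).
Lemma acritE (R : realType) : acrit R = 2 / expR 1.
Proof. exact: (svalP (acrit_seal R)). Qed.

Lemma Ev_seal (R : realType) : {f : R -> R -> R | f = @Eab R}.
Proof. by exists (@Eab R). Qed.
Definition Ev (R : realType) : R -> R -> R := sval (Ev_seal R).
Lemma EvE (R : realType) : @Ev R = @Eab R.
Proof. exact: (svalP (Ev_seal R)). Qed.

Section Beta.
Variable R : realType.
Implicit Types (a b c d e l x z w : R).
Local Notation e2 := (acrit R).

Definition lipc w b a : R := expR (w * b) / w / (1 - expR (w * a) / w ^+ 2).

Lemma lipc_gt0 w b a : 0 < w -> expR (w * a) < w ^+ 2 -> 0 < lipc w b a.
Proof.
move=> w0 wa; rewrite /lipc; apply: divr_gt0; first by rewrite divr_gt0// expR_gt0.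
by rewrite subr_gt0 ltr_pdivrMr ?exprn_gt0// mul1r.
Qed.

Lemma Eab_lipc_b w a b b' B : 0 < w -> expR (w * a) < w ^+ 2 ->
  a <= b -> b <= b' -> b' <= B -> Ev a b' <= Ev a b + (b' - b) * lipc w B a.
Proof.
by move=> w0 wa ab bb' b'B; rewrite /lipc mulrA EvE; exact: Eab_lip_b.
Qed.

Lemma Eab_lipc_a w a a' a1 b : 0 < w -> expR (w * a1) < w ^+ 2 ->
  a < a' -> a' <= a1 -> a' <= b -> Ev a b <= 1 ->
  Ev a' b <= Ev a b + (a' - a) * lipc w b a1.
Proof.
by rewrite EvE => w0 wa aa' a'1 a'b E1; rewrite /lipc mulrA; exact: Eab_lip_a.
Qed.

Lemma expR1_gt2 : 2 < expR 1 :> R.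
Proof. by have := @expR_gt1Dx R 1 (oner_neq0 R); rewrite (_ : 1 + 1 = 2). Qed.

Lemma e2_gt0 : 0 < e2.
Proof. by rewrite acritE divr_gt0// expR_gt0. Qed.

Lemma e2_lt1 : e2 < 1.
Proof. by rewrite acritE ltr_pdivrMr ?expR_gt0// mul1r expR1_gt2. Qed.

Lemma weightP a a' : 0 < a' < e2 -> a <= a' ->
  0 < 2 / a' /\ expR (2 / a' * a) < (2 / a') ^+ 2.
Proof.
rewrite acritE => a'e aa'; have [w0 wa] := weight_2a a'e; split=> //.
by apply: le_lt_trans wa; rewrite ler_expR ler_wpM2l// ltW.
Qed.

Lemma weight_exists a : 0 <= a < e2 -> exists a', [/\ a < a', 0 < a' < e2 &
  0 < 2 / a' /\ expR (2 / a' * a') < (2 / a') ^+ 2].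
Proof.
move=> /andP[a0 ae]; have e0 := e2_gt0.
exists ((a + e2) / 2); have h : 0 < (a + e2) / 2 < e2 by apply/andP; split; lra.
by split => //; [lra|apply: weight_2a; rewrite -acritE].
Qed.

Definition betaset a := [set b : R | a <= b /\ Ev a b <= 1].

(** From 2 / e on no weight satisfies the strict inequality, so the value at the critical lag is
    prescribed; [betaf_left_e2] shows that it is the limit. *)
Definition betaf_def a : R := if a < e2 then sup (betaset a) else e2.

Lemma betaf_seal : {f : R -> R | f = betaf_def}.
Proof. by exists betaf_def. Qed.

Definition betaf : R -> R := sval betaf_seal.

Lemma betaf_defE a : betaf a = betaf_def a.
Proof. by rewrite /betaf (svalP betaf_seal). Qed.

Lemma Eab_cont_b a b : 0 <= a < e2 -> a <= b -> exists2 L : R, 0 < L &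
  forall b', b <= b' -> b' <= b + 1 -> Ev a b' <= Ev a b + (b' - b) * L.
Proof.
move=> ae ab; have [a' [aa' a'e [w0 _]]] := weight_exists ae.
have [_ wa] := weightP a'e (ltW aa').
exists (lipc (2 / a') (b + 1) a); first exact: lipc_gt0.
by move=> b' bb' b'1; exact: Eab_lipc_b.
Qed.

Lemma Eab_mono a b b' : 0 <= a < e2 -> a < b -> b < b' -> Ev a b' <= 1 ->
  Ev a b < Ev a b'.
Proof.
move=> ae; have [a' [aa' a'e [w0 _]]] := weight_exists ae.
have [_ wa] := weightP a'e (ltW aa').
by rewrite EvE; apply: (Eab_lt_b w0 (ltW wa)); case/andP: ae.
Qed.

Lemma betaset_ub a b : 0 <= a < e2 -> betaset a b -> b <= 2.
Proof.
move=> ae [ab E1]; have [a' [aa' a'e [w0 _]]] := weight_exists ae.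
have [_ wa] := weightP a'e (ltW aa'); case/andP: ae => a0 ae; have e1 := e2_lt1.
move: ab; rewrite le_eqVlt => /predU1P[<-|ab]; first by lra.
have := Eab_ge w0 (ltW wa) a0 ab; rewrite -EvE => h; have := le_trans h E1; nra.
Qed.

Lemma betaset_diag a : 0 <= a < e2 -> betaset a a /\ Ev a a <= 0.
Proof.
move=> ae; have [a' [aa' a'e [w0 _]]] := weight_exists ae.
have [_ wa] := weightP a'e (ltW aa').
have h := Eab_diag w0 (ltW wa); rewrite -EvE in h; split => //; split => //.
by apply: (le_trans h).
Qed.

Lemma betaset_has_sup a : 0 <= a < e2 -> has_sup (betaset a).
Proof.
move=> ae; split; first by exists a; exact: (betaset_diag ae).1.
by exists 2 => b; exact: betaset_ub.
Qed.

Lemma betafE a : 0 <= a < e2 -> betaf a = sup (betaset a).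
Proof. by case/andP => _ h; rewrite betaf_defE /betaf_def h. Qed.

Lemma betaf_e2 : betaf e2 = e2. Proof. by rewrite betaf_defE /betaf_def ltxx. Qed.

Lemma betaf_ub a b : 0 <= a < e2 -> a <= b -> Ev a b <= 1 -> b <= betaf a.
Proof.
move=> ae ab E1; rewrite betafE//; apply: ub_le_sup => //.
by case: (betaset_has_sup ae).
Qed.

Lemma Eab_lt1_extend a b : 0 <= a < e2 -> a <= b -> Ev a b < 1 ->
  exists2 b', b < b' & Ev a b' <= 1.
Proof.
move=> ae ab E1; have [L L0 HL] := Eab_cont_b ae ab.
pose h := Num.min 1 ((1 - Ev a b) / L).
have h0 : 0 < h by rewrite lt_min ltr01 divr_gt0// subr_gt0.
exists (b + h); first by rewrite ltrDl.
have hL : h * L <= 1 - Ev a b by rewrite -ler_pdivlMr// ge_min lexx orbT.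
have h1 : h <= 1 by rewrite ge_min lexx.
have := HL (b + h); rewrite lerDl (ltW h0) lerD2l h1 => /(_ isT isT).
by rewrite (addrC b) addrK; lra.
Qed.

Lemma betaf_gt a : 0 <= a < e2 -> a < betaf a.
Proof.
move=> ae; have [[_ _] E0] := betaset_diag ae.
have [b ab E1] := Eab_lt1_extend ae (lexx a) (le_lt_trans E0 ltr01).
by apply: (lt_le_trans ab); apply: betaf_ub => //; exact: ltW.
Qed.

Lemma Eab_lt_beta a b : 0 <= a < e2 -> a < b -> b < betaf a -> Ev a b < 1.
Proof.
move=> ae ab; rewrite betafE// => bb.
have bb0 : 0 < sup (betaset a) - b by rewrite subr_gt0.
have [b' [ab' E1]] := sup_adherent bb0 (betaset_has_sup ae).
rewrite opprB addrC subrK => bb'.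
by apply: lt_le_trans (E1); apply: (Eab_mono ae ab bb' E1).
Qed.

Lemma Eab_beta a : 0 <= a < e2 -> Ev a (betaf a) = 1.
Proof.
move=> ae; have ab := betaf_gt ae.
apply/eqP; rewrite eq_le; apply/andP; split; last first.
  rewrite leNgt; apply/negP => E1.
  have [b' bb' E1'] := Eab_lt1_extend ae (ltW ab) E1.
  have ab'' : a <= b' by exact: ltW (lt_trans ab bb').
  by have := betaf_ub ae ab'' E1'; rewrite leNgt bb'.
apply/ler_addgt0Pr => e e0.
have [a' [aa' a'e [w0 _]]] := weight_exists ae.
have [_ wa] := weightP a'e (ltW aa').
pose L := lipc (2 / a') (betaf a) a.
have L0 : 0 < L by exact: lipc_gt0.
pose b := Num.max ((a + betaf a) / 2) (betaf a - e / L).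
have eL : 0 < e / L by rewrite divr_gt0.
have bb : b < betaf a by rewrite gt_max; apply/andP; split; lra.
have b1 : (a + betaf a) / 2 <= b by rewrite le_max lexx.
have b2 : betaf a - e / L <= b by rewrite le_max lexx orbT.
have ab' : a < b by lra.
have := Eab_lipc_b w0 wa (ltW ab') (ltW bb) (lexx (betaf a)).
rewrite -/L => h; apply: (le_trans h).
have : (betaf a - b) * L <= e by rewrite -ler_pdivlMr//; lra.
have := Eab_lt_beta ae ab' bb; lra.
Qed.

Lemma Eab_eq1 a b : 0 <= a < e2 -> a < b -> Ev a b = 1 -> b = betaf a.
Proof.
move=> ae ab E1; have h : b <= betaf a by apply: betaf_ub => //; [exact: ltW|rewrite E1].
move: h; rewrite le_eqVlt => /predU1P[//|h].
by have := Eab_lt_beta ae ab h; rewrite E1 ltxx.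
Qed.

Lemma betaf_decr_lt a a' : 0 <= a -> a < a' -> a' < e2 -> betaf a' < betaf a.
Proof.
move=> a0 aa' a'e; have ae : 0 <= a < e2 by rewrite a0; lra.
have ae' : 0 <= a' < e2 by rewrite a'e andbT; lra.
have [a1 [a1a a1e [w0 _]]] := weight_exists ae'.
have [_ wa] := weightP a1e (ltW a1a).
have b' := betaf_gt ae'; have E1 := Eab_beta ae'.
have E : Ev a (betaf a') < 1.
  by rewrite EvE; apply: (Eab_lt_a w0 (ltW wa) a0 aa' b'); rewrite -EvE.
have h : betaf a' <= betaf a by apply: betaf_ub => //; [lra|exact: ltW].
rewrite lt_neqAle h andbT; apply/negP => /eqP e; move: E.
by rewrite e Eab_beta// ltxx.
Qed.

(** For x close to 2 / e, beta x > x, and beta at the midpoint [c] exceeds all such values, so it is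
    at least 2 / e. Passing from [c] to [a] makes the inequality strict. *)
Lemma betaf_gt_e2 a : 0 <= a -> a < e2 -> e2 < betaf a.
Proof.
move=> a0 ae; pose c := (a + e2) / 2.
have ac : a < c by rewrite /c; lra.
have ce : c < e2 by rewrite /c; lra.
apply: le_lt_trans (betaf_decr_lt a0 ac ce).
apply/ler_addgt0Pr => e e0.
pose x := Num.max ((c + e2) / 2) (e2 - e).
have xe : x < e2 by rewrite gt_max; apply/andP; split; lra.
have x1 : (c + e2) / 2 <= x by rewrite le_max lexx.
have x2 : e2 - e <= x by rewrite le_max lexx orbT.
have cx : c < x by lra.
have := betaf_decr_lt (ltW (le_lt_trans a0 ac)) cx xe.
have x0 : 0 <= x < e2 by apply/andP; split; lra.
by have := betaf_gt x0; lra.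
Qed.

Lemma betaf_decr u v : 0 <= u -> u < v -> v <= e2 -> betaf v < betaf u.
Proof.
move=> u0 uv; rewrite le_eqVlt => /predU1P[ve|ve]; last exact: betaf_decr_lt.
by rewrite ve betaf_e2; apply: betaf_gt_e2 => //; rewrite -ve.
Qed.

Lemma betaf0 : betaf 0 = Num.sqrt 2.
Proof.
have e0 := e2_gt0; have s0 : 0 < Num.sqrt 2 :> R by rewrite sqrtr_gt0.
apply/esym/Eab_eq1 => //; first by rewrite lexx.
by rewrite EvE Eab_0// sqr_sqrtr// divff.
Qed.

Lemma betaf_lt_sqrt2 a : 0 < a -> a < e2 -> betaf a < Num.sqrt 2.
Proof. by move=> a0 ae; rewrite -betaf0; apply: betaf_decr_lt. Qed.

Lemma betaf_bounds a : 0 <= a <= e2 -> e2 <= betaf a <= Num.sqrt 2.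
Proof.
move=> /andP[a0]; rewrite le_eqVlt => /predU1P[->|ae].
  rewrite betaf_e2 lexx /= -betaf0.
  by apply: ltW; apply: betaf_gt_e2 => //; exact: e2_gt0.
rewrite (ltW (betaf_gt_e2 a0 ae)) /=.
move: a0; rewrite le_eqVlt => /predU1P[<-|a0]; first by rewrite betaf0.
exact/ltW/betaf_lt_sqrt2.
Qed.

(** Slightly below beta a the value of [Ev a] leaves slack under 1, which the Lipschitz bound in the
    lag spends. That bound starts from a value at most 1 at the smaller lag, here [a]. *)
Lemma betaf_right a e : 0 <= a < e2 -> 0 < e -> exists2 d, 0 < d &
  forall x, a < x -> x < a + d -> x < e2 -> betaf a - e <= betaf x.
Proof.
move=> ae e0; have ab := betaf_gt ae.
have [a1 [a1a a1e [w0 wa]]] := weight_exists ae.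
pose b := Num.max ((a + betaf a) / 2) (betaf a - e).
have b1 : (a + betaf a) / 2 <= b by rewrite le_max lexx.
have b2 : betaf a - e <= b by rewrite le_max lexx orbT.
have bb : b < betaf a by rewrite gt_max; apply/andP; split; lra.
have ab' : a < b by lra.
have E1 := Eab_lt_beta ae ab' bb.
pose L := lipc (2 / a1) b a1.
have L0 : 0 < L by exact: lipc_gt0.
exists (Num.min (Num.min (a1 - a) (b - a)) ((1 - Ev a b) / L)).
  by rewrite !lt_min !subr_gt0 a1a ab' divr_gt0// subr_gt0.
move=> x ax; rewrite -ltrBlDl !lt_min => /andP[/andP[x1 x2] x3] xe.
apply: (le_trans b2); apply: betaf_ub.
- by case/andP: ae => a0 _; rewrite xe (le_trans a0)// ltW.
- lra.
have xa1 : x <= a1 by lra.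
have xb : x <= b by lra.
have := Eab_lipc_a w0 wa ax xa1 xb (ltW E1); rewrite -/L => h; apply: (le_trans h).
have : (x - a) * L <= 1 - Ev a b by rewrite -ler_pdivlMr//; exact: ltW.
lra.
Qed.

(** If beta x exceeded b = beta a + e, then Ev x b < 1, and the Lipschitz bound, now based at the
    smaller lag [x], would contradict Ev a b > 1. *)
Lemma betaf_left a e : 0 <= a < e2 -> 0 < e -> exists2 d, 0 < d &
  forall x, 0 <= x -> x < a -> a - d < x -> betaf x <= betaf a + e.
Proof.
move=> ae e0; have ab := betaf_gt ae.
have [a1 [a1a a1e [w0 wa]]] := weight_exists ae.
pose b := betaf a + e.
have E1 : 1 < Ev a b.
  have ab1 : a <= b by rewrite /b; lra.
  by rewrite ltNge; apply/negP => /(betaf_ub ae ab1); rewrite /b; lra.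
pose L := lipc (2 / a1) b a1.
have L0 : 0 < L by exact: lipc_gt0.
exists ((Ev a b - 1) / L); first by rewrite divr_gt0// subr_gt0.
move=> x x0 xa ax; rewrite leNgt; apply/negP => bx.
have xe : 0 <= x < e2 by case/andP: ae => _ ae; rewrite x0 (lt_trans xa).
have Ex : Ev x b < 1 by apply: Eab_lt_beta => //; rewrite /b; lra.
have ab1 : a <= b by rewrite /b; lra.
have := Eab_lipc_a w0 wa xa (ltW a1a) ab1 (ltW Ex); rewrite -/L => h.
have : (a - x) * L < Ev a b - 1 by rewrite -ltr_pdivlMr//; lra.
lra.
Qed.

Lemma xexpN_le x z : x <= z -> 0 < z -> z <= 1 -> x * expR (- x) <= z * expR (- z).
Proof.
move=> xz z0 z1; have -> : - x = - z + (z - x) by ring.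
rewrite expRD mulrCA mulrC ler_pM2r ?expR_gt0//.
have h := expR_ge1Dx (- (z - x)); have p := expR_gt0 (z - x).
have e1 : expR (z - x) * expR (- (z - x)) = 1 by rewrite -expRD subrr expR0.
have h2 : x <= z * expR (- (z - x)).
  by apply: (@le_trans _ _ (z * (1 - (z - x)))); [nra|rewrite ler_pM2l].
rewrite -(ler_pM2r (expR_gt0 (- (z - x)))) -mulrA e1 mulr1.
by [].
Qed.

(** If beta x exceeded b = 2 / e + e, then Ev x b < 1 and [Eab_end] would keep x r away from 2. But
    x = 2 z exp (- z) with z = x r / 2, so x would stay away from 2 / e, the maximum of that
    function at z = 1. *)
Lemma betaf_left_e2 e : 0 < e -> exists2 d, 0 < d &
  forall x, 0 <= x -> x < e2 -> e2 - d < x -> betaf x <= e2 + e.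
Proof.
move=> e0; have p0 := e2_gt0; pose b := e2 + e.
have b0 : 0 < b by rewrite /b; lra.
pose m := Num.min e (e2 / 2).
have m0 : 0 < m by rewrite lt_min e0 divr_gt0.
(* [Eab_end] yields m ^ 2 e / 2 <= (1 + b) r (2 - x r), and r <= 4 / e2 since x r < 2 and x > e2 /
   2; hence 2 - x r >= c. *)
pose c := m ^+ 2 * e / 2 / ((1 + b) * (4 / e2)).
have c0 : 0 < c.
  apply: divr_gt0; first by rewrite divr_gt0// mulr_gt0// exprn_gt0.
  by rewrite mulr_gt0 ?divr_gt0// addr_gt0.
pose k := Num.min (c / 2) (1 / 2).
have k0 : 0 < k by rewrite lt_min; apply/andP; split; apply: divr_gt0.
have k1 : k <= 1 / 2 by rewrite ge_min lexx orbT.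
have kc : k <= c / 2 by rewrite ge_min lexx.
have kE : 2 * ((1 - k) * expR (- (1 - k))) < e2.
  rewrite acritE ltr_pM2l// -[ltRHS]mul1r -expRN (_ : - (1 - k) = -1 + k); last by ring.
  rewrite expRD mulrCA mulrC ltr_pM2r ?expR_gt0//.
  have kn0 : - k != 0 by rewrite oppr_eq0 gt_eqF.
  have h := expR_gt1Dx kn0.
  have e1 : expR k * expR (- k) = 1 by rewrite -expRD subrr expR0.
  rewrite -(ltr_pM2r (expR_gt0 (- k))) -mulrA e1; lra.
exists (Num.min (e2 / 2) (e2 - 2 * ((1 - k) * expR (- (1 - k))))).
  by rewrite lt_min divr_gt0//= subr_gt0.
move=> x x0 xe; rewrite ltrBlDl -ltrBlDr lt_min => /andP[x1 x2].
rewrite leNgt; apply/negP => bx.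
have x0' : 0 < x by lra.
have xe' : 0 <= x < e2 by rewrite x0.
have xe'' : 0 < x < 2 / expR 1 by rewrite x0' -acritE.
have xb : x < b by rewrite /b; lra.
have Eb : Ev x b < 1 by apply: Eab_lt_beta.
rewrite EvE in Eb; have := Eab_end xe'' xb (ltW Eb).
have [[r1 ar rE] _] := roots_props xe''; set r := rpar x in r1 ar rE *.
have r0 : 0 < r by lra.
have mle : m <= Num.min (b - x) x.
  by rewrite le_min !ge_min; apply/andP; split; apply/orP; [left|right]; rewrite /b; lra.
have h1 : m ^+ 2 * e / 2 <= Num.min (b - x) x ^+ 2 * (b - x) / 2.
  rewrite ler_pM2r ?invr_gt0//; apply: ler_pM; [by rewrite sqr_ge0|exact: ltW| |by rewrite /b; lra].
  by rewrite lerXn2r// ?nnegrE ltW// (lt_le_trans m0).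
move=> h2; have h3 := le_trans h1 h2.
have rb : r <= 4 / e2.
  by rewrite ler_pdivlMr//; move: ar; rewrite mulrC => ar; nra.
have h4 : m ^+ 2 * e / 2 <= (1 + b) * (4 / e2) * (2 - x * r).
  apply: (le_trans h3); rewrite mulrA ler_wpM2r ?subr_ge0 ?(ltW ar)//.
  by rewrite ler_wpM2l// addr_ge0// ltW.
have q0 : 0 < (1 + b) * (4 / e2) by rewrite mulr_gt0 ?divr_gt0// addr_gt0.
have h5 : c <= 2 - x * r by rewrite ler_pdivrMr// [leRHS]mulrC.
have h6 : x * r / 2 <= 1 - k by lra.
have k2 : 0 < 1 - k by lra.
have k3 : 1 - k <= 1 by lra.
have := xexpN_le h6 k2 k3.
have -> : x * r / 2 * expR (- (x * r / 2)) = x / 2.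
  by rewrite expRN rE; field; rewrite gt_eqF.
lra.
Qed.

Lemma betaf_continuous : {within `[0, e2]%classic, continuous betaf}.
Proof.
apply/subspace_continuousP => a; rewrite /= in_itv /= => /andP[a0 ae].
apply/cvgrPdist_le => e e0.
suff [d d0 Hd] : exists2 d : R, 0 < d & forall x, 0 <= x <= e2 -> `|a - x| < d ->
    `|betaf a - betaf x| <= e.
  apply/nbhs_ballP; exists d => // x /= ax; rewrite in_itv /= => xe.
  exact: Hd.
have mono u v : 0 <= u -> u <= v -> v <= e2 -> betaf v <= betaf u.
  move=> u0; rewrite le_eqVlt => /predU1P[->//|uv] ve.
  exact/ltW/betaf_decr.
move: (ae); rewrite le_eqVlt => /predU1P[aE|ae'].
  have [d d0 Hd] := betaf_left_e2 e0.
  exists d => // x /andP[x0 xe]; rewrite aE ltr_distlC => /andP[x1 x2].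
  have h := mono x e2 x0 xe (lexx _).
  rewrite ler0_norm ?subr_le0// opprB betaf_e2.
  move: xe; rewrite le_eqVlt => /predU1P[->|xe]; first by rewrite betaf_e2 subrr ltW.
  by have := Hd x x0 xe x1; lra.
have ae2 : 0 <= a < e2 by rewrite a0.
have [d1 d10 H1] := betaf_left ae2 e0.
have [d2 d20 H2] := betaf_right ae2 e0.
exists (Num.min (Num.min d1 d2) (e2 - a)).
  by rewrite !lt_min d10 d20 subr_gt0.
move=> x /andP[x0 xe]; rewrite !lt_min => /andP[/andP[]].
rewrite !ltr_distlC => /andP[x1 x2] /andP[x3 x4] /andP[x5 x6].
have xe2 : x < e2 by lra.
case: (ltgtP x a) => [xa|ax|->]; last by rewrite subrr normr0 ltW.
- have h := mono x a x0 (ltW xa) ae; rewrite ler0_norm ?subr_le0//.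
  by have := H1 x x0 xa x1; lra.
- have h := mono a x a0 (ltW ax) xe; rewrite ger0_norm ?subr_ge0//.
  by have := H2 x ax x4 xe2; lra.
Qed.

Lemma acrit_itv a : 0 < a < e2 -> 0 < a < 2 / expR 1.
Proof. by rewrite acritE. Qed.

Lemma dpar_gt0 a : 0 < a < e2 -> 0 < dpar a.
Proof.
move=> ae; have [[r1 _ _] [s0 s1 _]] := roots_props (acrit_itv ae).
by rewrite subr_gt0 ltf_pV2 ?posrE//; lra.
Qed.

(** By [Eab_large] at b = 2 a the hypothesis says Eab a (2 a) <= 1, so beta a >= 2 a. What remains
    is a quadratic equation for beta a - 2 a, whose nonnegative root is taken. *)
Lemma betaf_large a : 0 < a < e2 -> rpar a * spar a * (1 + dpar a ^+ 2) <= 2 ->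
  betaf a = 2 * a - 2 * dpar a
     + Num.sqrt (2 * dpar a ^+ 2 + 4 / (rpar a * spar a) - 2).
Proof.
move=> ae h; have ae' : 0 <= a < e2 by case/andP: ae => /ltW -> ->.
have a0 : 0 < a by case/andP: ae.
have d0 := dpar_gt0 ae; have ab := betaf_gt ae'.
have [[r1 _ _] [s0 s1 _]] := roots_props (acrit_itv ae).
have rs0 : 0 < rpar a * spar a by rewrite mulr_gt0//; lra.
have b2a : 2 * a <= betaf a.
  apply: betaf_ub => //; first by lra.
  have a2a : a < 2 * a by lra.
  rewrite EvE; have := Eab_large (acrit_itv ae) a2a (lexx _).
  rewrite subrr mulr0 expr0n /= mul0r !addr0 => ->; lra.
have E1 := Eab_beta ae'.
have := Eab_large (acrit_itv ae) ab b2a; rewrite -EvE E1.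
set m := betaf a - 2 * a; set d := dpar a in h d0 *; set p := rpar a * spar a in h rs0 *.
move=> e1; have m0 : 0 <= m by rewrite subr_ge0.
have -> : 2 * d ^+ 2 + 4 / p - 2 = (m + 2 * d) ^+ 2.
  have e3 : 4 / p = 2 + 2 * d ^+ 2 + 4 * d * m + m ^+ 2.
    apply: (mulIf (x := p)); first by rewrite gt_eqF.
    by rewrite divfK ?gt_eqF//; lra.
  by rewrite e3; ring.
rewrite sqrtr_sqr ger0_norm; last by rewrite addr_ge0// mulr_ge0// ltW.
rewrite /m; ring.
Qed.

(** [Eab_large] now excludes beta a >= 2 a. On ]0, a] the zeros of [Psi] are those of 1 - Eab a (a +
    l) by [Eab_small], so uniqueness of the root is that of beta. *)
Lemma betaf_small a : 0 < a < e2 -> 2 < rpar a * spar a * (1 + dpar a ^+ 2) ->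
  exists2 l, unique (fun l' => 0 < l' <= a /\ Psi a l' = 0) l & betaf a = a + l.
Proof.
move=> ae h; have ae' : 0 <= a < e2 by case/andP: ae => /ltW -> ->.
have a0 : 0 < a by case/andP: ae.
have d0 := dpar_gt0 ae; have ab := betaf_gt ae'.
have [[r1 _ _] [s0 s1 _]] := roots_props (acrit_itv ae).
have rs0 : 0 < rpar a * spar a by rewrite mulr_gt0//; lra.
have E1 := Eab_beta ae'.
have b2a : betaf a < 2 * a.
  rewrite ltNge; apply/negP => b2a.
  have := Eab_large (acrit_itv ae) ab b2a; rewrite -EvE E1.
  set m := betaf a - 2 * a; set d := dpar a in h d0 *; set p := rpar a * spar a in h rs0 *.
  have m0 : 0 <= m by rewrite subr_ge0.
  have : 0 <= p * (2 * d * m + m ^+ 2 / 2).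
    by rewrite mulr_ge0 ?(ltW rs0)// addr_ge0// ?mulr_ge0 ?divr_ge0 ?sqr_ge0// ltW.
  lra.
exists (betaf a - a); last by ring.
split.
  split; first by apply/andP; split; lra.
  by have [D D1 ->] := Eab_small (acrit_itv ae) ab (ltW b2a); rewrite -EvE E1 subrr mulr0.
move=> l [/andP[l0 la] Pl].
have al : a < a + l by rewrite ltrDl.
have al2 : a + l <= 2 * a by lra.
have [D D1] := Eab_small (acrit_itv ae) al al2; rewrite -EvE.
rewrite (addrC a) addrK Pl => /esym/eqP; rewrite mulf_eq0 gt_eqF ?(lt_le_trans ltr01)//=.
rewrite subr_eq0 => /eqP E; rewrite -(Eab_eq1 ae' _ (esym E)) ?addrK//.
by rewrite addrC.
Qed.

End Beta.

(** * Identification with the Neumann series *)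

Section SeriesSum.
Variable R : realType.
Implicit Types (a b t w C : R) (f g : R -> R).

Section Fixed.
Variables (a b : R).
Hypotheses (ae : 0 < a < 2 / expR 1).
Let w := 2 / a.
Let w0 : 0 < w. Proof. by have [] := weight_2a ae. Qed.
Let wa : expR (w * a) < w ^+ 2. Proof. by have [] := weight_2a ae. Qed.
Let A : set R := `[a, b]%classic.
Let L f := Top (mulind (~` A) (Sop a f)).
Let mA : measurable A. Proof. exact: measurable_itv. Qed.

Let expdom_shifted C f : expdom w C f ->
  expdom w (C * expR (w * a)) (mulind (~` A) (Sop a f)).
Proof.
move=> df; have C0 := expdom_ge0 0 df; case: df => mf hf; split.
  rewrite /mulind; apply: measurable_funM.
    by apply: measurable_indic; exact: measurableC.
  by apply: measurableT_comp => //; exact: measurable_lag.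
move=> t; have /andP[f0 fC] := hf (t - a).
rewrite /mulind /Sop indicE; case: (t \in _); rewrite /= ?mul1r ?mul0r.
  by rewrite f0 -mulrA -[expR (w * a) * _]expN_shift.
by rewrite lexx mulr_ge0 ?expR_ge0// mulr_ge0 ?expR_ge0.
Qed.

Lemma expdom_Phi_term j : exists C, expdom w C (Phi_term a b j).
Proof.
elim: j => [|j [C dC]].
  by eexists; apply: expdom_Top (expdom_indic a w0 (lexx b)).
by eexists; apply: expdom_Top (expdom_shifted dC).
Qed.

Lemma expdom_Phi_partial n : exists C, expdom w C (Phi_partial a b n).
Proof.
elim: n => [|n [C dC]].
  exists 0; split; first by rewrite /Phi_partial; under eq_fun do rewrite big_ord0; exact: measurable_cst.
  by move=> t; rewrite /Phi_partial big_ord0 mul0r lexx.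
have [C' dC'] := expdom_Phi_term n; exists (C + C').
have -> : Phi_partial a b n.+1 = (fun t => Phi_partial a b n t + Phi_term a b n t).
  by apply/funext => t; rewrite /Phi_partial big_ord_recr.
exact: expdomD.
Qed.

Let L_add C1 C2 f g t : expdom w C1 f -> expdom w C2 g ->
  L (fun t => f t + g t) t = L f t + L g t.
Proof.
move=> df dg; rewrite /L -(TopD w0 t (expdom_shifted df) (expdom_shifted dg)).
by congr (Top _ t); apply/funext => u; rewrite /mulind /Sop mulrDr.
Qed.

Lemma Phi_partial_rec n t :
  Phi_partial a b n.+1 t = Top (\1_A) t + L (Phi_partial a b n) t.
Proof.
elim: n => [|n IH].
  rewrite /Phi_partial big_ord1 /= (_ : L _ t = 0) ?addr0//.
  rewrite /L /Top (_ : (fun u => _) = (fun=> 0)).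
    by rewrite Rintegral_cst// mul0r.
  by apply/funext => u; rewrite /mulind /Sop big_ord0 !mulr0.
have -> : Phi_partial a b n.+2 t = Phi_partial a b n.+1 t + L (Phi_term a b n) t.
  by rewrite /Phi_partial big_ord_recr.
have [C1 d1] := expdom_Phi_partial n; have [C2 d2] := expdom_Phi_term n.
rewrite IH -addrA -(L_add t d1 d2); congr (_ + L _ t).
by apply/funext => u; rewrite /Phi_partial big_ord_recr.
Qed.

(** Both sequences start at 0 and obey the affine recursion of [Phi_partial_rec]: the Neumann
    partial sums are the monotone iterates. *)
Lemma Phi_partialE n : Phi_partial a b n = solI A (fun t => t - a) n.
Proof.
elim: n => [|n IH]; first by apply/funext => t; rewrite /Phi_partial big_ord0.
apply/funext => t; rewrite Phi_partial_rec /= -IH.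
have [C1 d1] := expdom_Phi_partial n.
by rewrite /L -(TopD w0 t (expdom_indic a w0 (lexx b)) (expdom_shifted d1)).
Qed.

Let sy := Fab_supersol w0 (ltW wa) (lexx b).
Let M := expR (w * b) / w ^+ 2.
Let q := expR (w * a) / w ^+ 2.

Let M0 : 0 <= M. Proof. by rewrite divr_ge0 ?expR_ge0 ?sqr_ge0. Qed.
Let q0 : 0 <= q. Proof. by rewrite divr_ge0 ?expR_ge0 ?sqr_ge0. Qed.
Let q1 : q < 1. Proof. by rewrite ltr_pdivrMr ?exprn_gt0// mul1r. Qed.

(** Each step integrates a delayed error, and [Top] sends exp (- w (u - a)) to q exp (- w t); on the
    plateau both right-hand sides equal 1. *)
Lemma solI_error n t : 0 <= Fab a b t - solI A (fun t => t - a) n t <= M * q ^+ n * expN w t.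
Proof.
apply/andP; split.
  by rewrite subr_ge0; exact: (@solI_le_sol _ _ _ _ _ _ w0 mA (measurable_lag a) sy).
elim: n t => [|n IH] t.
  by rewrite subr0 expr0 mulr1; exact: (Fab_le w0 (ltW wa) (lexx b)).
have dI := expdom_solI w0 mA (measurable_lag a) sy n.
have dF := expdom_Fab w0 (ltW wa) (lexx b).
have c0 : 0 <= M * q ^+ n * expR (w * a).
  by rewrite mulr_ge0 ?expR_ge0// mulr_ge0// exprn_ge0.
have dG := expdomZ c0 (expdom_expN w).
rewrite lerBlDl (Fab_fix w0 (ltW wa) (lexx b)) /=.
have -> : M * q ^+ n.+1 * expN w t = M * q ^+ n * expR (w * a) * Top (expN w) t.
  by rewrite Top_expN// exprSr /q; field; rewrite gt_eqF.
rewrite -(TopZ w0 _ t (expdom_expN w)) -(TopD w0 t dI dG).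
apply: (le_Top w0 dF (expdomD dI dG)) => u _.
have [h|h] := boolP (a <= u <= b).
  have Au : A u by rewrite /A /= in_itv.
  by rewrite (kab_in _ h) (kfun_in _ _ Au) lerDl mulr_ge0// ltW ?expN_gt0.
rewrite kab_out// kfun_out; last by rewrite /A /= in_itv /=; exact/negP.
by rewrite -lerBlDl (le_trans (IH _))// expN_shift mulrA.
Qed.

Lemma Xnorm_le f C : (forall t, `|f t| <= C * expN w t) -> (Xnorm a f <= C%:E)%E.
Proof.
move=> fC; apply: ge_ereal_sup => _ [t _ <-]; rewrite lee_fin.
have -> : 2 * t / a = w * t by rewrite /w; ring.
have := ler_wpM2l (expR_ge0 (w * t)) (fC t); rewrite mulrCA.
by rewrite -expRD subrr expR0 mulr1.
Qed.

Lemma Xnorm_ge0 f : (0 <= Xnorm a f)%E.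
Proof.
apply: le_trans (ereal_sup_ubound _); last by exists 0.
by rewrite lee_fin mulr_ge0 ?expR_ge0.
Qed.

Lemma Xspace_bounded f C : continuous f -> (forall t, `|f t| <= C * expN w t) ->
  Xspace a f.
Proof.
move=> cf fC; split=> //; apply: le_lt_trans (Xnorm_le fC) _; exact: ltry.
Qed.

Lemma calE_Eab : calE a b = Eab a b.
Proof.
rewrite /calE /Phi.
set S := (X in xget _ X).
have contI n : continuous (solI A (fun t => t - a) n).
  case: n => [|n]; first by move=> t; exact: cvg_cst.
  exact: (Top_continuous w0 (expdom_solI w0 mA (measurable_lag a) sy n)).
have SF : S (Fab a b).
  split.
  - apply: (Xspace_bounded (C := M)); first exact: (Fab_continuous w0 (ltW wa) (lexx b)).
    move=> t; rewrite ger0_norm; last exact: (Fab_ge0 w0 (ltW wa) (lexx b)).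
    exact: (Fab_le w0 (ltW wa) (lexx b)).
  - move=> n; rewrite Phi_partialE; apply: (Xspace_bounded (C := M)) => // t.
    have [_ /(_ t)/andP[h1 h2]] := solI_props w0 mA (measurable_lag a) sy n.
    by rewrite ger0_norm.
  - apply: (@squeeze_cvge _ _ _ _ (cst 0%E) _ (fun n => (M * q ^+ n)%:E)).
    + apply: nearW => n; rewrite Xnorm_ge0 /=; apply: Xnorm_le => t.
      rewrite distrC Phi_partialE; have /andP[h1 h2] := solI_error n t.
      by rewrite ger0_norm.
    + exact: cvg_cst.
    + apply: cvg_EFin; first exact: nearW.
      rewrite -[X in _ --> X](mulr0 M); apply: cvgM; first exact: cvg_cst.
      by apply: cvg_expr; rewrite ger0_norm.
have [_ _ cG] := xgetPex (fun=> 0) (ex_intro _ _ SF).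
set G := xget _ _ in cG *.
(* The chosen sum [G] is identified with [Fab a b] only at 0: the weight is 1 there, so the norm
   bounds the difference at that point. *)
apply: (@cvg_unique _ _ (solI A (fun t => t - a) n 0 @[n --> \oo])) => //.
- apply/cvgrPdist_lt => e e0.
  have : \forall n \near \oo, (Xnorm a (fun t => Phi_partial a b n t - G t)%R < e%:E)%E.
    have /fine_cvgP[fG cG'] := cG.
    apply: filterS2 fG (cvgr_lt _ cG' e e0) => n fn.
    by rewrite -lte_fin fineK.
  apply: filterS => n; rewrite Phi_partialE distrC -lte_fin; apply: le_lt_trans.
  apply: ereal_sup_ubound; exists 0 => //.
  by rewrite mulr0 mul0r expR0 mul1r.
- exact: (@solI_cvg _ _ _ _ _ _ w0 mA (measurable_lag a) sy).
Qed.

End Fixed.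

End SeriesSum.

(** * Necessity *)

Section AbsoluteContinuityClosure.
Variable R : realType.
Implicit Types (p q u v t l L : R) (f g : R -> R) (A : set R).

Lemma abs_continuous_sub p q p' q' f : p <= p' -> q' <= q ->
  abs_continuous_on p q f -> abs_continuous_on p' q' f.
Proof.
move=> pp qq acf e /acf[d d0 H]; exists d => // n u v uv; apply: H => i.
by have [h1 h2 h3] := uv i; split=> //; lra.
Qed.

Lemma abs_continuousD p q f g : abs_continuous_on p q f ->
  abs_continuous_on p q g -> abs_continuous_on p q (fun t => f t + g t).
Proof.
move=> acf acg e e0; have e2 : 0 < e / 2 by rewrite divr_gt0.
have [d1 d10 H1] := acf _ e2; have [d2 d20 H2] := acg _ e2.
exists (Num.min d1 d2) => [|n u v uv tr]; first by rewrite lt_min d10.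
rewrite lt_min => /andP[/(H1 n u v uv tr) h1 /(H2 n u v uv tr) h2].
rewrite [e]splitr; apply: le_lt_trans (ltrD h1 h2).
rewrite -big_split /=; apply: ler_sum => i _.
by rewrite opprD addrACA ler_normD.
Qed.

Lemma abs_continuous_lip p q L f : 0 < L ->
  (forall u v, p <= u -> u <= v -> v <= q -> `|f v - f u| <= L * (v - u)) ->
  abs_continuous_on p q f.
Proof.
move=> L0 H e e0; exists (e / L) => [|n u v uv tr]; first by rewrite divr_gt0.
rewrite ltr_pdivlMr// mulrC; apply: le_lt_trans.
rewrite mulr_sumr; apply: ler_sum => i _.
by have [h1 h2 h3] := uv i; exact: H.
Qed.

Lemma has_deriv_within_interior A f t l : nbhs t A ->
  has_deriv_within A f t l -> is_derive t 1 f l.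
Proof.
move=> At df.
have h : h^-1 *: (f (h *: 1 + t) - f t) @[h --> 0^'] --> l.
  apply/cvgrPdist_le => e e0.
  have /cvgrPdist_le/(_ e e0) H := df.
  have : \forall u \near t, u != t -> `|l - (f u - f t) / (u - t)| <= e.
    by apply: filterS2 At H => u Au Hu /Hu; exact.
  move=> /nbhs_ballP[d d0 Hd]; apply/nbhs_ballP; exists d => // h hd h0.
  have ut : `|t - (h + t)| < d by rewrite opprD addrCA subrr addr0 normrN; move: hd; rewrite /ball /= sub0r normrN.
  have := Hd (h + t) ut; rewrite addrK -subr_eq0 addrK => /(_ h0).
  by rewrite /GRing.scale /= mulr1 mulrC.
by split; [exact: cvgP h|exact/cvg_lim].
Qed.

Lemma is_derive_has_deriv_within A f t l : is_derive t 1 f l ->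
  has_deriv_within A f t l.
Proof.
move=> df; apply/cvgrPdist_le => e e0.
have h : h^-1 *: (f (h *: 1 + t) - f t) @[h --> 0^'] --> l.
  by case: df => df <-.
have /cvgrPdist_le/(_ e e0)/nbhs_ballP[d d0 Hd] := h.
apply/nbhs_ballP; exists d => // u ut u0 _.
have := Hd (u - t); rewrite /ball /= sub0r opprB => /(_ ut).
by rewrite subr_eq0 => /(_ u0); rewrite /GRing.scale /= mulr1 subrK mulrC.
Qed.

End AbsoluteContinuityClosure.

(** * Comparison of a solution with the iterates *)

Section Necessity.
Variable R : realType.
Notation mu := (@lebesgue_measure R).
Implicit Types (w C a b p q s t u v : R) (k x y tau : R -> R).

Lemma expdom_shift w C k p : expdom w C k ->
  expdom w (C * expR (w * p)) (fun t => k (t - p)).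
Proof.
move=> [mk hk]; split; first by apply: measurableT_comp => //; exact: measurable_lag.
move=> t; have /andP[k0 kC] := hk (t - p).
by rewrite k0 -mulrA -[expR (w * p) * _]expN_shift.
Qed.

Section Comparison.
Variables (tau x y : R -> R) (w a b T t1 : R).
Hypotheses (w0 : 0 < w) (wa : expR (w * a) <= w ^+ 2) (a0 : 0 <= a).
Hypotheses (t1T : t1 <= T) (x0 : forall t, t1 <= t -> 0 < x t).
Hypothesis xd : forall u v, t1 <= u -> u <= v -> x v <= x u.
Hypothesis dx : forall t, t1 <= t -> is_derive t 1 x (y t).
Hypothesis acy : forall q, t1 <= q -> abs_continuous_on t1 q y.
Hypothesis aey : {ae mu, forall t, t1 <= t -> is_derive t 1 y (x (tau t))}.
Hypothesis tau_mono : {homo tau : u v / u <= v}.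
Hypothesis lag : forall t, T <= t -> t1 <= tau t /\ a <= t - tau t.

Let A : set R := `[a, b]%classic.
Let I n : R -> R := solI A (fun t => t - a) n.

Let y0 t : t1 < t -> y t <= 0.
Proof.
move=> t1t; rewrite leNgt; apply/negP => yt.
have /cvgrPdist_lt/(_ _ yt) := @is_derive_has_deriv_within _ setT _ _ _ (dx (ltW t1t)).
move=> /nbhs_ballP[d /= d0 Hd].
have d20 : 0 < d / 2 by rewrite divr_gt0.
have := Hd (t + d / 2); rewrite /ball /= opprD addrA subrr sub0r normrN.
rewrite gtr0_norm// ltr_pdivrMr// ltr_pMr// ltrDl ltr01 => /(_ isT).
rewrite -subr_eq0 [_ + d / 2 - t]addrAC subrr add0r (gt_eqF d20) => /(_ isT Logic.I).
apply/negP; rewrite -leNgt ler_normr; apply/orP; left.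
rewrite lerDl oppr_ge0 pmulr_lle0 ?invr_gt0// subr_le0.
by apply: xd; [exact: ltW|rewrite lerDl ltW].
Qed.

Section Shifted.
Variable s : R.
Hypotheses (Ts : T <= s) (bs : b <= s - tau s).
Let p := tau s.

Let p1 : t1 <= p. Proof. by have [] := lag Ts. Qed.

(** The n-th iterate looks back through n lags, hence the range starting at T + n a. The induction
    step integrates the second-order inequality twice from infinity, using y <= 0 and x > 0 as
    boundary information. *)
Lemma comparison n t : T + n%:R * a <= t -> x p * I n (t - p) <= x t.
Proof.
elim: n t => [|n IH] t Tt.
  rewrite mulr0 ltW// x0//; apply: le_trans Tt.
  by rewrite mul0r addr0.
have xp : 0 < x p by exact: x0.
have Tn u : t <= u -> T + n%:R * a <= u - a.
  move=> tu; move: Tt; rewrite -natr1 mulrDl mul1r; lra.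
have na0 : 0 <= n%:R * a by rewrite mulr_ge0.
have Tu u : t <= u -> T <= u.
  by move=> /Tn h; move: a0 na0 h; lra.
have dk0 := expdom_solI w0 (measurable_itv `[a, b]) (measurable_lag a) (Fab_supersol w0 wa (lexx b)) n.
have := expdom_shift p dk0.
set C := (X in expdom w X); set K := fun u => _; move=> dK.
have C0 := expdom_ge0 0 dK.
(* On the plateau u <= p + b <= s, so tau u <= tau s = p; elsewhere tau u <= u - a. *)
have xK u : t <= u -> x p * K u <= x (tau u).
  move=> tu; have [t1u au] := lag (Tu u tu).
  have [h|h] := pselect (A (u - p)).
    rewrite /K (kfun_in _ _ h) mulr1; apply: xd => //.
    apply: tau_mono; move: h bs; rewrite /A /= in_itv /= -/p => /andP[]; lra.
  rewrite /K (kfun_out _ _ h) addrAC; apply: le_trans (IH _ (Tn u tu)) _.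
  by apply: xd => //; lra.
(* [Y] is the derivative of x - x p Top K, and its own derivative is nonnegative almost
   everywhere. *)
pose Y u := y u + x p * Vop K u.
have Yle u v : t <= u -> u <= v -> Y u <= Y v.
  move=> tu uv; have t1u : t1 <= u by exact: le_trans (Tu u tu).
  apply: abs_continuous_nondecreasing => //.
    apply: abs_continuousD; first exact: (abs_continuous_sub t1u (lexx v) (acy (le_trans t1u uv))).
    apply: (@abs_continuous_lip _ _ _ (x p * (C * expN w u + 1))).
      by rewrite mulr_gt0// ltr_wpDl// mulr_ge0// ltW// expN_gt0.
    move=> u' v' uu' uv' vv'; rewrite -mulrBr normrM gtr0_norm// -mulrA ler_pM2l//.
    rewrite distrC ger0_norm; last by rewrite subr_ge0 (Vop_nincr w0 dK).
    apply: le_trans (Vop_lip w0 dK uv') _; rewrite ler_wpM2r ?subr_ge0//.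
    apply: le_trans (_ : C * expN w u <= _); last by rewrite lerDl.
    by rewrite ler_wpM2l// le_expN.
  have D (r : R) : (t1 <= r -> is_derive r 1 y (x (tau r))) ->
      is_derive r 1 (Vop K) (- K r) ->
      u <= r <= v -> exists2 l : R, 0 <= l & is_derive r 1 Y l.
    move=> dyr dVr /andP[ur rv]; have tr := le_trans tu ur.
    exists (x (tau r) - x p * K r); first by rewrite subr_ge0 xK.
    have d1 := dyr (le_trans t1u ur).
    by apply: is_derive_eq; rewrite /GRing.scale /=; ring.
  by apply: (@filterS2 _ _ (ae_filter_ringOfSetsType mu) _ _ _ _ aey (Vop_ae_derive w0 dK)).
have Y0 u : t <= u -> Y u <= 0.
  move=> tu; have hc : x p * Vop K v @[v --> +oo] --> 0.
    rewrite -(mulr0 (x p)); apply: cvgM; [exact: cvg_cst|exact: (Vop_cvg w0 dK)].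
  apply: (cvgr_to_ge hc); near=> v.
  have uv : u < v by near: v; apply: nbhs_pinfty_gt; exact: num_real.
  apply: le_trans (Yle u v tu (ltW uv)) _.
  by rewrite /Y gerDr; apply: y0; apply: le_lt_trans uv; exact: le_trans (Tu u tu).
have dW u : t <= u -> is_derive u 1 (fun u => x u - x p * Top K u) (Y u).
  move=> tu; have d1 := dx (le_trans t1T (Tu u tu)).
  have d2 := is_derive_Top w0 dK u.
  by apply: is_derive_eq; rewrite /GRing.scale /= /Y; ring.
have Wle u : t <= u -> x u - x p * Top K u <= x t - x p * Top K t.
  move=> tu.
  suff : - (x t - x p * Top K t) <= - (x u - x p * Top K u) by rewrite lerN2.
  apply: (@nondecreasing_of_derive _ (fun u => - (x u - x p * Top K u)) (fun u => - Y u)) => //.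
  - apply: continuous_in_subspaceT => v /[!inE]/=; rewrite in_itv /= => /andP[tv _].
    by apply: cvgN; exact: is_derive_continuous (dW v tv).
  - move=> v /andP[/ltW tv _]; have d := dW v tv.
    by apply: is_derive_eq.
  - by move=> v /andP[/ltW tv _]; rewrite oppr_ge0 Y0.
have -> : I n.+1 (t - p) = Top K t by rewrite /K (Top_shift _ _ dk0).
rewrite -subr_ge0.
have hc : - (x p * Top K v) @[v --> +oo] --> 0.
  rewrite -oppr0 -(mulr0 (x p)); apply: cvgN; apply: cvgM; [exact: cvg_cst|exact: (Top_cvg w0 dK)].
apply: (cvgr_to_le hc); near=> v.
have tv : t <= v by near: v; apply: nbhs_pinfty_ge; exact: num_real.
apply: le_trans (Wle v tv); rewrite lerDr ltW// x0//.
Unshelve. all: end_near. Qed.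

End Shifted.

(** At t = p the comparison reads x p I_n 0 <= x p. For each n a late time s is chosen so that p =
    tau s lies in the range available to the n-th iterate. *)
Lemma Eab_le1 : (forall M : R, exists2 s, M <= s & b <= s - tau s) ->
  tau t @[t --> +oo] --> +oo -> Eab a b <= 1.
Proof.
move=> freq taup; apply: ge_sup; first by exists (I 0 0), 0%N.
move=> _ [n _ <-]; rewrite -/(I n 0).
have /cvgryPge/(_ (T + n%:R * a))[M [_ HM]] := taup.
have [s Ms bs] := freq (Num.max (M + 1) T).
move: Ms; rewrite ge_max => /andP[Ms Ts].
have := @comparison s Ts bs n (tau s); rewrite subrr => /(_ (HM s _)).
have [t1s _] := lag Ts.
rewrite -[leRHS]mulr1 ler_pM2l ?x0//; apply; lra.
Qed.

End Comparison.

End Necessity.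

(** * Lower and upper limits of the lag, and the necessary condition *)

Section Lags.
Variable R : realType.
Implicit Types (a b c e s t : R) (x y tau : R -> R).
Local Notation e2 := (acrit R).

Lemma ereal_between c (l : \bar R) : (c%:E < l)%E ->
  exists2 c', c < c' & (c'%:E < l)%E.
Proof.
case: l => [r| |]; rewrite ?lte_fin//.
  by move=> cr; exists ((c + r) / 2); rewrite ?lte_fin; lra.
by move=> _; exists (c + 1); rewrite ?ltrDl// ltry.
Qed.

Lemma lag_liminf_gt tau c : (c%:E < lag_liminf tau)%E ->
  exists M : R, forall t, M <= t -> c <= t - tau t.
Proof.
rewrite /lag_liminf limf_einfE => /ereal_sup_gt[_ [V [M [_ HM]] <-] cV].
exists (M + 1) => t Mt; rewrite -lee_fin; apply: le_trans (ltW cV) _.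
apply: ereal_inf_lbound; exists t => //; apply: HM.
by apply: lt_le_trans Mt; rewrite ltrDl.
Qed.

Lemma lag_limsup_gt tau c : (c%:E < lag_limsup tau)%E ->
  forall M : R, exists2 s, M <= s & c <= s - tau s.
Proof.
rewrite /lag_limsup limf_esupE => cl M.
have : (c%:E < ereal_sup [set (t - tau t)%:E | t in [set t | M <= t]%R])%E.
  apply: lt_le_trans cl _; apply: ereal_inf_lbound.
  exists [set t | M <= t] => //; exists M; split; first exact: num_real.
  by move=> t /ltW.
by move=> /ereal_sup_gt[_ [s /= Ms <-]]; rewrite lte_fin => /ltW ?; exists s.
Qed.

Lemma lag_liminf_ge tau c (M : R) : (forall t, M <= t -> c <= t - tau t) ->
  (c%:E <= lag_liminf tau)%E.
Proof.
move=> H; rewrite /lag_liminf limf_einfE.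
apply: le_trans (ereal_sup_ubound _); last first.
  exists [set t | M <= t] => //; exists M; split; first exact: num_real.
  by move=> t /ltW.
by apply: le_ereal_inf_tmp => _ [t Mt <-]; rewrite lee_fin; exact: H.
Qed.

Lemma lag_liminf_le tau c : (forall M : R, exists2 s, M <= s & s - tau s <= c) ->
  (lag_liminf tau <= c%:E)%E.
Proof.
move=> H; rewrite leNgt; apply/negP => cl.
have [c' c1 c2] := ereal_between cl.
have [M HM] := lag_liminf_gt c2; have [s Ms sc] := H M.
by have := le_trans (HM s Ms) sc; rewrite leNgt c1.
Qed.

Lemma lag_limsup_le tau c (M : R) : (forall t, M <= t -> t - tau t <= c) ->
  (lag_limsup tau <= c%:E)%E.
Proof.
move=> H; rewrite /lag_limsup limf_esupE.
apply: le_trans (ereal_inf_lbound _) _.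
  exists [set t | M <= t] => //; exists M; split; first exact: num_real.
  by move=> t /ltW.
by apply: ge_ereal_sup => _ [t Mt <-]; rewrite lee_fin; exact: H.
Qed.

Lemma lag_limsup_ge tau c :
  (forall c' M : R, c' < c -> exists2 s, M <= s & c' <= s - tau s) ->
  (c%:E <= lag_limsup tau)%E.
Proof.
move=> H; rewrite leNgt; apply/negP.
rewrite {1}/lag_limsup limf_esupE => /ereal_inf_lt[_ [V [M [_ HM]] <-] Vc].
have Vs t : M < t -> ((t - tau t)%:E <= ereal_sup [set (t - tau t)%:E | t in V])%E.
  by move=> Mt; apply: ereal_sup_ubound; exists t => //; exact: HM.
set S := ereal_sup _ in Vc Vs.
have SE : S \is a fin_num.
  rewrite fin_numE; apply/andP; split.
    by apply/eqP => E; have := Vs (M + 1); rewrite E ltrDl => /(_ ltr01).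
  by apply/eqP => E; move: Vc; rewrite E.
move: Vc; rewrite -(fineK SE) lte_fin => Vc.
have [s Ms] := H ((fine S + c) / 2) (M + 1) ltac:(lra).
have := Vs s ltac:(lra); rewrite -(fineK SE) lee_fin; lra.
Qed.

Lemma lag_liminf_ge0 tau : (forall t, tau t <= t) -> (0 <= lag_liminf tau)%E.
Proof. by move=> H; apply: (@lag_liminf_ge _ 0 0) => t _; rewrite subr_ge0. Qed.

Lemma necessity_step tau a b : admissible_delay tau ->
  has_eventually_positive_decreasing_solution tau -> 0 <= a < e2 ->
  (exists M : R, forall t, M <= t -> a <= t - tau t) ->
  (forall M : R, exists2 s, M <= s & b <= s - tau s) -> Ev a b <= 1.
Proof.
move=> [tm tl tp] [t0 [J [x [[_ _ _ _ [y [_ dx acy aey]]] [t1 t01 [x0 xd]]]]]] ae.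
move=> [M HM] freq; have [a' [aa' a'e [w0 wa']]] := weight_exists ae.
have [_ /ltW wa] := weightP a'e (ltW aa').
(* Strictly above [t0] the derivative within the half-line is a two-sided derivative. *)
pose t2 := t1 + 1; have t12 : t1 < t2 by rewrite ltrDl.
have t02 : t0 < t2 by exact: le_lt_trans t12.
have /cvgryPge/(_ t2)[M' [_ HM']] := tp.
pose T := Num.max (Num.max M (M' + 1)) t2.
rewrite EvE; apply: (@Eab_le1 _ tau x y (2 / a') a b T t2 w0 wa) => //.
- by case/andP: ae.
- by rewrite le_max lexx orbT.
- by move=> t t2t; apply: x0; lra.
- by move=> u v t2u uv; apply: xd => //; lra.
- move=> t t2t; have t0t : t0 < t by lra.
  apply: (has_deriv_within_interior (A := `[t0, +oo[%classic)); last exact/dx/ltW.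
  apply: (@filterS _ (nbhs t) _ [set u | t0 < u]).
    by move=> u /=; rewrite in_itv /= andbT => /ltW.
  by apply: open_nbhs_nbhs; split=> //; exact: open_gt.
- move=> q t2q; apply: abs_continuous_sub (acy q _) => //; lra.
- apply: (@filterS _ _ (ae_filter_ringOfSetsType (@lebesgue_measure R)) _ _ _ aey).
  by move=> t H t2t; apply: H; apply: le_trans t2t; exact: ltW.
- move=> t; rewrite /T !ge_max => /andP[/andP[Mt M't] _]; split; last exact: HM.
  apply: HM'; lra.
Qed.

(** The lag is known to be eventually at least a' only for a' below its lower limit; this is the
    passage back to [a], the critical lag included. *)
Lemma betaf_left_approx a e : 0 < a <= e2 -> 0 < e ->
  exists a', [/\ 0 <= a', a' < a & betaf a' <= betaf a + e].
Proof.
move=> /andP[a0 ae] e0.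
have [d d0 H] : exists2 d : R, 0 < d & forall x : R, 0 <= x -> x < a -> a - d < x ->
    betaf x <= betaf a + e.
  move: ae; rewrite le_eqVlt => /predU1P[->|ae].
    by rewrite betaf_e2; exact: betaf_left_e2.
  by apply: betaf_left => //; rewrite (ltW a0).
exists (Num.max 0 (a - d / 2)); have ha : Num.max 0 (a - d / 2) < a.
  by rewrite gt_max a0 /=; lra.
split => //; first by rewrite le_max lexx.
apply: H => //; first by rewrite le_max lexx.
by rewrite lt_max; apply/orP; right; lra.
Qed.

Lemma necessity tau : admissible_delay tau ->
  has_eventually_positive_decreasing_solution tau ->
  (lag_liminf tau <= e2%:E)%E /\
  (lag_limsup tau <= (betaf (fine (lag_liminf tau)))%:E)%E.
Proof.
move=> ad hs; have [_ tl _] := ad.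
have step a b : 0 <= a < e2 -> a < b ->
    (exists M : R, forall t, M <= t -> a <= t - tau t) ->
    (forall M : R, exists2 s, M <= s & b <= s - tau s) -> b <= betaf a.
  move=> ae ab ev freq; apply: betaf_ub => //; first exact: ltW.
  exact: necessity_step ad hs ae ev freq.
have l0 := lag_liminf_ge0 tl; have e0 := e2_gt0 R.
have le2 : (lag_liminf tau <= e2%:E)%E.
  rewrite leNgt; apply/negP => /ereal_between[b eb bl].
  (* A lag eventually at least b > 2 / e is eventually at least any a < 2 / e and frequently at
     least b, whereas beta a < b for [a] close to 2 / e. *)
  have be : 0 < (b - e2) / 2 by lra.
  have [|a [a0 ae ba]] := betaf_left_approx _ be (a := e2); first by rewrite e0 lexx.
  have [M HM] := lag_liminf_gt bl.
  have ev : exists M : R, forall t, M <= t -> a <= t - tau t.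
    by exists M => t /HM; lra.
  have := step a b; rewrite a0 ae => /(_ isT ltac:(lra) ev).
  have freq M' : exists2 s, M' <= s & b <= s - tau s.
    by exists (Num.max M M'); [|apply: HM]; rewrite le_max lexx ?orbT.
  by move=> /(_ freq); move: ba; rewrite betaf_e2; lra.
split=> //; have lE : lag_liminf tau \is a fin_num.
  by rewrite ge0_fin_numE// (le_lt_trans le2)// ltry.
move: l0 le2 (@lag_liminf_gt tau); rewrite -{1 2 3}(fineK lE); set a := fine _.
rewrite !lee_fin => a0 ae Ha; rewrite leNgt; apply/negP => /ereal_between[b ab bl].
have freq := lag_limsup_gt bl.
have ge_e2 : e2 <= betaf a by have /andP[] := @betaf_bounds R a ltac:(by rewrite a0).
(* For a = 0 there is no smaller lag to start from, but the lag is nonnegative everywhere and [step]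
   applies at 0 itself. *)
move: a0; rewrite le_eqVlt => /predU1P[a0|a0].
  have := step a b; rewrite -a0 lexx e0 => /(_ isT).
  have b0 : 0 < b by lra.
  move=> /(_ b0 _ freq) h; suff : b <= betaf 0 by rewrite a0; lra.
  by apply: h; exists 0 => t _; rewrite subr_ge0.
have be : 0 < (b - betaf a) / 2 by lra.
have [|a' [a'0 a'a ba]] := betaf_left_approx _ be (a := a); first by rewrite a0.
have [|M HM] := Ha a'; first by rewrite lte_fin.
have := step a' b; rewrite a'0 (lt_le_trans a'a ae) => /(_ isT).
have a'b : a' < b by lra.
move=> /(_ a'b (ex_intro _ M HM) freq); lra.
Qed.

End Lags.

(** * Sharpness *)

Section SolutionFromKernel.
Variable R : realType.
Notation mu := (@lebesgue_measure R).
Implicit Types (w C a s t u v : R) (tau : R -> R).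
Variables (w C : R) (k : R -> R).
Hypotheses (w0 : 0 < w) (dk : expdom w C k) (Top0 : forall t, 0 < Top k t).

Lemma Vop_gt0 t : 0 < Vop k t.
Proof.
rewrite lt_neqAle (Vop_ge0 dk) andbT eq_sym; apply/eqP => Vt0.
have : Top k t <= 0.
  apply: (cvgr_to_ge (Top_cvg w0 dk)); near=> u.
  have tu : t <= u by near: u; apply: nbhs_pinfty_ge; exact: num_real.
  by have /andP[_] := Top_diff w0 dk tu; rewrite Vt0 mulr0 subr_le0.
by rewrite leNgt Top0.
Unshelve. all: end_near. Qed.

Lemma Top_decr u v : u < v -> Top k v < Top k u.
Proof.
move=> uv; have /andP[h _] := Top_diff w0 dk (ltW uv).
by rewrite -subr_gt0; apply: lt_le_trans h; rewrite mulr_gt0 ?subr_gt0// Vop_gt0.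
Qed.

Lemma le_Top_inv u v : Top k v <= Top k u -> u <= v.
Proof. by apply: contraTT; rewrite -!ltNge => /Top_decr. Qed.

Lemma Top_inj u v : Top k u = Top k v -> u = v.
Proof.
move=> E; apply/eqP; rewrite eq_le; apply/andP.
by split; apply: le_Top_inv; rewrite E.
Qed.

(** Convexity makes [Top k] grow at least linearly towards minus infinity, and it tends to 0 at plus
    infinity. *)
Lemma Top_onto c : 0 < c -> exists s, Top k s = c.
Proof.
move=> c0; have V0 := Vop_gt0 0; pose s0 := - (c / Vop k 0).
have s00 : s0 <= 0 by rewrite oppr_le0 ltW// divr_gt0.
have cs0 : c <= Top k s0.
  have /andP[h _] := Top_diff w0 dk s00.
  have <- : (0 - s0) * Vop k 0 = c by rewrite sub0r opprK divfK// gt_eqF.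
  by apply: le_trans h _; rewrite gerBl ltW.
have /cvgrPdist_lt/(_ _ c0)[M [_ HM]] := Top_cvg w0 dk.
pose s1 := Num.max s0 (M + 1).
have cs1 : Top k s1 <= c.
  have /HM : M < s1 by rewrite lt_max; apply/orP; right; rewrite ltrDl.
  by rewrite /= sub0r normrN gtr0_norm// => /ltW.
have s01 : s0 <= s1 by rewrite le_max lexx.
have [||s _ sE] := @IVT R (Top k) s0 s1 c s01; last by exists s.
- by apply: continuous_subspaceT; exact: (Top_continuous w0 dk).
- by rewrite ge_min le_max cs0 cs1 orbT.
Qed.

Lemma Top_solution tau : (forall t, k t = Top k (tau t)) ->
  has_positive_decreasing_solution tau.
Proof.
move=> kE; exists 0, setT, (Top k); split => //; last by move=> u v _ _; exact: Top_decr.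
split => //.
  by apply: continuous_subspaceT; exact: (Top_continuous w0 dk).
exists (fun t => - Vop k t); split.
- by apply: continuous_subspaceT => t; apply: cvgN; exact: (Vop_continuous w0 dk).
- by move=> t _; apply: is_derive_has_deriv_within; exact: (is_derive_Top w0 dk).
- move=> q _; have C0 := expdom_ge0 0 dk.
  apply: (@abs_continuous_lip _ _ _ (C * expN w 0 + 1)).
    by rewrite ltr_wpDl// mulr_ge0// ltW// expN_gt0.
  move=> u v u0 uv _; rewrite opprK addrC ger0_norm; last first.
    by rewrite subr_ge0 (Vop_nincr w0 dk).
  apply: le_trans (Vop_lip w0 dk uv) _; rewrite ler_wpM2r ?subr_ge0//.
  apply: le_trans (_ : C * expN w 0 <= _); last by rewrite lerDl.
  by rewrite ler_wpM2l// le_expN.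
- have D (t : R) : is_derive t 1 (Vop k) (- k t) ->
      0 <= t -> is_derive t 1 (fun t => - Vop k t) (Top k (tau t)).
    by move=> d _; rewrite -kE -[k t]opprK; exact: is_deriveN.
  by apply: (@filterS _ _ (ae_filter_ringOfSetsType mu) _ _ _ (Vop_ae_derive w0 dk)).
Qed.

Hypotheses (kn : forall u v, u <= v -> k v <= k u).

(* The delay is read off the solution [Top k]: it solves
   [Top k (tau t) = k t], and monotonicity of [k] makes it nondecreasing. *)
Lemma delay_of_kernel a : 0 <= a -> (forall t, Top k (t - a) <= k t) ->
  exists tau, [/\ admissible_delay tau, forall t, k t = Top k (tau t),
    forall t, tau t <= t - a & has_positive_decreasing_solution tau].
Proof.
move=> a0 ka; have k0 t : 0 < k t by exact: lt_le_trans (ka t).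
have /choice[tau tauE] : forall t, exists s, Top k s = k t.
  by move=> t; exact: Top_onto.
have taua t : tau t <= t - a by apply: le_Top_inv; rewrite tauE.
exists tau; split => //; last by apply: Top_solution => t; rewrite tauE.
split.
- by move=> u v uv; apply: le_Top_inv; rewrite !tauE; exact: kn.
- by move=> t; apply: le_trans (taua t) _; rewrite gerBl.
- apply/cvgryPge => s.
  have /cvgrPdist_lt/(_ _ (Top0 s)) : k t @[t --> +oo] --> 0.
    apply: (@squeeze_cvgr _ _ _ _ (cst 0) (fun t => C * expN w t)).
    + by apply: nearW => t; have [_] := dk; exact.
    + exact: cvg_cst.
    + by rewrite -(mulr0 C); apply: cvgM; [exact: cvg_cst|exact: cvg_expN].
  apply: filterS => t; rewrite sub0r normrN gtr0_norm// => kt.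
  by apply: le_Top_inv; rewrite tauE ltW.
Qed.

End SolutionFromKernel.

(** * A kernel with sparse plateaus and the lag it produces *)

Section PlateauTrain.
Variable R : realType.
Implicit Types (c h s t u v : R) (tau : R -> R).
Variables (a b w1 w2 : R).
Hypotheses (a0 : 0 <= a) (ab : a < b) (b2 : b <= 2) (E1 : Eab a b = 1).
Hypotheses (w10 : 0 < w1) (w12 : w1 < w2).
Hypotheses (wa1 : expR (w1 * a) <= w1 ^+ 2) (wa2 : expR (w2 * a) <= w2 ^+ 2).

Let w20 : 0 < w2. Proof. exact: lt_trans w12. Qed.
Let F := Fab a b.
Let k := kab a b F.
(** The rate w1 + d of the amplitudes is the midpoint of the two weights, at distance [d] from
    each. *)
Let d := (w2 - w1) / 2.
Let q := expR (- d).
Let p (m : nat) : R := m%:R ^+ 2.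
Let c (m : nat) : R := expN (w1 + d) (p m).
Let M := expR (w1 * b) / w1 ^+ 2 + expR (w2 * b) / w2 ^+ 2.

Let d0 : 0 < d. Proof. by rewrite divr_gt0 ?subr_gt0. Qed.
Let q0 : 0 < q. Proof. exact: expR_gt0. Qed.
Let q1 : q < 1. Proof. by rewrite expR_lt1 oppr_lt0. Qed.
Let c0 m : 0 < c m. Proof. exact: expN_gt0. Qed.
Let M0 : 0 <= M. Proof. by rewrite addr_ge0// divr_ge0 ?expR_ge0 ?sqr_ge0. Qed.

Let FE : F = Top k. Proof. exact: (Fab_fix w10 wa1 (lexx b)). Qed.
Let dk : expdom w1 (expR (w1 * b)) k. Proof. exact: (expdom_Fab w10 wa1 (lexx b)). Qed.
Let F0 t : 0 <= F t. Proof. exact: (Fab_ge0 w10 wa1 (lexx b)). Qed.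
Let Fn u v : u <= v -> F v <= F u. Proof. exact: (Fab_nincr w10 wa1 (lexx b)). Qed.
Let F_le1 t : 0 <= t -> F t <= 1. Proof. by move=> /Fn; rewrite -/(Eab a b) [F 0]E1. Qed.
Let F_ge1 t : t <= 0 -> 1 <= F t. Proof. by move=> /Fn; rewrite [F 0]E1. Qed.

Let k_ge t : F (t - a) <= k t.
Proof.
have [h|h] := boolP (a <= t <= b); last by rewrite /k kab_out.
by rewrite /k (kab_in _ h); apply: F_le1; case/andP: h; rewrite subr_ge0.
Qed.

Let k_nincr u v : u <= v -> k v <= k u.
Proof.
move=> uv; have [h|h] := boolP (a <= v <= b); last first.
  by rewrite {1}/k (kab_out _ h); apply: le_trans (k_ge u); apply: Fn; rewrite lerB.
rewrite {1}/k (kab_in _ h); have [h'|h'] := boolP (a <= u <= b).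
  by rewrite /k (kab_in _ h').
rewrite /k (kab_out _ h') F_ge1// subr_le0 ltW// ltNge.
by apply: contra h' => ->; case/andP: h => _; exact: le_trans.
Qed.

Let k0 t : 0 <= k t. Proof. by have [_ /(_ t)/andP[]] := dk. Qed.

Let geometric_sum_le N : \sum_(m < N) q ^+ m <= (1 - q)^-1.
Proof.
rewrite -[leRHS]mul1r ler_pdivlMr ?subr_gt0// -opprB mulrN mulrC -subrX1 opprB.
by rewrite gerBl exprn_ge0// ltW.
Qed.

Let pq m : m%:R <= p m.
Proof. by rewrite /p -natrX ler_nat -[leqLHS]expn1; case: m => // m; rewrite leq_pexp2l. Qed.

Let expN_q m t : m%:R <= t -> expN d t <= q ^+ m.
Proof.
move=> mt; rewrite /q /expN -expRM_natl ler_expR mulrN lerN2 mulrC.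
by rewrite ler_wpM2l// ltW.
Qed.

Let KN N t := \sum_(m < N) c m * k (t - p m).
Let yN N t := \sum_(m < N) c m * F (t - p m).
Let CK := expR (w1 * b) * (1 - q)^-1.

Let KN_le N t : KN N t <= CK * expN w1 t.
Proof.
have -> : CK * expN w1 t = (expR (w1 * b) * expN w1 t) * (1 - q)^-1 by rewrite /CK mulrAC.
apply: le_trans (ler_wpM2l _ (geometric_sum_le N)); last first.
  by rewrite mulr_ge0 ?expR_ge0.
rewrite mulr_sumr; apply: ler_sum => m _.
have [_ /(_ (t - p m))/andP[_ kC]] := dk.
apply: le_trans (ler_wpM2l (ltW (c0 m)) kC) _.
have -> : c m * (expR (w1 * b) * expR (- (w1 * (t - p m)))) =
    expR (w1 * b) * expN w1 t * expN d (p m).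
  rewrite mulrCA -mulrA; congr (_ * _); rewrite /c /expN -!expRD; congr expR; ring.
apply: ler_wpM2l; first by rewrite mulr_ge0 ?expR_ge0.
exact: expN_q.
Qed.

Let term_ge0 m t : 0 <= c m * k (t - p m). Proof. by rewrite mulr_ge0// ltW. Qed.

Let expdom_KN N : expdom w1 CK (KN N).
Proof.
split; last by move=> t; rewrite KN_le andbT sumr_ge0.
apply: measurable_sum => m; apply: measurable_funM => //.
by apply: measurableT_comp; [case: dk|exact: measurable_lag].
Qed.

Let Top_KN N t : Top (KN N) t = yN N t.
Proof.
elim: N => [|N IH].
  rewrite /yN big_ord0 /Top (_ : (fun u => _) = (fun=> 0)).
    by rewrite Rintegral_cst// mul0r.
  by apply/funext => u; rewrite /KN big_ord0 mulr0.
have -> : KN N.+1 = (fun t => KN N t + c N * k (t - p N)).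
  by apply/funext => u; rewrite /KN big_ord_recr.
have ds := expdom_shift (p N) dk.
rewrite (TopD w10 t (expdom_KN N) (expdomZ (ltW (c0 N)) ds)) (TopZ w10 _ t ds).
by rewrite IH (Top_shift _ _ dk) -FE /yN big_ord_recr.
Qed.

Let KN_mono t : {homo (fun N => KN N t) : m n / (m <= n)%N >-> m <= n}.
Proof. by apply/nondecreasing_seqP => N; rewrite /KN big_ord_recr lerDl. Qed.

Let KN_cvg t : cvg (KN N t @[N --> \oo]).
Proof.
apply: nondecreasing_is_cvgn; first exact: KN_mono.
by exists (CK * expN w1 t) => _ [N _ <-]; exact: KN_le.
Qed.

(* Plateaus of length [b - a] are placed after the times [p m = m ^ 2], with
   amplitudes [c m] decaying at a rate strictly between two admissible weights:
   this makes the series converge and the [n]-th term dominate near [p n], from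
   both sides. *)
Definition train t : R := lim (KN N t @[N --> \oo]).
Let K := train.

Let expdom_K : expdom w1 CK K.
Proof. by have [] := Top_dominated_cvg 0 w10 expdom_KN KN_cvg. Qed.

Let yN_cvg t : yN N t @[N --> \oo] --> Top K t.
Proof.
have [_ h] := Top_dominated_cvg t w10 expdom_KN KN_cvg.
by under eq_fun do rewrite -Top_KN.
Qed.

Let KN_le_K N t : KN N t <= K t.
Proof. by apply: nondecreasing_cvgn_le; [exact: KN_mono|exact: KN_cvg]. Qed.

Let yN_le N t : yN N t <= Top K t.
Proof.
apply: (cvgr_to_ge (@yN_cvg t)); exists N => // n /= Nn.
rewrite /yN -(subnKC Nn) big_split_ord /= lerDl.
by apply: sumr_ge0 => i _; rewrite mulr_ge0// ltW.
Qed.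

Let y_gt0 t : 0 < Top K t.
Proof.
pose n := (Num.truncn `|t|).+1; have tn : t <= p n.
  apply: le_trans (pq n); apply: le_trans (ler_norm t) _.
  by apply/ltW; exact: truncnS_gt.
apply: lt_le_trans (yN_le n.+1 t); rewrite /yN big_ord_recr /=.
rewrite ltr_wpDl ?mulr_gt0//; first by apply: sumr_ge0 => i _; rewrite mulr_ge0// ltW.
by apply: lt_le_trans (F_ge1 _); rewrite ?ltr01// subr_le0.
Qed.

Let K_nincr u v : u <= v -> K v <= K u.
Proof.
move=> uv; apply: (ler_cvg_to (@KN_cvg v) (@KN_cvg u)); apply: nearW => N.
by apply: ler_sum => m _; rewrite ler_pM2l// k_nincr// lerB.
Qed.

Let K_ge t : Top K (t - a) <= K t.
Proof.
apply: (ler_cvg_to (@yN_cvg _) (@KN_cvg t)); apply: nearW => N.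
by apply: ler_sum => m _; rewrite ler_pM2l// addrAC k_ge.
Qed.

(** Half a unit before the n-th plateau every plateau is missed: those with m >= n have not begun,
    and an earlier one is at least 2 n - 1 + a - 1/2 > 2 >= b past its base point. *)
Let K_gap n : (2 <= n)%N -> let t := p n + a - 2^-1 in K t = Top K (t - a).
Proof.
move=> n2 t.
have gap m : ~~ (a <= t - p m <= b).
  have [nm|mn] := leqP n m.
    have : p n <= p m by rewrite /p lerXn2r ?nnegrE// ler_nat.
    by move=> h; apply/negP => /andP[]; rewrite /t; lra.
  have : p m + 2 * n%:R - 1 <= p n.
    have : (m%:R : R) <= n%:R - 1 by rewrite lerBrDr natr1 ler_nat.
    have : (0 : R) <= m%:R by []. 
    by rewrite /p; nra.
  have : (2 : R) <= n%:R by rewrite ler_nat.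
  by move=> h1 h2; apply/negP => /andP[]; rewrite /t; move: b2 a0; lra.
apply: (cvg_unique _ (@KN_cvg t)) => //.
have := @yN_cvg (t - a); apply: cvg_trans; apply: near_eq_cvg; apply: nearW => N.
by apply: eq_bigr => m _; rewrite /k (kab_out _ (gap m)) addrAC.
Qed.

Let K_plateau n : c n <= K (p n + b).
Proof.
apply: le_trans (KN_le_K n.+1 _); rewrite /KN big_ord_recr /=.
rewrite [p n + b]addrC addrK /k kab_in ?mulr1 ?lerDr ?sumr_ge0//.
by rewrite lexx ltW.
Qed.

(** Earlier terms are estimated with weight [w2], later ones with [w1]; relative to c n either
    leaves exp (- d |p n - p m|). Squares as base points give |p n - p m| >= n + m, hence a factor
    summable in m and small in n. *)
Let far_term m n : m != n -> c m * F (p n - p m) <= c n * (M * q ^+ n * q ^+ m).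
Proof.
move=> mn; rewrite -mulrA -exprD.
have MF (w : R) : 0 < w -> expR (w * a) <= w ^+ 2 -> expR (w * b) / w ^+ 2 <= M ->
    F (p n - p m) <= M * expN w (p n - p m).
  move=> w0 wa wM; apply: le_trans (Fab_le w0 wa (lexx b) _) _.
  by rewrite ler_wpM2r// ltW// expN_gt0.
have ge w : 0 <= expR (w * b) / w ^+ 2 by rewrite divr_ge0 ?expR_ge0 ?sqr_ge0.
have sq (i j : nat) : (i < j)%N -> (n + m)%N = (i + j)%N -> (n + m)%:R <= p j - p i.
  move=> ij ->; have : (i%:R : R) + 1 <= j%:R by rewrite natr1 ler_nat.
  have : (0 : R) <= i%:R by [].
  by rewrite natrD /p; nra.
rewrite [c n * _]mulrCA.
suff [w [w0 wa wM [t ht wE]]] : exists w : R, [/\ 0 < w, expR (w * a) <= w ^+ 2,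
    expR (w * b) / w ^+ 2 <= M & exists2 t : R, (n + m)%:R <= t &
    c m * expN w (p n - p m) = c n * expN d t].
  apply: le_trans (ler_wpM2l (ltW (c0 m)) (MF w w0 wa wM)) _.
  rewrite [leLHS]mulrCA wE; apply: ler_wpM2l => //.
  by apply: ler_wpM2l; [exact: ltW|exact: expN_q].
move: mn; rewrite neq_ltn => /orP[mn|nm].
- exists w2; split=> //; first by rewrite /M lerDr ge.
  exists (p n - p m); first by apply: sq; rewrite // addnC.
  by rewrite /c /expN -!expRD; congr expR; rewrite /d; field.
- exists w1; split=> //; first by rewrite /M lerDl ge.
  exists (p m - p n); first by apply: sq.
  by rewrite /c /expN -!expRD; congr expR; rewrite /d; field.
Qed.

Let y_peak n h : 0 <= h -> Top K (p n + h) <= c n * (F h + M * q ^+ n / (1 - q)).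
Proof.
move=> h0; apply: (cvgr_to_le (@yN_cvg _)); apply: nearW => N.
apply: le_trans (_ : (n < N)%N%:R * (c n * F h) +
    c n * (M * q ^+ n) * \sum_(m < N) q ^+ m <= _); last first.
  rewrite mulrDr lerD//.
    by rewrite ler_piMl// ?mulr_ge0// ?(ltW (c0 n))//; case: (n < N)%N; rewrite ?lexx ?ler01.
  rewrite !mulrA; apply: ler_wpM2l (geometric_sum_le N).
  by rewrite !mulr_ge0 ?exprn_ge0// ltW.
elim: N => [|N IH]; first by rewrite /yN !big_ord0 mul0r mulr0 addr0.
rewrite /yN !big_ord_recr /= -/(yN N _).
have [nN|nN] := eqVneq n N.
  rewrite -nN ltnn mul0r add0r in IH; rewrite -nN ltnSn mul1r.
  have -> : p n + h - p n = h by rewrite addrAC subrr add0r.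
  rewrite addrC lerD2l; apply: le_trans IH _.
  by rewrite mulrDr lerDl !mulr_ge0 ?exprn_ge0// ltW.
have -> : (n < N.+1)%N = (n < N)%N by rewrite ltnS leq_eqVlt (negbTE nN).
rewrite mulrDr addrA lerD//.
apply: le_trans (_ : c N * F (p n - p N) <= _).
  by rewrite ler_wpM2l ?(ltW (c0 N))// Fn// lerD2r lerDl.
by apply: le_trans (far_term _) _; rewrite 1?eq_sym// -!mulrA.
Qed.

(** In the gaps K t = Top K (t - a), so injectivity gives the lag [a]. At the right end of the n-th
    plateau Top K (tau t) = K t >= c n, while Top K (p n + h) <= c n for large n because F h < 1;
    hence tau t <= p n + h and the lag is at least b - h. *)
Lemma train_delay : exists tau,
  [/\ admissible_delay tau, has_positive_decreasing_solution tau,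
      forall t, a <= t - tau t,
      forall x, exists2 s, x <= s & s - tau s <= a &
      forall x b', b' < b -> exists2 s, x <= s & b' <= s - tau s].
Proof.
have [tau [ad tauE taua ps]] := delay_of_kernel w10 expdom_K y_gt0 K_nincr a0 K_ge.
have nat_above (x : R) : exists2 n, (2 <= n)%N & x <= n%:R.
  exists (Num.truncn `|x|).+2 => //; apply: le_trans (ler_norm x) _.
  by apply/ltW/(lt_le_trans (truncnS_gt _)); rewrite ler_nat.
exists tau; split=> //.
- by move=> t; have := taua t; lra.
- move=> x; have [n n2 xn] := nat_above (x - a + 1).
  exists (p n + a - 2^-1); first by have := pq n; lra.
  have -> : tau (p n + a - 2^-1) = p n + a - 2^-1 - a; last by lra.
  by apply: (Top_inj w10 expdom_K y_gt0); rewrite -tauE K_gap.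
- move=> x b' b'b; pose h := Num.min ((b - b') / 2) (b / 2).
  have b0 : 0 < b by exact: le_lt_trans ab.
  have h0 : 0 < h by rewrite lt_min !divr_gt0// subr_gt0.
  have hb : h < b by rewrite gt_min; apply/orP; right; lra.
  have hb' : b' <= b - h.
    have : h <= (b - b') / 2 by rewrite ge_min lexx.
    lra.
  have Fh : 0 < 1 - F h.
    by rewrite subr_gt0 -E1; apply: (Fab_decr w10 wa1 (lexx b)).
  have cv : M * q ^+ n / (1 - q) @[n --> \oo] --> 0.
    rewrite -(mul0r (1 - q)^-1) -{1}(mulr0 M).
    apply: cvgM; last exact: cvg_cst.
    apply: cvgM; first exact: cvg_cst.
    by apply: cvg_expr; rewrite gtr0_norm.
  have [N _ HN] := cvgr_lt _ cv _ Fh.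
  have [n _ xn] := nat_above (Num.max x N%:R).
  move: xn; rewrite ge_max ler_nat => /andP[xn Nn].
  exists (p n + b); first by have := pq n; lra.
  suff : tau (p n + b) <= p n + h by lra.
  apply: (le_Top_inv w10 expdom_K y_gt0); rewrite -tauE.
  apply: le_trans (y_peak n (ltW h0)) _; apply: le_trans (K_plateau n).
  by rewrite ger_pMr ?c0//; have := HN n Nn; rewrite /=; lra.
Qed.

End PlateauTrain.

Section Sharpness.
Variable R : realType.
Implicit Types (a t : R) (tau : R -> R).
Local Notation e2 := (acrit R).

(** The weight w = e satisfies exp (w a) = w ^ 2 at a = 2 / e, so exp (- e t) is a solution with
    constant lag 2 / e. *)
Lemma sharp_critical : exists tau : R -> R,
  [/\ admissible_delay tau, lag_liminf tau = e2%:E, lag_limsup tau = e2%:E &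
      has_positive_decreasing_solution tau].
Proof.
pose w : R := expR 1; have w0 : 0 < w := expR_gt0 1.
have dw := expdom_expN w.
have T0 t : 0 < Top (expN w) t by rewrite Top_expN// divr_gt0 ?expN_gt0 ?exprn_gt0.
have Tlag t : Top (expN w) (t - e2) = expN w t.
  rewrite Top_expN// expN_shift.
  have -> : expR (w * e2) = w ^+ 2.
    by rewrite acritE mulrCA divff ?gt_eqF// mulr1 -[2]mulr_natr mul1r -expRM_natl mulr1.
  by rewrite mulrAC divff ?mul1r// gt_eqF ?exprn_gt0.
have [|t|tau [ad tauE _ ps]] := @delay_of_kernel R w 1 (expN w) w0 dw T0 _ e2 (ltW (e2_gt0 R)).
- by move=> u v; exact: le_expN.
- by rewrite Tlag.
have lagE t : t - tau t = e2.
  have -> : tau t = t - e2; last by rewrite opprB addrC subrK.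
  by apply: (Top_inj w0 dw T0); rewrite -tauE Tlag.
exists tau; split => //; apply/eqP; rewrite eq_le; apply/andP; split.
- by apply: lag_liminf_le => M; exists M; rewrite ?lagE.
- by apply: (@lag_liminf_ge _ _ _ 0) => t _; rewrite lagE.
- by apply: (@lag_limsup_le _ _ _ 0) => t _; rewrite lagE.
- by apply: lag_limsup_ge => c' M /ltW ?; exists M; rewrite ?lagE.
Qed.

Lemma positive_decreasing_eventually tau :
  has_positive_decreasing_solution tau ->
  has_eventually_positive_decreasing_solution tau.
Proof.
move=> [t0 [J [x [sx x0 xd]]]]; exists t0, J, x; split => //.
have [_ tJ _ _ _] := sx.
have Jt t : t0 <= t -> J t by move=> tt; apply: tJ; rewrite /= in_itv /= tt.
exists t0 => //; split; first by move=> t /Jt; exact: x0.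
move=> u v tu; rewrite le_eqVlt => /predU1P[->//|uv].
by apply/ltW/xd => //; apply: Jt => //; apply: le_trans (ltW uv).
Qed.

Lemma sharp a : 0 <= a <= e2 -> exists tau : R -> R,
  [/\ admissible_delay tau, lag_liminf tau = a%:E,
      lag_limsup tau = (betaf a)%:E & has_positive_decreasing_solution tau].
Proof.
move=> /andP[a0]; rewrite le_eqVlt => /predU1P[->|ae].
  by rewrite betaf_e2; exact: sharp_critical.
have aE : 0 <= a < e2 by rewrite a0.
have [a' [aa' a'e [w10 wa1]]] := weight_exists aE.
(* The train needs two distinct admissible weights for the same [a]; they come from two values
   between [a] and 2 / e. *)
pose a'' := (a' + e2) / 2.
have [a'0 a'e2] := andP a'e.
have ha'' : 0 < a'' < e2 by rewrite /a''; apply/andP; split; lra.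
have aa'' : a <= a'' by rewrite /a''; lra.
have [w0 wa] := weightP ha'' aa''.
have [_ wa'] := weightP a'e (ltW aa').
have ww : 2 / a'' < 2 / a'.
  rewrite ltr_pM2l// ltf_pV2 ?posrE//; last by case/andP: ha''.
  by rewrite /a''; lra.
have b2 : betaf a <= 2.
  have /andP[_] := @betaf_bounds R a ltac:(by rewrite a0 ltW).
  move/le_trans; apply.
  by rewrite -ler_sqr ?nnegrE ?sqrtr_ge0// sqr_sqrtr//; lra.
have E1 : Eab a (betaf a) = 1 by rewrite -EvE Eab_beta.
have [tau [ad ps lo hi top]] := train_delay a0 (betaf_gt aE) b2 E1 w0 ww (ltW wa) (ltW wa').
have infE : lag_liminf tau = a%:E.
  apply/eqP; rewrite eq_le lag_liminf_le//=.
  by apply: (@lag_liminf_ge _ _ _ 0) => t _.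
exists tau; split => //; apply/eqP; rewrite eq_le; apply/andP; split.
  by have [_] := necessity ad (positive_decreasing_eventually ps); rewrite infE.
by apply: lag_limsup_ge => b' M; exact: top.
Qed.

End Sharpness.

Theorem theorem1p4 (R : realType) :
  exists beta : R -> R,
    (* beta is a continuous strictly decreasing map [0, 2/e] -> [2/e, sqrt 2] *)
    [/\ {within `[0, 2 / expR 1]%classic, continuous beta},
        (forall u v : R, 0 <= u -> u < v -> v <= 2 / expR 1 ->
           beta v < beta u),
        (forall a : R, 0 <= a <= 2 / expR 1 ->
           2 / expR 1 <= beta a <= Num.sqrt 2),
        beta 0 = Num.sqrt 2 &
        beta (2 / expR 1) = 2 / expR 1] /\
    (* its values on ]0, 2/e[ *)
    (forall a : R, 0 < a < 2 / expR 1 ->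
       [/\ unique (fun b : R => a < b < Num.sqrt 2 /\ calE a b = 1) (beta a),
           (rpar a * spar a * (1 + dpar a ^+ 2) <= 2 ->
            beta a = 2 * a - 2 * dpar a
              + Num.sqrt (2 * dpar a ^+ 2 + 4 / (rpar a * spar a) - 2)) &
           (2 < rpar a * spar a * (1 + dpar a ^+ 2) ->
            exists2 l : R,
              unique (fun l' : R => 0 < l' <= a /\ Psi a l' = 0) l &
              beta a = a + l)]) /\
    (* the necessary condition *)
    (forall tau : R -> R, admissible_delay tau ->
       has_eventually_positive_decreasing_solution tau ->
       (lag_liminf tau <= (2 / expR 1)%:E)%E /\
       (lag_limsup tau <= (beta (fine (lag_liminf tau)))%:E)%E) /\
    (* sharpness *)
    (forall a : R, 0 <= a <= 2 / expR 1 ->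
       exists tau : R -> R,
         [/\ admissible_delay tau,
             lag_liminf tau = a%:E,
             lag_limsup tau = (beta a)%:E &
             has_positive_decreasing_solution tau]).
Proof.
rewrite -acritE; exists (@betaf R); split.
  split; [exact: betaf_continuous|exact: betaf_decr|exact: betaf_bounds|
    exact: betaf0|exact: betaf_e2].
split; last by split; [move=> tau; exact: necessity|exact: sharp].
move=> a ae; have [a0 aE] := andP ae; have ae' : 0 <= a < acrit R by rewrite ltW.
split; [|exact: betaf_large|exact: betaf_small].
have cE b : calE a b = Ev a b by rewrite EvE calE_Eab// -acritE.
split=> [|b [/andP[ab _]]]; rewrite cE.
  by rewrite betaf_gt// betaf_lt_sqrt2// Eab_beta.
by move=> E1; apply/esym/Eab_eq1.
Qed.
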